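(* Let $\mathbb{H}$ be a non-empty family of finite graphs, each with minimum degree at least $1$ and none isomorphic to a star. For all sufficiently large $n$ (depending on $\mathbb{H}$), every graph in $SPEX(n,\mathbb{H}_{minor})$ contains a spanning book $B_{\gamma_\mathbb{H},n-\gamma_\mathbb{H}}$ (i.e. has a spanning subgraph isomorphic to it). Moreover, as $n\to\infty$, $$\sqrt{\gamma_\mathbb{H} n}+\frac{\gamma_\mathbb{H}-1}{2}+O\Big(\frac{1}{\sqrt{n}}\Big)\leq spex(n,\mathbb{H}_{minor})\leq\sqrt{\gamma_\mathbb{H} n}+\frac{\alpha_\mathbb{H}+\gamma_\mathbb{H}-1}{2}+O\Big(\frac{1}{\sqrt{n}}\Big),$$ where the implied constants depend only on $\mathbb{H}$.
   Context: All graphs are finite and simple; $|G|$ is the number of vertices of $G$ and $\rho(G)$ is its spectral radius (largest adjacency eigenvalue). A graph $H$ is a minor of $G$ if $H$ can be obtained from $G$ by a sequence of vertex deletions, edge deletions and edge contractions. $G$ is $\mathbb{H}$-minor-free if no member of $\mathbb{H}$ is a minor of $G$. $spex(n,\mathbb{H}_{minor})$ is the maximum of $\rho(G)$ over all $n$-vertex $\mathbb{H}$-minor-free graphs $G$, and $SPEX(n,\mathbb{H}_{minor})$ is the set of $n$-vertex $\mathbb{H}$-minor-free graphs attaining this maximum. $\alpha_H$ is the independence number of $H$; $\gamma_H=|H|-\alpha_H-1$ and $\gamma_\mathbb{H}=\min_{H\in\mathbb{H}}\gamma_H$ (so $\gamma_\mathbb{H}\ge 1$ since no member is a star). A member $H$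 of $\mathbb{H}$ is minimal if $\gamma_H=\gamma_\mathbb{H}$ and, among the members with this property, $|H|$ is smallest; all minimal members have the same independence number, denoted $\alpha_\mathbb{H}$. The book $B_{\gamma,m}$ is obtained by joining every vertex of a $\gamma$-clique to every vertex of an independent set of size $m$. *)

(* Defs.v *)
From HB Require Import structures.
From mathcomp Require Import all_boot all_order all_algebra.
From mathcomp Require Import all_classical all_reals all_analysis.
Import Order.TTheory GRing.Theory Num.Theory.
Import numFieldNormedType.Exports.

Set Implicit Arguments.
Unset Strict Implicit.
Unset Printing Implicit Defensive.

Local Open Scope classical_set_scope.
Local Open Scope ring_scope.

(* Families of graphs are plain predicates graph -> Prop: the type graph is too
   large, universe-wise, for the type set of classical_sets. *)
Record graph := Graph {
  vertex :> finType;
  edge : rel vertex;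
  edge_sym : symmetric edge;
  edge_irr : irreflexive edge }.

Definition iso (G H : graph) : Prop :=
  exists2 f : G -> H, bijective f & {mono f : x y / edge x y}.

Section Operations.
Variables (G : graph) (u v : G).

Definition del_vertex_edge : rel {x : G | x != v} :=
  fun x y => edge (val x) (val y).

Lemma del_vertex_sym : symmetric del_vertex_edge.
Proof. by move=> x y; exact: edge_sym. Qed.

Lemma del_vertex_irr : irreflexive del_vertex_edge.
Proof. by move=> x; exact: edge_irr. Qed.

Definition del_vertex : graph := Graph del_vertex_sym del_vertex_irr.

Definition del_edge_edge : rel G :=
  fun x y => edge x y && ((x, y) \notin [:: (u, v); (v, u)]).

Lemma del_edge_sym : symmetric del_edge_edge.
Proof.
move=> x y; rewrite /del_edge_edge edge_sym; congr (_ && ~~ _).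
by rewrite !inE !xpair_eqE orbC (andbC (x == v)) (andbC (x == u)).
Qed.

Lemma del_edge_irr : irreflexive del_edge_edge.
Proof. by move=> x; rewrite /del_edge_edge edge_irr. Qed.

Definition del_edge : graph := Graph del_edge_sym del_edge_irr.

(* The merged vertex is represented by u: it becomes adjacent to every former
   neighbour of u or v, and v disappears. *)
Definition contract_edge : rel {x : G | x != v} :=
  fun x y => (x != y) && [|| edge (val x) (val y),
                             (val x == u) && edge v (val y) |
                             (val y == u) && edge v (val x)].

Lemma contract_sym : symmetric contract_edge.
Proof.
by move=> x y; rewrite /contract_edge eq_sym edge_sym (orbC (_ && edge v (val y))).
Qed.

Lemma contract_irr : irreflexive contract_edge.
Proof. by move=> x; rewrite /contract_edge eqxx. Qed.

Definition contract : graph := Graph contract_sym contract_irr.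

End Operations.

Inductive minor (H : graph) : graph -> Prop :=
| minor_iso (G : graph) : iso H G -> minor H G
| minor_del_vertex (G : graph) (v : G) : minor H (del_vertex v) -> minor H G
| minor_del_edge (G : graph) (u v : G) :
    edge u v -> minor H (del_edge u v) -> minor H G
| minor_contract (G : graph) (u v : G) :
    edge u v -> minor H (contract u v) -> minor H G.

Definition minor_free (HH : graph -> Prop) (G : graph) : Prop :=
  forall H : graph, HH H -> ~ minor H G.

Section Book.
Variables g m : nat.

Definition book_edge : rel ('I_g + 'I_m)%type :=
  fun x y => match x, y with
             | inl i, inl j => i != j
             | inr _, inr _ => false
             | _, _ => true
             end.

Lemma book_sym : symmetric book_edge.
Proof. by move=> [i|i] [j|j] //=; rewrite eq_sym. Qed.

Lemma book_irr : irreflexive book_edge.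
Proof. by move=> [i|i] //=; rewrite eqxx. Qed.

Definition book : graph := Graph book_sym book_irr.

End Book.

(* B_(1, r) is the star K_(1, r). *)
Definition is_star (G : graph) : Prop := exists r : nat, iso G (book 1 r).

Definition has_spanning (B G : graph) : Prop :=
  exists2 f : B -> G, bijective f & {homo f : x y / edge x y}.

Definition degree (G : graph) (x : G) : nat := #|[set y | edge x y]%SET|.

(* Every degree is less than #|G|, so the default value does not affect the
   minimum, except on the graph without vertices, where it yields 0. *)
Definition min_degree (G : graph) : nat :=
  \big[minn/#|G|]_(x : G) degree x.

Definition independent (G : graph) (A : {set G}) : bool :=
  [forall x in A, forall y in A, ~~ edge x y].

Definition indep_number (G : graph) : nat :=
  \max_(A : {set G} | independent A) #|A|.

(* The subtraction is truncated, but #|H| - indep_number H >= 1 as soon as H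
   has an edge. *)
Definition gamma_graph (H : graph) : nat := (#|H| - indep_number H - 1)%N.

Definition nat_min (A : set nat) : nat :=
  xget 0%N [set k | A k /\ forall j, A j -> (k <= j)%N].

Definition gamma (HH : graph -> Prop) : nat :=
  nat_min [set k | exists2 H : graph, HH H & gamma_graph H = k].

Definition minimal (HH : graph -> Prop) (H : graph) : Prop :=
  [/\ HH H, gamma_graph H = gamma HH &
      forall H' : graph, HH H' -> gamma_graph H' = gamma HH ->
        (#|H| <= #|H'|)%N].

(* All minimal members have the same independence number, namely
   #|H| - gamma HH - 1, so the value chosen by xget is the only one. *)
Definition alpha (HH : graph -> Prop) : nat :=
  xget 0%N [set a | exists2 H : graph, minimal HH H & indep_number H = a].

Section Spectral.
Variable R : realType.

Definition adjacency (G : graph) : 'M[R]_#|G| :=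
  \matrix_(i, j) (edge (enum_val i) (enum_val j))%:R.

(* For a graph with at least one vertex this set is finite and nonempty (the
   matrix is real symmetric), so its supremum is the largest eigenvalue. *)
Definition spectral_radius (G : graph) : R :=
  sup [set a : R | eigenvalue (adjacency G) a].

Definition minor_free_order (n : nat) (HH : graph -> Prop) : graph -> Prop :=
  fun G => #|G| = n /\ minor_free HH G.

(* There are finitely many graphs of order n up to isomorphism, so the
   supremum is a maximum. *)
Definition spex (n : nat) (HH : graph -> Prop) : R :=
  sup [set r : R | exists2 G : graph, minor_free_order n HH G &
                                      spectral_radius G = r].

Definition SPEX (n : nat) (HH : graph -> Prop) : graph -> Prop :=
  fun G => minor_free_order n HH G /\ spectral_radius G = spex n HH.

End Spectral.

(* Main.v *)
Require Import Defs.
From HB Require Import structures.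
From mathcomp Require Import all_boot all_order all_algebra.
From mathcomp Require Import all_classical all_reals all_analysis.
(* fintype and finset come last so that the names they share with
   classical_sets refer to finite sets. *)
From mathcomp Require Import fintype finset zify ring lra.
Import Order.TTheory GRing.Theory Num.Theory.
Import numFieldNormedType.Exports.

Set Implicit Arguments.
Unset Strict Implicit.
Unset Printing Implicit Defensive.

(** Write s for gamma HH, a for alpha HH, and let G be an extremal graph of
    large order n, with spectral radius rho.

    A minimal member is contained in the book B_(s+1, a), whereas a minor of
    B_(s, m) has a vertex cover with s vertices; so B_(s+1, a) is not a minor
    of G, and every B_(s, m) is minor-free ([minor_free_no_book],
    [minor_free_book]).  The Rayleigh quotient of a vector that is constant on
    the spine and on the pages of B_(s, n-s) gives the lower bound
    ([book_radius_ge]).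

    Take a Perron vector of G whose largest entry is 1.  Since rho ^ 2 is at
    least s (n - s), counting the walks of length 2 determines its shape.  The
    average degree is bounded because a complete minor is forbidden ([mader]),
    and so is the number of common neighbours of s + 1 vertices; hence only
    boundedly many entries matter ([few_heavy]), and all but boundedly many
    vertices see at most s of them.  It follows that exactly s vertices, forming
    a set K, have entries close to 1, that they are adjacent to almost all
    vertices, and that all other entries are small ([card_dominating],
    [common_dominating], [small_outside]).

    Suppose that some vertex misses a vertex of K, or that K is not a clique.
    Join K to every vertex, and remove all edges outside K at the vertices that
    missed K and at a bounded set W of common neighbours of K whose entries are
    small.  The test vector that raises the entries of the former vertices to
    the value prescribed by their new neighbourhood shows that the spectral
    radius increases ([rewire_lt]).  So K spans the required book, as soon as
    the new graph is known to be minor-free.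

    It is the join of a clique on K with a graph Z and isolated vertices.  In G,
    the vertices of W can be used to make K a clique by contraction and to
    supply w isolated vertices, for a constant w ([cone_minor_model]); the
    question is whether w isolated vertices are as good as arbitrarily many.
    As the family may be infinite this is not a matter of counting vertices of
    its members.  But Z has no star minor K_(1, a), and the graphs without this
    minor are well-quasi-ordered by minors ([starfree_wqo]), so that a constant
    w exists by contradiction ([isolated_vertices_free]).  This special case of
    the graph minor theorem is elementary: a connected graph without a K_(1, t)
    minor becomes a disjoint union of paths on removing a bounded number of
    vertices ([starfree_near_forest]), and labelled paths are dealt with by
    minimal bad sequences ([higman], [path_wqo]).

    For the upper bound, each vertex outside K has fewer than a neighbours
    outside K, again because of B_(s+1, a), and the eigenvalue equations yield
    (rho - s + 1) (rho - a + 1) <= s n ([spanning_radius_le]).  The error terms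
    obtained are - s ^ 2 / sqrt n below and 0 above. *)

(** * Minors as models *)

(** Walks are pushed along a map h that sends each edge to a walk, while an
    invariant P is maintained; connectedness is transported in this way
    throughout. *)
Lemma connect_map (T T' : finType) (e : rel T) (e' : rel T') (P : T -> Prop)
    (h : T -> T') :
  (forall x y, P x -> e x y -> P y /\ connect e' (h x) (h y)) ->
  forall x y, P x -> connect e x y -> P y /\ connect e' (h x) (h y).
Proof.
move=> step x y Px /connectP[p ep ->]; elim: p x Px ep => [|z p IHp] x Px /=.
  by split; last exact: connect0.
case/andP=> exz ep; have [Pz cz] := step _ _ Px exz.
by have [Pl cl] := IHp _ Pz ep; split=> //; exact: connect_trans cz cl.
Qed.

Definition fiber_edge (H G : graph) (phi : G -> option H) : rel G :=
  fun x y => edge x y && (phi x == phi y).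

(** The branch set of y is the fibre of phi over Some y, and None marks the
    deleted vertices. The sets A and B stand for the subgraphs that they
    induce, which saves changing vertex types. *)
Record model (H G : graph) (B : {set H}) (A : {set G}) (phi : G -> option H) :
    Prop := Model {
  model_sub : forall x y, phi x = Some y -> x \in A /\ y \in B;
  model_surj : forall y, y \in B -> exists x, phi x = Some y;
  model_conn : forall x1 x2, phi x1 -> phi x1 = phi x2 ->
    connect (fiber_edge phi) x1 x2;
  model_edge : forall y1 y2, y1 \in B -> y2 \in B -> edge y1 y2 ->
    exists x1 x2, [/\ phi x1 = Some y1, phi x2 = Some y2 & edge x1 x2] }.

Definition minor_model (H G : graph) : Prop :=
  exists phi : G -> option H, model setT setT phi.

Lemma hom_minor_model (H G : graph) (f : H -> G) :
  injective f -> {homo f : x y / edge x y} -> minor_model H G.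
Proof.
move=> f_inj f_hom; pose phi x := [pick y | f y == x].
have phif y : phi (f y) = Some y.
  by rewrite /phi; case: pickP => [z /eqP/f_inj-> //|/(_ y)]; rewrite eqxx.
have phiE x y : phi x = Some y -> f y = x.
  by rewrite /phi; case: pickP => [z /eqP fz [<-]|].
exists phi; split=> [x y|y _|x1 x2|y1 y2 _ _ e12].
- by rewrite !inE.
- by exists (f y).
- case e1: (phi x1) => [y|//] _ /esym e2.
  by rewrite -(phiE _ _ e1) -(phiE _ _ e2) connect0.
- by exists (f y1), (f y2); rewrite !phif; split=> //; exact: f_hom.
Qed.

(** A walk of H lifts to G: inside a branch set because branch sets are
    connected, from one to the next along an edge that realizes the edge of H.
    The predicate P confines the walk of H, and thereby the edges e' that are
    used in G. *)
Lemma connect_lift (H G : graph) (B : {set H}) (A : {set G})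
    (phi : G -> option H) (P : H -> Prop) (e : rel H) (e' : rel G) :
  model B A phi ->
  (forall y, P y -> y \in B) ->
  (forall y z, P y -> e y z -> edge y z /\ P z) ->
  (forall a b y, P y -> phi a = Some y -> phi b = Some y -> edge a b -> e' a b) ->
  (forall a b y z, P y -> e y z -> phi a = Some y -> phi b = Some z ->
     edge a b -> e' a b) ->
  forall y1 y2 x1 x2, P y1 -> connect e y1 y2 ->
    phi x1 = Some y1 -> phi x2 = Some y2 -> connect e' x1 x2.
Proof.
move=> mphi PB eP inner step.
have fib x1 x2 y : P y -> phi x1 = Some y -> phi x2 = Some y -> connect e' x1 x2.
  move=> Py h1 h2; have := model_conn mphi (x1 := x1) (x2 := x2).
  rewrite h1 h2 => /(_ isT erefl).
  case/(connect_map (P := fun x => phi x = Some y) (e' := e') (h := id)) => // a b ha.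
  case/andP=> eab; rewrite ha => /eqP/esym hb; split=> //.
  by apply: connect1; exact: inner Py ha hb eab.
move=> y1 y2 x1 x2 Py /connectP[p ep ->]; elim: p y1 x1 Py ep => [|z p IHp] y1 x1 Py /=.
  by move=> _; exact: fib.
case/andP=> e1z ep h1 h2; have [e1 Pz] := eP _ _ Py e1z.
have [a [b [ha hb eab]]] := model_edge mphi (PB _ Py) (PB _ Pz) e1.
apply: connect_trans (fib _ a _ Py h1 ha) _.
by apply: connect_trans (IHp _ b Pz ep hb h2); apply: connect1; exact: step Py e1z ha hb eab.
Qed.

(** A branch set of the composite is the union of the branch sets of phi over
    a branch set of psi; it is connected by [connect_lift]. *)
Lemma model_comp (G H K : graph) (C : {set K}) (B : {set H}) (A : {set G})
    (psi : H -> option K) (phi : G -> option H) :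
  model C B psi -> model B A phi -> model C A (fun x => obind psi (phi x)).
Proof.
move=> mpsi mphi; set chi := fun x => obind psi (phi x).
have chiE x z : chi x = Some z -> exists2 y, phi x = Some y & psi y = Some z.
  by rewrite /chi; case: (phi x) => //= y; exists y.
split=> [x z|z Cz|x1 x2|z1 z2 C1 C2 e12].
- by case/chiE=> y /(model_sub mphi)[Ax _] /(model_sub mpsi)[].
- have [y py] := model_surj mpsi Cz; have [By _] := model_sub mpsi py.
  by have [x px] := model_surj mphi By; exists x; rewrite /chi px.
- case e1: (chi x1) => [z|//] _ /esym e2.
  have [y1 h1 k1] := chiE _ _ e1; have [y2 h2 k2] := chiE _ _ e2.
  apply: (connect_lift (P := fun y => psi y) (e := fiber_edge psi) mphi _ _ _ _
    _ _ h1 h2).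
  + by move=> y; case E: (psi y) => [w|//] _; have [] := model_sub mpsi E.
  + by move=> y w py /andP[-> /eqP <-].
  + by move=> a b y _ ha hb eab; rewrite /fiber_edge eab /chi ha hb eqxx.
  + move=> a b y w _ /andP[_ pyw] ha hb eab.
    by rewrite /fiber_edge eab /chi ha hb.
  + by rewrite k1.
  + by apply: (model_conn mpsi); rewrite k1 ?k2.
- have [y1 [y2 [p1 p2 e']]] := model_edge mpsi C1 C2 e12.
  have [B1 _] := model_sub mpsi p1; have [B2 _] := model_sub mpsi p2.
  have [x1 [x2 [q1 q2 e'']]] := model_edge mphi B1 B2 e'.
  by exists x1, x2; rewrite /chi q1 q2.
Qed.

Lemma minor_model_trans (G H K : graph) :
  minor_model K H -> minor_model H G -> minor_model K G.
Proof.
move=> [psi mpsi] [phi mphi]; exists (fun x => obind psi (phi x)).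
exact: model_comp mpsi mphi.
Qed.

Section ContractMap.
Variables (G : graph) (u v : G).
Hypothesis nuv : u != v.

(** The default value of insubd is taken at v only, so that v is sent to the
    vertex that represents the merged one. *)
Definition contract_map (x : G) : Defs.contract u v := insubd (Sub u nuv) x.

Lemma val_contract_map x : val (contract_map x) = if x == v then u else x.
Proof. by rewrite /contract_map val_insubd; case: eqP. Qed.

Lemma contract_map_val (y : Defs.contract u v) : contract_map (val y) = y.
Proof. by rewrite /contract_map valKd. Qed.

Lemma contract_map_eq x y : contract_map x = contract_map y ->
  [\/ x = y, x = u /\ y = v | x = v /\ y = u].
Proof.
move/(congr1 val); rewrite !val_contract_map.
case: eqP => [->|_]; case: eqP => [->|_] E; first by apply: Or31.
- by apply: Or33.
- by apply: Or32.
- by apply: Or31.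
Qed.

Lemma contract_map_edge x y : edge x y -> contract_map x != contract_map y ->
  edge (contract_map x) (contract_map y).
Proof.
move=> exy nxy; rewrite /= /contract_edge nxy /= !val_contract_map.
have [xv|xv] := eqVneq x v; have [yv|yv] := eqVneq y v.
- by move: nxy; rewrite xv yv eqxx.
- by move: exy; rewrite xv => ->; rewrite eqxx orbT.
- by move: exy; rewrite yv (edge_sym x) => ->; rewrite eqxx !orbT.
- by rewrite exy.
Qed.

Lemma contract_map_edgeP (a b : Defs.contract u v) : edge a b ->
  exists x y, [/\ contract_map x = a, contract_map y = b & edge x y].
Proof.
have cv : contract_map v = Sub u nuv.
  by apply: val_inj; rewrite val_contract_map eqxx.
case/andP=> _ /or3P[e|/andP[/eqP au e]|/andP[/eqP bu e]].
- by exists (val a), (val b); rewrite !contract_map_val.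
- exists v, (val b); rewrite contract_map_val cv; split=> //; exact: val_inj.
- exists (val a), v; rewrite contract_map_val cv edge_sym; split=> //; exact: val_inj.
Qed.

End ContractMap.

Lemma edge_neq (G : graph) (u v : G) : edge u v -> u != v.
Proof. by apply: contraTneq => ->; rewrite edge_irr. Qed.

Lemma contract_minor_model (G : graph) (u v : G) :
  edge u v -> minor_model (Defs.contract u v) G.
Proof.
move=> euv; have nuv := edge_neq euv; pose h := contract_map nuv.
exists (fun x => Some (h x)); split=> [x y|y _|x1 x2 _ [h12]|y1 y2 _ _].
- by rewrite !inE.
- by exists (val y); rewrite /h contract_map_val.
- case: (contract_map_eq h12) => [->|[-> ->]|[-> ->]]; first exact: connect0.
    apply: connect1; rewrite /fiber_edge euv /= /h; apply/eqP; congr Some.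
    by apply: val_inj; rewrite !val_contract_map eqxx (negPf nuv).
  apply: connect1; rewrite /fiber_edge edge_sym euv /= /h; apply/eqP; congr Some.
  by apply: val_inj; rewrite !val_contract_map eqxx (negPf nuv).
- by move=> /(contract_map_edgeP nuv)[x [y [<- <- e]]]; exists x, y.
Qed.

Lemma minor_modelP (H G : graph) : minor H G -> minor_model H G.
Proof.
elim=> {}G => [[f f_bij f_mono]|v _ IH|u v euv _ IH|u v euv _ IH].
- apply: (@hom_minor_model _ _ f); first exact: bij_inj.
  by move=> x y; rewrite f_mono.
- apply: minor_model_trans IH _.
  by apply: (@hom_minor_model (del_vertex v) G val) => //; exact: val_inj.
- apply: minor_model_trans IH _.
  by apply: (@hom_minor_model (del_edge u v) G id) => // x y /andP[].
- exact: minor_model_trans IH (contract_minor_model euv).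
Qed.

Lemma card_predC1 (T : finType) (v : T) : #|{: {x : T | x != v}}|.+1 = #|T|.
Proof.
rewrite card_sig (eq_card (B := predC1 v)) // cardC1 prednK //.
by apply/card_gt0P; exists v.
Qed.

(** Induction on the number of vertices and arcs of G. A vertex outside the
    branch sets is deleted, and an edge inside a branch set is contracted.
    When there is neither, phi is bijective, and the edges of G that H lacks
    are deleted one by one. *)
Lemma minor_of_model (H G : graph) : minor_model H G -> minor H G.
Proof.
have [m] := ubnP (#|G| + #|[set p : G * G | edge p.1 p.2]|).
elim: m G => // m IHm G leGm [phi mphi].
have [[v /eqP phiv]|noNone] := altP (@existsP _ (fun v => phi v == None)).
  apply: (@minor_del_vertex _ _ v); apply: IHm.
    rewrite -ltnS; apply: leq_trans leGm; rewrite ltnS -addSn card_predC1 leq_add //.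
    rewrite -(card_imset _ (_ : injective (fun p => (val p.1, val p.2)))).
      by apply/subset_leq_card/subsetP=> _ /imsetP[p + ->]; rewrite !inE.
    by case=> [a b] [c d] [] /val_inj-> /val_inj->.
  exists (fun x => phi (val x)); split=> [x y|y _|x1 x2|y1 y2 _ _ e12].
  - by rewrite !inE.
  - have [x px] := model_surj mphi (in_setT y).
    have xv : x != v by apply/eqP=> E; rewrite E phiv in px.
    by exists (Sub x xv).
  - move=> p1 p12; have c12 := model_conn mphi p1 p12.
    have := connect_map (P := fun x => phi x = phi (val x1))
      (e' := fiber_edge (fun x : del_vertex v => phi (val x)))
      (h := insubd x1) _ (erefl _) c12.
    rewrite !valKd; case=> // a b pa /andP[eab /eqP pab]; split; first by rewrite -pab.
    apply: connect1; rewrite /fiber_edge /= /del_vertex_edge !val_insubd.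
    have av : a != v by apply: contraTneq p1 => E; rewrite -pa E phiv.
    have bv : b != v by apply: contraTneq p1 => E; rewrite -pa pab E phiv.
    by rewrite av bv eab pab eqxx.
  - have [a [b [pa pb eab]]] :=
      model_edge mphi (in_setT y1) (in_setT y2) e12.
    have av : a != v by apply/eqP=> E; rewrite E phiv in pa.
    have bv : b != v by apply/eqP=> E; rewrite E phiv in pb.
    by exists (Sub a av), (Sub b bv).
have phiS x : phi x by case E: (phi x) => //; case/existsP: noNone; exists x; rewrite E.
have [/existsP[u /existsP[v /andP[euv /eqP puv]]]|noE] :=
    boolP [exists u, exists v, fiber_edge phi u v].
  have nuv := edge_neq euv; pose h := contract_map nuv.
  have hV (x : Defs.contract u v) : h (val x) = x by exact: contract_map_val.
  have ph x : phi (val (h x)) = phi x.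
    by rewrite val_contract_map; case: eqP => // ->.
  have he x y : edge x y -> h x != h y -> edge (h x) (h y).
    exact: contract_map_edge.
  apply: (@minor_contract _ _ u v euv); apply: IHm.
    rewrite -ltnS; apply: leq_trans leGm; rewrite ltnS -addSn card_predC1 leq_add //.
    apply: leq_trans (leq_imset_card (fun p => (h p.1, h p.2)) _).
    apply/subset_leq_card/subsetP=> -[a b]; rewrite inE /= => eab.
    have [x [y [<- <- exy]]] := contract_map_edgeP nuv eab.
    by apply/imsetP; exists (x, y); rewrite ?inE.
  exists (fun x => phi (val x)); split=> [x y|y _|x1 x2|y1 y2 _ _ e12].
  - by rewrite !inE.
  - have [x px] := model_surj mphi (in_setT y).
    by exists (h x); rewrite ph.
  - move=> p1 p12; have c12 := model_conn mphi p1 p12.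
    have := connect_map (P := fun=> True)
      (e' := fiber_edge (fun x : Defs.contract u v => phi (val x)))
      (h := h) _ I c12.
    rewrite !hV; case=> // a b _ /andP[eab /eqP pab]; split=> //.
    have [->|nab] := eqVneq (h a) (h b); first exact: connect0.
    by apply: connect1; rewrite /fiber_edge !ph pab eqxx andbT; exact: he.
  - have [a [b [pa pb eab]]] :=
      model_edge mphi (in_setT y1) (in_setT y2) e12.
    exists (h a), (h b); rewrite !ph; split=> //; apply: he => //.
    apply: contraTneq e12 => hab; move: pb; rewrite -ph -hab ph pa => -[->].
    by rewrite edge_irr.
(* Every fibre is now a single vertex. *)
have phi_inj : injective phi.
  move=> x y pxy; have /connectP[[|z p] /=] := model_conn mphi (phiS x) pxy.
    by move=> _ ->.
  case/andP=> exz _ _; case/negP: noE.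
  by apply/existsP; exists x; apply/existsP; exists z.
have /choice[g pg] : forall x, exists y, phi x = Some y.
  by move=> x; case: (phi x) (phiS x) => // y _; exists y.
have /choice[f gf] : forall y, exists x, phi x = Some y.
  by move=> y; exact: (model_surj mphi (in_setT y)).
have gK : cancel g f by move=> x; apply: phi_inj; rewrite gf pg.
have fK : cancel f g by move=> y; apply: Some_inj; rewrite -pg gf.
have f_hom : {homo f : x y / edge x y}.
  move=> x y exy; have [a [b [pa pb eab]]] :=
    model_edge mphi (in_setT x) (in_setT y) exy.
  by move: pa pb; rewrite -!gf => /phi_inj <- /phi_inj <-.
(* Edges of G that are absent from H are deleted. *)
have [/existsP[u /existsP[v /andP[euv nuv]]]|noD] :=
    boolP [exists u, exists v, edge u v && ~~ edge (g u) (g v)].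
  apply: (@minor_del_edge _ _ u v euv); apply: IHm.
    rewrite -ltnS; apply: leq_trans leGm; rewrite ltnS -addnS leq_add //.
    apply/proper_card/properP; split.
      by apply/subsetP=> p; rewrite !inE => /andP[].
    by exists (u, v); rewrite !inE //= /del_edge_edge !inE eqxx andbF.
  apply: (@hom_minor_model H (del_edge u v) f); first exact: can_inj fK.
  move=> x y exy; rewrite /= /del_edge_edge f_hom //= !inE !xpair_eqE.
  apply/norP; split; apply: contra nuv => /andP[/eqP<- /eqP<-]; rewrite !fK //.
  by rewrite edge_sym.
apply: minor_iso; exists f; first by exists g.
move=> x y; apply/idP/idP; last exact: f_hom.
move=> exy; apply: contraR noD => nxy.
by apply/existsP; exists (f x); apply/existsP; exists (f y); rewrite exy !fK.
Qed.

(** * Well-quasi-orders *)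

Definition wqo_on (T : Type) (P : T -> Prop) (R : T -> T -> Prop) : Prop :=
  forall f : nat -> T, (forall i, P (f i)) -> exists i j, i < j /\ R (f i) (f j).

Definition trans_on (T : Type) (P : T -> Prop) (R : T -> T -> Prop) : Prop :=
  forall x y z, P x -> P y -> P z -> R x y -> R y z -> R x z.

Lemma strict_mono_of_succ (g : nat -> nat) :
  (forall n, g n < g n.+1) -> forall i j, i < j -> g i < g j.
Proof. by move=> gS; exact: (homo_ltn ltn_trans gS). Qed.

(** Call a term terminal if no later term is above it. Infinitely many
    terminal terms would form a bad sequence; beyond the last terminal term, a
    monotone subsequence is built greedily. *)
Lemma wqo_subsequence (T : Type) (P : T -> Prop) (R : T -> T -> Prop) :
  wqo_on P R -> trans_on P R -> forall f : nat -> T, (forall i, P (f i)) ->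
  exists g : nat -> nat, (forall i j, i < j -> g i < g j) /\
    (forall i j, i < j -> R (f (g i)) (f (g j))).
Proof.
move=> wR tR f Pf; pose terminal i := forall j, i < j -> ~ R (f i) (f j).
have [N finT] : exists N, forall i, N <= i -> ~ terminal i.
  apply: contrapT => noN.
  have /choice[t tP] : forall N, exists i, N <= i /\ terminal i.
    move=> N; apply: contrapT => noi; apply: noN; exists N => i Ni ti.
    by apply: noi; exists i.
  pose g := fix g n := if n is m.+1 then t (g m).+1 else t 0.
  have gS n : g n < g n.+1 by case: (tP (g n).+1).
  have gt n : terminal (g n) by case: n => [|n]; [case: (tP 0)|case: (tP (g n).+1)].
  have [i [j [ij Rij]]] := wR (f \o g) (fun=> Pf _).
  by apply: (gt i (g j)) => //; exact: strict_mono_of_succ.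
have /choice[t tP] : forall i, exists j, N <= i -> i < j /\ R (f i) (f j).
  move=> i; have [Ni|] := leqP N i; last by exists 0.
  apply: contrapT => noj; apply: (finT i Ni) => j ij Rij.
  by apply: noj; exists j.
pose g n := iter n t N.
have gN n : N <= g n.
  by elim: n => //= n IH; have [/ltnW + _] := tP _ IH; exact: leq_trans.
have gS n : g n < g n.+1 by have [] := tP _ (gN n).
exists g; split; first exact: strict_mono_of_succ.
move=> i j; elim: j => // j IH; rewrite ltnS leq_eqVlt.
have Rj : R (f (g j)) (f (g j.+1)) by have [] := tP _ (gN j).
by case/predU1P => [->//|/IH Rij]; exact: tR Rij Rj.
Qed.

Lemma wqo_prod (T U : Type) (P : T -> Prop) (Q : U -> Prop)
    (R : T -> T -> Prop) (S : U -> U -> Prop) :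
  wqo_on P R -> trans_on P R -> wqo_on Q S ->
  forall (f : nat -> T) (h : nat -> U), (forall i, P (f i)) ->
    (forall i, Q (h i)) ->
  exists i j, [/\ i < j, R (f i) (f j) & S (h i) (h j)].
Proof.
move=> wR tR wS f h Pf Qh; have [g [gmono Rg]] := wqo_subsequence wR tR Pf.
have [i [j [ij Sij]]] := wS (h \o g) (fun=> Qh _).
by exists (g i), (g j); split=> //; [exact: gmono|exact: Rg].
Qed.

Lemma wqo_finite (T : finType) : wqo_on (fun _ : T => True) eq.
Proof.
move=> f _; pose h (i : 'I_#|T|.+1) := f i.
have /injectivePn[i [j nij hij]] : ~~ injectiveb h.
  by apply/negP=> /injectiveP/leq_card; rewrite card_ord ltnn.
have [ij|ji|/val_inj ij] := ltngtP i j; last by rewrite ij eqxx in nij.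
  by exists i, j.
by exists j, i.
Qed.

Lemma trans_on_eq (T : Type) : trans_on (fun _ : T => True) eq.
Proof. by move=> x y z _ _ _ ->. Qed.

(** Nash-Williams' minimal bad sequence. Its n-th term has the least size
    among the bad sequences that share the n terms already chosen; a diagonal
    through the successive choices is bad again. *)
Lemma min_bad_sequence (T : Type) (P : T -> Prop) (R : T -> T -> Prop)
    (size : T -> nat) :
  let bad f := (forall i, P (f i)) /\ (forall i j, i < j -> ~ R (f i) (f j)) in
  (exists f, bad f) ->
  exists m, bad m /\ forall n g, bad g -> (forall i, i < n -> g i = m i) ->
    size (m n) <= size (g n).
Proof.
move=> bad [f0 bad0].
pose agree n (f g : nat -> T) := forall i, i < n -> g i = f i.
have improve (f : nat -> T) n : exists g, bad f -> [/\ bad g, agree n f g &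
    forall g', bad g' -> agree n f g' -> size (g n) <= size (g' n)].
  have [bf|] := EM (bad f); last by exists f.
  suff: forall k g, bad g -> agree n f g -> size (g n) <= k ->
      exists g, [/\ bad g, agree n f g & forall g', bad g' -> agree n f g' ->
        size (g n) <= size (g' n)].
    by move=> /(_ _ f bf (fun _ _ => erefl) (leqnn _)) [g h]; exists g.
  elim=> [|k IH] g bg ag leg.
    by exists g; split=> // g' _ _; exact: leq_trans leg _.
  have [[g' [bg' ag' lt]]|no] :=
      EM (exists g', [/\ bad g', agree n f g' & size (g' n) < size (g n)]).
    by apply: (IH g' bg' ag'); rewrite -ltnS; exact: leq_trans lt leg.
  exists g; split=> // g' bg' ag'; rewrite leqNgt; apply/negP=> lt.
  by apply: no; exists g'.
have /choice[F FP] : forall fn : (nat -> T) * nat, exists g, bad fn.1 ->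
    [/\ bad g, agree fn.2 fn.1 g & forall g', bad g' -> agree fn.2 fn.1 g' ->
      size (g fn.2) <= size (g' fn.2)].
  by case=> f n; exact: improve.
pose seq_ := fix seq_ n := if n is m.+1 then F (seq_ m, m) else f0.
have badS n : bad (seq_ n) by elim: n => // n /(FP (_, n))[].
have agreeS n : agree n (seq_ n) (seq_ n.+1).
  by move=> i lin; have [_ ag _] := FP (seq_ n, n) (badS n); exact: ag.
have stable k n i : i < n -> seq_ (n + k) i = seq_ n i.
  move=> lin; elim: k => [|k IH]; first by rewrite addn0.
  by rewrite addnS agreeS ?IH // (leq_trans lin) // leq_addr.
pose m n := seq_ n.+1 n.
have mE n i : i < n -> m i = seq_ n i.
  by move=> lin; rewrite /m -(stable (n - i.+1) i.+1) // subnKC.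
exists m; split=> [|n g bg ag].
  split=> [i|i j ij]; first by have [Pi _] := badS i.+1; exact: Pi.
  by rewrite (mE j.+1 i) ?(leq_trans ij) // (mE j.+1 j) //; have [_] := badS j.+1; exact.
have [_ _ /(_ g bg)] := FP (seq_ n, n) (badS n); apply.
by move=> i lin; rewrite ag // (mE n).
Qed.

(** Higman's lemma, for objects x that decompose into a head h and a smaller
    tail t. In a minimal bad sequence the heads have a monotone subsequence,
    indexed by g. Follow the terms before g 0 by the tails along g: by
    minimality this is not a bad sequence. But a comparison in it carries over
    to the minimal bad sequence, because whatever is below a tail is below the
    whole object, and comparable tails under comparable heads make comparable
    objects. *)
Lemma higman (T U : Type) (P : T -> Prop) (R : T -> T -> Prop)
    (Q : U -> Prop) (S : U -> U -> Prop) (size : T -> nat)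
    (D : T -> U -> T -> Prop) :
  wqo_on Q S -> trans_on Q S ->
  (forall x, P x -> (forall y, P y -> R x y) \/ exists h t, D x h t) ->
  (forall x h t, P x -> D x h t -> [/\ size t < size x, P t & Q h]) ->
  (forall x y h t, P x -> P y -> D x h t -> R y t -> R y x) ->
  (forall x y h h' t t', P x -> P y -> D x h t -> D y h' t' ->
     S h h' -> R t t' -> R x y) ->
  wqo_on P R.
Proof.
move=> wS tS decomp Dsmall Dmono Dglue; apply: contrapT => nwqo.
have [|m [[Pm badm] minm]] := @min_bad_sequence T P R size.
  apply: contrapT => nobad; apply: nwqo => f Pf.
  apply: contrapT => nogood; apply: nobad; exists f; split=> // i j ij Rij.
  by apply: nogood; exists i, j.
have /choice[h /choice[t Dm]] : forall i, exists h t, D (m i) h t.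
  move=> i; case: (decomp _ (Pm i)) => // /(_ _ (Pm i.+1)) Ri.
  by case: (badm i i.+1).
have Qh i : Q (h i) by case: (Dsmall _ _ _ (Pm i) (Dm i)).
have Pt i : P (t i) by case: (Dsmall _ _ _ (Pm i) (Dm i)).
have [g [gmono Sg]] := wqo_subsequence wS tS Qh.
(* The terms before g 0, then the tails along g. *)
pose z i := if i < g 0 then m i else t (g (i - g 0)).
suff bz : (forall i, P (z i)) /\ (forall i j, i < j -> ~ R (z i) (z j)).
  have := minm (g 0) z bz; rewrite leqNgt /z ltnn subnn => /(_ _)/negP; apply.
    by move=> i ->.
  by case: (Dsmall _ _ _ (Pm (g 0)) (Dm (g 0))).
have gle k : g 0 <= g k by case: k => // k; exact/ltnW/gmono.
split=> [i|i j ij]; first by rewrite /z; case: ifP.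
rewrite /z; case: ltnP => gi; case: ltnP => gj.
- exact: badm.
- move=> /(Dmono _ _ _ _ (Pm _) (Pm _) (Dm _)); apply: badm.
  exact: leq_trans gi (gle _).
- by have := leq_trans gj gi; rewrite leqNgt ltnS ltnW.
- have lt : i - g 0 < j - g 0 by rewrite ltn_sub2r // (leq_ltn_trans gi ij).
  move=> Rt; apply: (badm (g (i - g 0)) (g (j - g 0))); first exact: gmono.
  exact: (Dglue _ _ _ _ _ _ (Pm _) (Pm _) (Dm _) (Dm _) (Sg _ _ lt) Rt).
Qed.

(** * Labelled pieces, glued from components and paths *)

Definition within (G : graph) (A : {set G}) : rel G :=
  fun x y => [&& x \in A, y \in A & edge x y].

Definition nbrs_in (G : graph) (A : {set G}) (x : G) : {set G} :=
  [set y in A | edge x y].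

Definition connected_in (G : graph) (A : {set G}) : Prop :=
  forall x y, x \in A -> y \in A -> connect (within A) x y.

Lemma connect_within_sym (G : graph) (A : {set G}) :
  connect_sym (within A).
Proof. by apply: sym_connect_sym => x y; rewrite /within edge_sym andbCA. Qed.

Lemma fiber_edge_sym (H G : graph) (phi : G -> option H) :
  symmetric (fiber_edge phi).
Proof. by move=> x y; rewrite /fiber_edge edge_sym eq_sym. Qed.

Definition component (G : graph) (A : {set G}) (a : G) : {set G} :=
  [set y in A | connect (within A) a y].

Lemma component_sub (G : graph) (A : {set G}) (a : G) : component A a \subset A.
Proof. by apply/subsetP=> x; rewrite inE => /andP[]. Qed.

Lemma component_self (G : graph) (A : {set G}) (a : G) :
  a \in A -> a \in component A a.
Proof. by rewrite inE connect0 andbT. Qed.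

Lemma component_edge (G : graph) (A : {set G}) (a x y : G) :
  y \in A -> x \in component A a -> edge x y -> y \in component A a.
Proof.
rewrite !inE => Ay /andP[Ax cax] exy; rewrite Ay (connect_trans cax) //.
by apply: connect1; rewrite /within Ax Ay.
Qed.

Lemma component_connected (G : graph) (A : {set G}) (a : G) :
  a \in A -> connected_in (component A a).
Proof.
move=> Aa.
suff h x : x \in component A a -> connect (within (component A a)) a x.
  by move=> x y /h + /h; rewrite connect_within_sym; exact: connect_trans.
rewrite inE => /andP[_]; case/(connect_map (P := fun x => x \in component A a)
  (e' := within (component A a)) (h := id)) => //; last exact: component_self.
move=> y z Cy /and3P[_ Az eyz]; have Cz := component_edge Az Cy eyz.
by split=> //; apply: connect1; rewrite /within Cy Cz.
Qed.

Lemma connect_outside_component (G : graph) (A : {set G}) (a x y : G) :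
  x \in A :\: component A a -> connect (within A) x y ->
  y \in A :\: component A a /\ connect (within (A :\: component A a)) x y.
Proof.
move=> Bx; set B := A :\: _ in Bx *.
case/(connect_map (P := fun x => x \in B) (e' := within B) (h := id)) => // z w.
move=> Bz /and3P[Az Aw ezw].
have Bw : w \in B.
  rewrite inE Aw andbT; move: Bz; rewrite inE Az andbT; apply: contra => Cw.
  by apply: component_edge Cw _; rewrite // edge_sym.
by split=> //; apply: connect1; rewrite /within Bz Bw.
Qed.

Lemma connect_fiber_ext (H G : graph) (phi psi : G -> option H) x y :
  (forall z, phi z -> psi z = phi z) -> phi x ->
  connect (fiber_edge phi) x y -> connect (fiber_edge psi) x y.
Proof.
move=> ext px; case/(connect_map (P := fun x => phi x)
  (e' := fiber_edge psi) (h := id)) => // z w pz /andP[ezw /eqP pzw].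
have pw : phi w by rewrite -pzw.
by split=> //; apply: connect1; rewrite /fiber_edge ezw !ext // pzw eqxx.
Qed.

(** The subgraph induced by pset, each vertex of which carries a set of
    labels. In the minor order below, a vertex may take its labels from
    anywhere in its branch set. *)
Record piece (L : finType) := Piece {
  pgraph :> graph;
  pset : {set pgraph};
  plab : pgraph -> {set L} }.

Definition sub_piece (L : finType) (X : piece L) (A : {set X}) : piece L :=
  Piece A (@plab L X).

Definition lmodel (L : finType) (X Y : piece L) (phi : Y -> option X) : Prop :=
  model (pset X) (pset Y) phi /\
  forall y i, y \in pset X -> i \in plab y ->
    exists x, phi x = Some y /\ i \in plab x.

Definition lminor (L : finType) (X Y : piece L) : Prop :=
  exists phi : Y -> option X, lmodel phi.

Lemma lminor_trans (L : finType) (P : piece L -> Prop) : trans_on P (@lminor L).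
Proof.
move=> X Y Z _ _ _ [psi [mpsi lpsi]] [phi [mphi lphi]].
exists (fun x => obind psi (phi x)); split; first exact: model_comp mpsi mphi.
move=> z i Xz /(lpsi _ _ Xz)[y [py iy]]; have [Yy _] := model_sub mpsi py.
by have [x [px ix]] := lphi _ _ Yy iy; exists x; rewrite px.
Qed.

Lemma lmodel_empty (L : finType) (X Y : piece L) :
  pset X = set0 -> lmodel (fun _ : Y => None : option X).
Proof.
by move=> X0; split; [split=> // [y|y1 y2]|move=> y i]; rewrite X0 inE.
Qed.

(** Models of two parts without edges in between can be put side by side. So
    [higman] applies, with the part split off as the head and the rest as the
    tail. *)
Lemma glue_wqo (L : finType) (P Q : piece L -> Prop) :
  wqo_on Q (@lminor L) ->
  (forall X, P X -> pset X = set0 \/ exists A : {set X},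
     [/\ A \subset pset X, A != set0,
         forall x y, x \in A -> y \in pset X :\: A -> ~~ edge x y,
         Q (sub_piece A) & P (sub_piece (pset X :\: A))]) ->
  wqo_on P (@lminor L).
Proof.
move=> wQ split_P.
pose D (X h t : piece L) := exists A : {set X},
  [/\ A \subset pset X, A != set0,
      forall x y, x \in A -> y \in pset X :\: A -> ~~ edge x y &
      [/\ Q (sub_piece A), P (sub_piece (pset X :\: A)),
          h = sub_piece A & t = sub_piece (pset X :\: A)]].
apply: (@higman _ _ P _ Q _ (fun X => #|pset X|) D wQ) => //.
- exact: lminor_trans.
- move=> X /split_P[X0|[A [sA A0 nA QA PA]]]; last first.
    by right; exists (sub_piece A), (sub_piece (pset X :\: A)), A.
  by left=> Y _; exists (fun=> None); exact: lmodel_empty.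
- move=> X h t _ [A [sA A0 _ [QA PA -> ->]]]; split=> //=.
  rewrite -(cardsID A (pset X)) (finset.setIidPr sA) -[leqLHS]add1n leq_add2r.
  by rewrite card_gt0.
- move=> X Y h t _ _ [A [sA _ _ [_ _ _ ->]]] [phi [mphi lphi]].
  exists phi; split=> //; case: mphi => [s1 s2 s3 s4]; split=> // x y /s1[].
  by rewrite inE => /andP[].
move=> X Y h h' t t' _ _ [A [sA _ nA [_ _ -> ->]]] [B [sB _ nB [_ _ -> ->]]].
move=> [phi [mphi lphi]] [psi [mpsi lpsi]].
pose chi y : option X := if y \in B then phi y else psi y.
have phiB y : phi y -> y \in B.
  by case E: (phi y) => [x|//] _; case: (model_sub mphi E).
have psiB y : psi y -> y \in pset Y :\: B.
  by case E: (psi y) => [x|//] _; case: (model_sub mpsi E).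
have chi1 y : phi y -> chi y = phi y by rewrite /chi => /phiB ->.
have chi2 y : psi y -> chi y = psi y.
  by move=> /psiB; rewrite inE /chi => /andP[/negPf->].
have chiA y x : chi y = Some x -> if x \in A then phi y = Some x else psi y = Some x.
  rewrite /chi; case: ifP => yB E; first by have [_ ->] := model_sub mphi E.
  by have [_] := model_sub mpsi E; rewrite inE => /andP[/negPf->].
have sX x : x \in pset X -> x \in A \/ x \in pset X :\: A.
  by move=> Xx; case: (boolP (x \in A)) => Ax; [left|right; rewrite inE Ax].
exists chi; split; last first.
  move=> x i /sX[Ax|Ax] ix.
    by have [y [py iy]] := lphi _ _ Ax ix; exists y; rewrite chi1 ?py.
  by have [y [py iy]] := lpsi _ _ Ax ix; exists y; rewrite chi2 ?py.
split=> [y x|x /sX[Ax|Ax]|y1 y2|x1 x2].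
- move/chiA; case: ifP => xA /(model_sub)=> [/(_ _ _ mphi)|/(_ _ _ mpsi)] [Sy Sx].
    by rewrite (subsetP sB) ?(subsetP sA).
  by move: Sy Sx; rewrite !inE => /andP[_ ->] /andP[_ ->].
- by have [y py] := model_surj mphi Ax; exists y; rewrite chi1 ?py.
- by have [y py] := model_surj mpsi Ax; exists y; rewrite chi2 ?py.
- case E1: (chi y1) => [x|//] _ /esym E2.
  move: (chiA _ _ E1) (chiA _ _ E2); case: ifP => xA p1 p2.
    apply: (connect_fiber_ext (phi := phi)); rewrite ?p1 //.
    by apply: (model_conn mphi); rewrite p1 ?p2.
  apply: (connect_fiber_ext (phi := psi)); rewrite ?p1 //.
  by apply: (model_conn mpsi); rewrite p1 ?p2.
- move=> /sX[Ax1|Ax1] /sX[Ax2|Ax2] e12.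
  + have [y1 [y2 [p1 p2 e]]] := model_edge mphi Ax1 Ax2 e12.
    by exists y1, y2; rewrite !chi1 ?p1 ?p2.
  + by have := nA _ _ Ax1 Ax2; rewrite e12.
  + by have := nA _ _ Ax2 Ax1; rewrite edge_sym e12.
  + have [y1 [y2 [p1 p2 e]]] := model_edge mpsi Ax1 Ax2 e12.
    by exists y1, y2; rewrite !chi2 ?p1 ?p2.
Qed.

(** A nonempty path comes with one of its ends as root; the empty path has
    none. *)
Record rooted (L : finType) := Rooted {
  rpiece :> piece L;
  root_of : option rpiece }.

Definition is_path (L : finType) (X : rooted L) : Prop :=
  if root_of X is Some a then
    [/\ a \in pset X, connected_in (pset X),
        forall x, x \in pset X -> #|nbrs_in (pset X) x| <= 2 &
        #|nbrs_in (pset X) a| <= 1]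
  else pset X = set0.

(** The root of a path has at most one neighbour, which leaves pick no choice. *)
Definition peel (L : finType) (X : rooted L) (a : X) : rooted L :=
  @Rooted L (sub_piece (pset X :\ a)) [pick u in nbrs_in (pset X) a].

Definition rminor (L : finType) (X Y : rooted L) : Prop :=
  exists phi : Y -> option X, lmodel phi /\
    forall a, root_of X = Some a -> exists b, root_of Y = Some b /\ phi b = Some a.

(** This is [higman] with the labels of the root as head and the rest of the
    path as tail. Models have to send root to root, so that a removed root can
    be attached again. A path below the tail is also below the whole path: the
    removed root joins the branch set that contains the next vertex. *)
Lemma path_wqo (L : finType) : wqo_on (@is_path L) (@rminor L).
Proof.
pose D (X : rooted L) (h : {set L}) (t : rooted L) :=
  exists a : X, [/\ root_of X = Some a, h = plab a & t = peel a].
have empty X Y : is_path X -> root_of X = None -> rminor X Y.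
  rewrite /is_path => + X0; rewrite X0 => A0; exists (fun=> None).
  by split; [exact: lmodel_empty|rewrite X0].
apply: (@higman _ _ (@is_path L) _ (fun=> True) eq (fun X => #|pset X|) D).
- exact: wqo_finite.
- exact: trans_on_eq.
- move=> X pX; case E: (root_of X) => [a|]; last by left=> Y _; exact: empty.
  by right; exists (plab a), (peel a), a.
- move=> X h t pX [a [Xa _ ->]]; move: pX; rewrite /is_path Xa => -[Aa cA dA da].
  split=> //=; first by rewrite [ltnRHS](cardsD1 a) Aa.
  have nbr u v : u \in nbrs_in (pset X) a -> v \in nbrs_in (pset X) a -> u = v.
    by move=> ua va; move/card_le1_eqP: da; exact.
  case: pickP => [u ua|no]; last first.
    apply/setP=> x; rewrite !inE; apply/andP=> -[nxa Ax].
    have /connectP[[|y p] /=] := cA _ _ Aa Ax; first by move=> _ /eqP; rewrite (negPf nxa).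
    by case/andP=> /and3P[_ Ay eay]; have := no y; rewrite inE Ay eay.
  have [Au eau] : u \in pset X /\ edge a u by move: ua; rewrite inE => /andP[].
  have nua : u != a by apply: contraTneq eau => ->; rewrite edge_irr.
  split=> [||x|]; first by rewrite !inE nua.
  + move=> x y; rewrite !inE => /andP[xa Ax] /andP[ya Ay].
    (* A walk that passes through the root a enters and leaves it by u. *)
    pose g z := if z == a then u else z.
    have := connect_map (P := fun=> True) (h := g)
      (e' := within (pset X :\ a)) _ I (cA _ _ Ax Ay).
    rewrite /g (negPf xa) (negPf ya); case=> // z w _ /and3P[Az Aw ezw]; split=> //.
    have [za|za] := eqVneq z a; have [wa|wa] := eqVneq w a.
    * exact: connect0.
    * by rewrite (nbr u w) ?connect0 // inE Aw -za.
    * by rewrite (nbr z u) ?connect0 // inE Az -wa edge_sym.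
    * by apply: connect1; rewrite /within !inE za wa Az Aw.
  + rewrite !inE => /andP[xa Ax]; apply: leq_trans (dA _ Ax).
    by apply/subset_leq_card/subsetP=> y; rewrite !inE => /andP[/andP[_ ->] ->].
  + have := dA _ Au; rewrite (cardsD1 a) inE Aa edge_sym eau ltnS.
    apply: leq_trans; apply/subset_leq_card/subsetP=> y.
    by rewrite !inE => /andP[/andP[-> ->] ->].
- move=> X Y h t pX pY [a [Xa _ ->]] [phi [[mphi lphi] rphi]].
  case E: (root_of Y) => [b|]; last exact: empty.
  have [u [Tu pu]] := rphi _ E.
  have [Aa _ _ _] : [/\ a \in pset X, connected_in (pset X),
        forall x, x \in pset X -> #|nbrs_in (pset X) x| <= 2 &
        #|nbrs_in (pset X) a| <= 1] by move: pX; rewrite /is_path Xa.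
  have eau : edge a u.
    by move: Tu => /=; case: pickP => // v + [<-]; rewrite inE => /andP[].
  have pa : phi a = None.
    by case pa: (phi a) => [y|//]; have [] := model_sub mphi pa; rewrite !inE eqxx.
  pose psi x : option Y := if x == a then Some b else phi x.
  have ext x : phi x -> psi x = phi x by rewrite /psi; case: eqP => // ->; rewrite pa.
  exists psi; split; last first.
    by move=> _ [<-]; exists a; rewrite /psi eqxx.
  split; last first.
    by move=> y i Yy /(lphi _ _ Yy)[x [px ix]]; exists x; rewrite ext ?px.
  have Yb : b \in pset Y by have [] := model_sub mphi pu.
  split=> [x y|y|x1 x2|y1 y2].
  + rewrite /psi; case: eqP => [-> [<-]//|_] /(model_sub mphi)[].
    by rewrite !inE => /andP[_ ->].
  + by move=> /(model_surj mphi)[x px]; exists x; rewrite ext ?px.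
  + have cu x : psi x = Some b -> connect (fiber_edge psi) u x.
      rewrite {1}/psi; case: eqP => [-> _|_ px].
        apply: connect1; rewrite /fiber_edge edge_sym eau ext ?pu //.
        by rewrite /psi !eqxx.
      apply: (connect_fiber_ext ext); first by rewrite pu.
      by apply: (model_conn mphi); rewrite pu ?px.
    case E1: (psi x1) => [y|//] _ /esym E2.
    have [yb|nyb] := eqVneq y b.
      rewrite yb in E1 E2.
      apply: (@connect_trans _ _ u); last exact: cu.
      by rewrite (sym_connect_sym (@fiber_edge_sym _ _ psi)); exact: cu.
    have dom x : psi x = Some y -> phi x = Some y.
      by rewrite /psi; case: eqP => // _ [yb]; rewrite yb eqxx in nyb.
    apply: (connect_fiber_ext ext); first by rewrite dom.
    by apply: (model_conn mphi); rewrite !dom.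
  + move=> Y1 Y2 /(model_edge mphi Y1 Y2)[x1 [x2 [p1 p2 e]]].
    by exists x1, x2; rewrite !ext ?p1 ?p2.
- move=> X Y h h' t t' pX pY [a [Xa -> ->]] [b [Yb -> ->]] hab.
  move=> [phi [[mphi lphi] rphi]].
  move: pX pY; rewrite /is_path Xa Yb => -[Aa _ _ da] [Bb _ _ _].
  have pb : phi b = None.
    by case pb: (phi b) => [y|//]; have [] := model_sub mphi pb; rewrite !inE eqxx.
  have npa y : phi y <> Some a.
    by move=> py; have [_] := model_sub mphi py; rewrite !inE eqxx.
  pose psi x : option X := if x == b then Some a else phi x.
  have ext x : phi x -> psi x = phi x by rewrite /psi; case: eqP => // ->; rewrite pb.
  have psib : psi b = Some a by rewrite /psi eqxx.
  have root_edge y : y \in pset X -> edge a y ->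
      exists x, psi x = Some y /\ edge b x.
    move=> Xy eay; have ya : y \in nbrs_in (pset X) a by rewrite inE Xy.
    have [x [/= Yx px]] : exists x, root_of (peel b) = Some x /\ phi x = Some y.
      apply: rphi => /=; case: pickP => [u ua|/(_ y)]; last by rewrite ya.
      by congr Some; move/card_le1_eqP: da; exact.
    exists x; rewrite ext ?px //; split=> //.
    by move: Yx; case: pickP => // v + [<-]; rewrite inE => /andP[].
  exists psi; split; last first.
    by move=> c; rewrite Xa => -[<-]; exists b.
  split; last first.
    move=> x i Ax; have [->|nxa] := eqVneq x a; first by rewrite hab; exists b.
    move=> ix; have [|y [py iy]] := lphi x i _ ix; first by rewrite !inE nxa.
    by exists y; rewrite ext ?py.
  split=> [y x|x Ax|y1 y2|x1 x2 A1 A2 e12].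
  + rewrite /psi; case: eqP => [-> [<-]//|_] /(model_sub mphi)[].
    by rewrite !inE => /andP[_ ->] /andP[_ ->].
  + have [->|nxa] := eqVneq x a; first by exists b.
    have [|y py] := @model_surj _ _ _ _ _ mphi x; first by rewrite !inE nxa.
    by exists y; rewrite ext ?py.
  + rewrite {1 2 3}/psi; case: eqP => [->|_]; case: eqP => [->|_] //.
    * by move=> _ /esym/npa.
    * by move=> _ /npa.
    * by move=> p1 p12; apply: (connect_fiber_ext ext) => //; exact: (model_conn mphi).
  + have [x1a|n1] := eqVneq x1 a.
      rewrite x1a in e12 *; have [x [px e]] := root_edge _ A2 e12.
      by exists b, x.
    have [x2a|n2] := eqVneq x2 a.
      rewrite x2a edge_sym in e12 *; have [x [px e]] := root_edge _ A1 e12.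
      by exists x, b; rewrite edge_sym.
    have [|| y1 [y2 [p1 p2 e]]] := @model_edge _ _ _ _ _ mphi x1 x2 _ _ e12;
      rewrite ?inE ?n1 ?n2 //.
    by exists y1, y2; rewrite !ext ?p1 ?p2.
Qed.

(** With degrees at most 2, a component is a path rather than a cycle if and
    only if one of its vertices has degree at most 1. *)
Definition linear_forest (G : graph) (A : {set G}) : Prop :=
  (forall x, x \in A -> #|nbrs_in A x| <= 2) /\
  (forall x, x \in A -> exists a,
     [/\ a \in A, connect (within A) x a & #|nbrs_in A a| <= 1]).

Lemma nbrs_inS (G : graph) (A B : {set G}) (x : G) :
  A \subset B -> #|nbrs_in A x| <= #|nbrs_in B x|.
Proof.
move=> sAB; apply/subset_leq_card/subsetP=> y; rewrite !inE => /andP[Ay ->].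
by rewrite (subsetP sAB).
Qed.

Lemma linear_forest_wqo (L : finType) :
  wqo_on (fun X : piece L => linear_forest (pset X)) (@lminor L).
Proof.
pose Q (X : piece L) := exists a : X, is_path (Rooted (Some a)).
apply: (@glue_wqo _ _ Q).
  move=> f Qf.
  have /choice[r rP] : forall i, exists Y : rooted L, is_path Y /\ rpiece Y = f i.
    by move=> i; have [a ?] := Qf i; exists (Rooted (Some a)).
  have [|i [j [ij [phi [mphi _]]]]] := @path_wqo L r; first by move=> i; case: (rP i).
  exists i, j; split=> //; have [_ <-] := rP i; have [_ <-] := rP j.
  by exists phi.
move=> X [dA eA]; have [->|[x Ax]] := set_0Vmem (pset X); first by left.
right; exists (component (pset X) x).
have sC := component_sub (pset X) x.
have sB : pset X :\: component (pset X) x \subset pset X by exact: subsetDl.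
split=> //.
- by apply/set0Pn; exists x; exact: component_self.
- move=> y z Cy; rewrite inE => /andP[+ Az]; apply: contra => e.
  exact: component_edge Az Cy e.
- have [a [Aa cxa da]] := eA _ Ax; exists a; split=> /=.
  + by rewrite inE Aa.
  + exact: component_connected.
  + move=> y /(subsetP sC) Ay; apply: leq_trans (dA _ Ay); exact: nbrs_inS.
  + by apply: leq_trans da; exact: nbrs_inS.
- split=> /= y By.
    by apply: leq_trans (dA y _); [exact: nbrs_inS|exact: (subsetP sB)].
  have [a [Aa cya da]] := eA _ (subsetP sB _ By).
  have [Ba ca] := connect_outside_component By cya.
  by exists a; split=> //; apply: leq_trans da; exact: nbrs_inS.
Qed.

(** * Linear forests with boundedly many further vertices *)

(** The vertices of dset are named by their position in its enumeration. *)
Record deleted := Deleted {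
  dpiece :> piece void;
  dset : {set dpiece} }.

Definition dindex (X : deleted) (x : X) : nat := index x (enum (dset X)).

Lemma dindex_inj (X : deleted) : {in dset X &, injective (@dindex X)}.
Proof.
by move=> x y Dx Dy; apply: index_inj => //; rewrite mem_enum.
Qed.

(** The labels of a vertex are the names of its neighbours in dset. *)
Definition attached (B : nat) (X : deleted) : piece 'I_B :=
  Piece (pset X :\: dset X)
    (fun x => [set i : 'I_B | [exists d in dset X, (dindex d == i) && edge x d]]).

(** The finite amount of information about dset that [attached] leaves out. *)
Definition skeleton (B : nat) (X : deleted) : 'I_B.+1 * {set 'I_B * 'I_B} :=
  (inord #|dset X|, [set p : 'I_B * 'I_B | [exists c in dset X, exists d in dset X,
     [&& dindex c == p.1, dindex d == p.2 & edge c d]]]).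

(** Vertices of dset with the same name correspond to each other, as singleton
    branch sets. The skeleton takes care of the edges between them, and the
    labels of those that lead to the remaining vertices. *)
Lemma near_forest_lift (B : nat) (X Y : deleted) :
  dset X \subset pset X -> #|dset X| <= B ->
  dset Y \subset pset Y -> #|dset Y| <= B ->
  skeleton B X = skeleton B Y -> lminor (attached B X) (attached B Y) ->
  lminor X Y.
Proof.
move=> sX leX sY leY [cardXY skel] [phi [mphi lphi]].
have cXY : #|dset X| = #|dset Y|.
  by have := congr1 (@nat_of_ord _) cardXY; rewrite !inordK ?ltnS.
have lt_dindex (Z : deleted) d : #|dset Z| <= B -> d \in dset Z -> dindex d < B.
  by move=> leZ Dd; apply: leq_trans leZ; rewrite cardE index_mem mem_enum.
pose psi y : option X := if y \in dset Y
  then [pick d in dset X | dindex d == dindex y] else phi y.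
have phiD y : phi y -> y \notin dset Y.
  case E: (phi y) => [x|//] _; have [+ _] := model_sub mphi E.
  by rewrite inE => /andP[].
have ext y : phi y -> psi y = phi y by move=> /phiD; rewrite /psi => /negPf->.
have psiD y : y \in dset Y -> exists d,
    [/\ d \in dset X, dindex d = dindex y & psi y = Some d].
  move=> Dy; rewrite /psi Dy; case: pickP => [d /andP[Dd /eqP <-]|]; first by exists d.
  have lt : dindex y < size (enum (dset X)).
    by rewrite -cardE cXY cardE index_mem mem_enum.
  have x0 : X by case: (enum _) lt => // x0.
  move=> /(_ (nth x0 (enum (dset X)) (dindex y))).
  rewrite -mem_enum mem_nth //= /dindex index_uniq ?enum_uniq //.
  by rewrite eqxx.
have psiX d : d \in dset X -> exists y,
    [/\ y \in dset Y, dindex d = dindex y & psi y = Some d].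
  move=> Dd; have lt : dindex d < size (enum (dset Y)).
    by rewrite -cardE -cXY cardE index_mem mem_enum.
  have y0 : Y by case: (enum _) lt => // y0.
  have Dy : nth y0 (enum (dset Y)) (dindex d) \in dset Y.
    by rewrite -mem_enum mem_nth.
  have iy : dindex (nth y0 (enum (dset Y)) (dindex d)) = dindex d.
    by rewrite /dindex index_uniq ?enum_uniq.
  exists (nth y0 (enum (dset Y)) (dindex d)); split=> //.
  have [c [Dc ic ->]] := psiD _ Dy; congr Some.
  by apply: dindex_inj => //; rewrite ic.
have psiE y x : psi y = Some x -> x \in dset X ->
    y \in dset Y /\ dindex y = dindex x.
  case: (boolP (y \in dset Y)) => Dy py Dx.
    by have [d [_ id]] := psiD _ Dy; rewrite py => -[->].
  move: py; rewrite /psi (negPf Dy) => /(model_sub mphi)[_].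
  by rewrite inE Dx.
have psiF y x : psi y = Some x -> x \notin dset X -> phi y = Some x.
  case: (boolP (y \in dset Y)) => Dy; last by rewrite /psi (negPf Dy).
  by have [d [Dd _ ->]] := psiD _ Dy => -[<-]; rewrite Dd.
have XF x : x \in pset X -> x \notin dset X -> x \in pset (attached B X).
  by rewrite inE => -> ->.
exists psi; split; last by move=> x [].
split=> [y x|x Xx|y1 y2|x1 x2 X1 X2 e12].
- case: (boolP (x \in dset X)) => Dx py.
    by have [Dy _] := psiE _ _ py Dx; rewrite (subsetP sY) ?(subsetP sX).
  have [] := model_sub mphi (psiF _ _ py Dx); rewrite !inE.
  by move=> /andP[_ ->] /andP[_ ->].
- have [/psiX[y [_ _ py]]|Dx] := boolP (x \in dset X); first by exists y.
  by have [y py] := model_surj mphi (XF _ Xx Dx); exists y; rewrite ext ?py.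
- case E1: (psi y1) => [x|//] _ /esym E2.
  have [Dx|Dx] := boolP (x \in dset X).
    have [D1 i1] := psiE _ _ E1 Dx; have [D2 i2] := psiE _ _ E2 Dx.
    by rewrite (dindex_inj D1 D2) ?i1 ?connect0.
  have p1 := psiF _ _ E1 Dx; have p2 := psiF _ _ E2 Dx.
  apply: (connect_fiber_ext ext); first by rewrite p1.
  by apply: (model_conn mphi); rewrite p1 ?p2.
have mixed x d : x \in pset X -> x \notin dset X -> d \in dset X -> edge x d ->
    exists y1 y2, [/\ psi y1 = Some x, psi y2 = Some d & edge y1 y2].
  move=> Xx nDx Dd exd; pose i := Ordinal (lt_dindex _ _ leX Dd).
  have ix : i \in @plab _ (attached B X) x.
    by rewrite inE; apply/existsP; exists d; rewrite Dd eqxx.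
  have [y1 [p1]] := lphi _ _ (XF _ Xx nDx) ix.
  rewrite inE => /existsP[y2 /and3P[D2 /eqP i2 e]].
  exists y1, y2; rewrite ext ?p1 //; split=> //.
  have [c [Dc ic ->]] := psiD _ D2; congr Some.
  by apply: dindex_inj => //; rewrite ic i2.
have [D1|D1] := boolP (x1 \in dset X); have [D2|D2] := boolP (x2 \in dset X).
- have : (Ordinal (lt_dindex _ _ leX D1), Ordinal (lt_dindex _ _ leX D2)) \in
      (skeleton B X).2.
    rewrite inE; apply/existsP; exists x1; rewrite D1.
    by apply/existsP; exists x2; rewrite D2 /= !eqxx.
  rewrite /= skel inE => /existsP[y1 /andP[Dy1 /existsP[y2 /andP[Dy2]]]] /=.
  case/and3P=> /eqP i1 /eqP i2 e.
  exists y1, y2; split=> //.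
    by have [c [Dc ic ->]] := psiD _ Dy1; congr Some; apply: dindex_inj; rewrite ?ic.
  by have [c [Dc ic ->]] := psiD _ Dy2; congr Some; apply: dindex_inj; rewrite ?ic.
- have [|y1 [y2 [p1 p2 e]]] := mixed _ _ X2 D2 D1; first by rewrite edge_sym.
  by exists y2, y1; rewrite edge_sym.
- exact: mixed.
- have [y1 [y2 [p1 p2 e]]] := model_edge mphi (XF _ X1 D1) (XF _ X2 D2) e12.
  by exists y1, y2; rewrite !ext ?p1 ?p2.
Qed.

Definition near_forest (B : nat) (X : piece void) : Prop :=
  exists D : {set X},
    [/\ D \subset pset X, #|D| <= B & linear_forest (pset X :\: D)].

Lemma near_forest_wqo (B : nat) : wqo_on (near_forest B) (@lminor void).
Proof.
move=> f Pf.
have /choice[r rP] : forall i, exists Y : deleted, [/\ dset Y \subset pset Y,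
    #|dset Y| <= B, linear_forest (pset Y :\: dset Y) & dpiece Y = f i].
  by move=> i; have [D [sD leD lD]] := Pf i; exists (Deleted D).
have Lf k : linear_forest (pset (attached B (r k))) by have [_ _ lk _] := rP k.
have [i [j [ij skel lij]]] := wqo_prod
  (@wqo_finite ('I_B.+1 * {set 'I_B * 'I_B})%type) (@trans_on_eq _)
  (@linear_forest_wqo 'I_B) (f := fun i => skeleton B (r i)) (fun=> I) Lf.
exists i, j; split=> //.
have [sX leX _ <-] := rP i; have [sY leY _ <-] := rP j.
exact: near_forest_lift skel lij.
Qed.

(** * Graphs without star minors *)

Definition induced_edge (G : graph) (A : {set G}) : rel {x : G | x \in A} :=
  fun x y => edge (val x) (val y).

Lemma induced_sym (G : graph) (A : {set G}) : symmetric (@induced_edge G A).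
Proof. by move=> x y; exact: edge_sym. Qed.

Lemma induced_irr (G : graph) (A : {set G}) : irreflexive (@induced_edge G A).
Proof. by move=> x; exact: edge_irr. Qed.

Definition induced (G : graph) (A : {set G}) : graph :=
  Graph (@induced_sym G A) (@induced_irr G A).

Lemma model_induced (G : graph) (A : {set G}) :
  model (H := induced A) [set: induced A] A insub.
Proof.
have vK (y : induced A) : insub (val y) = Some y :> option (induced A).
  exact: valK.
have iE x (y : induced A) : insub x = Some y -> val y = x.
  by case: insubP => // z _ <- [<-].
split=> [x y /iE <-|y _|x1 x2|y1 y2 _ _ e].
- by rewrite inE (valP y).
- by exists (val y); exact: vK.
- case E1: (insub x1) => [y|//] _ /esym E2.
  by rewrite -(iE _ _ E1) -(iE _ _ E2) connect0.
- by exists (val y1), (val y2); rewrite !vK.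
Qed.

Lemma model_of_induced (G : graph) (A : {set G}) :
  model (G := induced A) A [set: induced A] (fun x => Some (val x)).
Proof.
split=> [x y [<-]|y Ay|x1 x2 _ [/val_inj ->]|y1 y2 A1 A2 e].
- by rewrite inE (valP x).
- by exists (Sub y Ay).
- exact: connect0.
- by exists (Sub y1 A1), (Sub y2 A2).
Qed.

Lemma induced_minor_model (G : graph) (A : {set G}) : minor_model (induced A) G.
Proof.
by apply: (@hom_minor_model (induced A) G val) => //; exact: val_inj.
Qed.

Definition frontier (G : graph) (A S : {set G}) : {set G} :=
  [set y in A :\: S | [exists x in S, edge x y]].

(** No K_(1, t) is a minor of the subgraph induced by A: a model of this star
    with connected centre S needs t distinct vertices next to S. *)
Definition starfree (t : nat) (G : graph) (A : {set G}) : Prop :=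
  forall S : {set G}, S \subset A -> S != set0 -> connected_in S ->
    #|frontier A S| < t.

Lemma starfreeS (t : nat) (G : graph) (A B : {set G}) :
  A \subset B -> starfree t B -> starfree t A.
Proof.
move=> sAB sfB S sSA S0 cS; apply: leq_ltn_trans (sfB S _ S0 cS); last first.
  exact: subset_trans sSA sAB.
apply/subset_leq_card/subsetP=> y; rewrite !inE => /andP[/andP[-> Ay] ->].
by rewrite (subsetP sAB).
Qed.

Lemma model_preim_connected (H G : graph) (B S : {set H}) (A : {set G})
    (phi : G -> option H) :
  model B A phi -> S \subset B -> connected_in S ->
  connected_in [set x | if phi x is Some y then y \in S else false].
Proof.
move=> mphi sSB cS x1 x2; rewrite !inE.
case E1: (phi x1) => [y1|//] S1; case E2: (phi x2) => [y2|//] S2.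
apply: (connect_lift (P := fun y => y \in S) (e := within S) mphi _ _ _ _
  S1 (cS _ _ S1 S2) E1 E2).
- by move=> y; exact: (subsetP sSB).
- by move=> y z _ /and3P[].
- by move=> a b y Sy ha hb eab; rewrite /within !inE ha hb Sy.
- by move=> a b y z Sy /and3P[_ Sz _] ha hb eab; rewrite /within !inE ha hb Sy Sz.
Qed.

(** The preimage of a connected set is connected, and distinct vertices of the
    frontier of S are represented by distinct vertices of the frontier of its
    preimage. *)
Lemma starfree_model (t : nat) (H G : graph) (B : {set H}) (A : {set G})
    (phi : G -> option H) :
  model B A phi -> starfree t A -> starfree t B.
Proof.
move=> mphi sfA S sSB /set0Pn[y0 Sy0] cS.
pose T := [set x | if phi x is Some y then y \in S else false].
have sT : T \subset A.
  by apply/subsetP=> x; rewrite inE; case E: (phi x) => [y|//] _; have [] := model_sub mphi E.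
apply: leq_ltn_trans (sfA T sT _ (model_preim_connected mphi sSB cS)); last first.
  have [x px] := model_surj mphi (subsetP sSB _ Sy0).
  by apply/set0Pn; exists x; rewrite inE px.
have fP y : y \in frontier B S -> exists x, phi x = Some y /\ x \in frontier A T.
  rewrite !inE => /andP[/andP[nSy By] /existsP[z /andP[Sz e]]].
  have [a [b [ha hb eab]]] := model_edge mphi (subsetP sSB _ Sz) By e.
  exists b; rewrite !inE hb nSy; have [-> _] := model_sub mphi hb.
  by split=> //=; apply/existsP; exists a; rewrite inE ha Sz.
have [F0|[y1 /fP[x1 _]]] := set_0Vmem (frontier B S); first by rewrite F0 cards0.
pose f y := odflt x1 [pick x in frontier A T | phi x == Some y].
have fE y : y \in frontier B S -> phi (f y) = Some y /\ f y \in frontier A T.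
  move=> /fP[x [px Fx]]; rewrite /f; case: pickP => [z /andP[? /eqP]|/(_ x)] //.
  by rewrite Fx px eqxx.
rewrite -(card_in_imset (f := f)); last first.
  by move=> y z /fE[py _] /fE[pz _] fyz; apply: Some_inj; rewrite -py -pz fyz.
by apply/subset_leq_card/subsetP=> _ /imsetP[y /fE[_ Fy] ->].
Qed.

Definition arcs (G : graph) : {set G * G} := [set p | edge p.1 p.2].

Definition common_nbrs (G : graph) (u v : G) : {set G} :=
  [set w | edge u w && edge v w].

Lemma sum_degree (G : graph) : \sum_(x : G) degree x = #|arcs G|.
Proof.
rewrite -sum1_card (eq_bigl (fun p : G * G => xpredT p.1 && edge p.1 p.2)).
  rewrite -(pair_big_dep xpredT (fun x y : G => edge x y) (fun _ _ => 1)) /=.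
  by apply: eq_bigr => x _; rewrite sum1_card /degree cardsE.
by move=> p; rewrite inE.
Qed.

(** Apart from the two arcs between u and v, the contraction identifies arcs
    only in pairs, two for each triangle on the edge. *)
Lemma arcs_contract (G : graph) (u v : G) : edge u v ->
  #|arcs G| <= #|arcs (Defs.contract u v)| + (2 + 2 * #|common_nbrs u v|).
Proof.
move=> euv; have nuv := edge_neq euv; pose h := contract_map nuv.
pose C := common_nbrs u v.
pose E := [set (u, v); (v, u)] :|:
  ([set (v, w) | w in C] :|: [set (w, v) | w in C]).
rewrite -(cardsID E) addnC leq_add //; last first.
  apply: leq_trans (subset_leq_card (subsetIr _ _)) _.
  apply: leq_trans (leq_card_setU _ _) _.
  apply: leq_add; first by rewrite cards2; case: eqP.
  apply: leq_trans (leq_card_setU _ _) _.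
  by rewrite mul2n -addnn leq_add // leq_imset_card.
have inC x y : edge x y -> edge u y -> edge v y -> (x, y) \notin E -> x <> v.
  move=> _ eu ev; rewrite !inE !negb_or => /andP[_ /andP[/imsetP nE _]] xv.
  by apply: nE; exists y; rewrite ?inE ?eu ?ev ?xv.
have inC' x y : edge x y -> edge u x -> edge v x -> (x, y) \notin E -> y <> v.
  move=> _ eu ev; rewrite !inE !negb_or => /andP[_ /andP[_ /imsetP nE]] xv.
  by apply: nE; exists x; rewrite ?inE ?eu ?ev ?xv.
have E1 : (u, v) \in E by rewrite !inE eqxx.
have E2 : (v, u) \in E by rewrite !inE eqxx orbT.
rewrite -(card_in_imset (f := fun p => (h p.1, h p.2))).
  apply/subset_leq_card/subsetP=> _ /imsetP[[x y] + ->].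
  rewrite in_setD => /andP[nE]; rewrite !inE /= => exy.
  apply: contract_map_edge => //; apply/eqP => hxy.
  case: (contract_map_eq hxy) => [xy|[xu yv]|[xv yu]].
  - by move: exy; rewrite xy edge_irr.
  - by rewrite xu yv E1 in nE.
  - by rewrite xv yu E2 in nE.
move=> [x y] [x' y']; rewrite !in_setD => /andP[nE exy] /andP[nE' exy'].
move: exy exy'; rewrite !inE /= => exy exy' [hx hy].
have xor : (x = x') \/ (y = y').
  case: (contract_map_eq hx) => [->|[xu xv]|[xv xu]]; first by left.
    case: (contract_map_eq hy) => [->|[yu yv]|[yv yu]]; first by right.
      by move: exy; rewrite xu yu edge_irr.
    by rewrite xu yv E1 in nE.
  case: (contract_map_eq hy) => [->|[yu yv]|[yv yu]]; first by right.
    by rewrite xv yu E2 in nE.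
  by move: exy; rewrite xv yv edge_irr.
case: xor => [xx|yy]; [rewrite -xx in exy' nE' *|rewrite -yy in exy' nE' *].
  case: (contract_map_eq hy) => [->//|[yu yv]|[yv yu]].
    rewrite yu yv in exy exy' nE'.
    by case: (inC' x v) => //; rewrite edge_sym.
  rewrite yu yv in exy exy' nE.
  by case: (inC' x v) => //; rewrite edge_sym.
case: (contract_map_eq hx) => [->//|[xu xv]|[xv xu]].
  rewrite xu xv in exy exy' nE'.
  by case: (inC v y).
rewrite xu xv in exy exy' nE.
by case: (inC v y).
Qed.

(** * Structure of connected graphs without star minors *)

Section Layers.
Variables (G : graph) (r : G).

Definition grow (S : {set G}) : {set G} := S :|: frontier [set: G] S.

Definition ball (k : nat) : {set G} := iter k grow [set r].

Lemma ballS k : ball k.+1 = ball k :|: frontier [set: G] (ball k).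
Proof. by []. Qed.

Lemma ball_mono k l : k <= l -> ball k \subset ball l.
Proof.
move/subnK <-; elim: (l - k) => // m IH; rewrite addSn ballS.
exact: subset_trans IH (subsetUl _ _).
Qed.

Lemma ball_edge k x y : x \in ball k -> edge x y -> y \in ball k.+1.
Proof.
move=> Bx exy; rewrite ballS inE; have [//|nBy] := boolP (y \in ball k).
by rewrite !inE nBy /=; apply/existsP; exists x; rewrite Bx.
Qed.

Lemma ball_parent k y : y \in ball k.+1 -> y \notin ball k ->
  exists2 x, x \in ball k & edge x y.
Proof.
rewrite ballS inE => /orP[-> //|]; rewrite !inE => /andP[_ /existsP[x /andP[Bx e]]].
by exists x.
Qed.

Lemma ball_connected k : connected_in (ball k).
Proof.
suff h y : y \in ball k -> connect (within (ball k)) r y.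
  by move=> x y /h + /h; rewrite connect_within_sym; exact: connect_trans.
elim: k y => [|k IH] y; first by rewrite inE => /eqP->; exact: connect0.
have sub x : x \in ball k -> connect (within (ball k.+1)) r x.
  move=> Bx; have [//|_ //] := connect_map (P := fun=> True) (h := id)
    (e' := within (ball k.+1)) _ I (IH _ Bx).
  move=> a b _ /and3P[Ba Bb e]; split=> //; apply: connect1.
  by rewrite /within !(subsetP (ball_mono (leqnSn k))).
move=> By; have [/sub //|nBy] := boolP (y \in ball k).
have [x Bx exy] := ball_parent By nBy.
apply: connect_trans (sub _ Bx) (connect1 _).
by rewrite /within By exy (subsetP (ball_mono (leqnSn k))).
Qed.

Lemma ball_stable k : connected_in [set: G] ->
  ball k.+1 \subset ball k -> ball k = [set: G].
Proof.
move=> cG st; apply/setP=> y; rewrite in_setT.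
have Br : r \in ball k by apply: (subsetP (ball_mono (leq0n k))); rewrite inE.
case/(connect_map (P := fun x => x \in ball k) (e' := within setT) (h := id)):
  (cG _ _ (in_setT r) (in_setT y)) => // a b Ba /and3P[_ _ e].
split; first exact: (subsetP st) _ (ball_edge Ba e).
by apply: connect1; rewrite /within !in_setT.
Qed.

Lemma card_ball t k : starfree t [set: G] -> #|ball k| <= 1 + k * t.
Proof.
move=> sf; elim: k => [|k IH]; first by rewrite cards1.
rewrite ballS mulSn addnCA addnC; apply: leq_trans (leq_card_setU _ _) _.
rewrite leq_add // ltnW // sf ?subsetT //; last exact: ball_connected.
apply/set0Pn; exists r; apply: (subsetP (ball_mono (leq0n k))).
by rewrite inE.
Qed.

(** Go from r to y along a shortest path. On every other edge of it, the third
    vertex of a triangle is off the path and next to it. These vertices are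
    distinct, since each lies outside the ball that contains the previous
    ones. *)
Lemma layer_frontier j y :
  (forall u v : G, edge u v -> common_nbrs u v != set0) ->
  y \in ball j.*2 -> (forall i, i < j.*2 -> y \notin ball i) ->
  exists S : {set G}, [/\ connected_in S, y \in S, S \subset ball j.*2 &
    j <= #|frontier [set: G] S :&: ball j.*2|].
Proof.
move=> tri; elim: j y => [|j IH] y By nBy.
  exists [set r]; split=> //.
  by move=> a b; rewrite !inE => /eqP-> /eqP->; exact: connect0.
have [x Bx exy] : exists2 x, x \in ball j.*2.+1 & edge x y.
  by apply: ball_parent By _; exact: nBy.
have nBx i : i < j.*2.+1 -> x \notin ball i.
  by move=> li; apply/negP=> /ball_edge/(_ exy); exact/negP/nBy.
have [z Bz ezx] : exists2 z, z \in ball j.*2 & edge z x.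
  by apply: ball_parent Bx _; exact: nBx.
have [|S [cS Sz sS leS]] := IH z Bz.
  by move=> i li; apply/negP=> /ball_edge/(_ ezx); exact/negP/nBx.
have [w] : exists w, w \in common_nbrs x y by apply/set0Pn; exact: tri.
rewrite inE => /andP[exw eyw].
have nSx : x \notin S by apply: contra (nBx j.*2 (ltnSn _)); exact: (subsetP sS).
have nSy : y \notin S by apply: contra (nBy j.*2 (leqW (ltnSn _))); exact: (subsetP sS).
have nBw : w \notin ball j.*2.
  by apply/negP=> /ball_edge/(_ (etrans (edge_sym w y) eyw)); exact/negP/nBy.
have nSw : w \notin S by apply: contra nBw; exact: (subsetP sS).
have sB : ball j.*2 \subset ball j.+1.*2 by apply: ball_mono; rewrite doubleS leqW.
exists (x |: (y |: S)); split.
- suff h a : a \in x |: (y |: S) -> connect (within (x |: (y |: S))) x a.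
    by move=> a b /h + /h; rewrite connect_within_sym; exact: connect_trans.
  have cxy : connect (within (x |: (y |: S))) x y.
    by apply: connect1; rewrite /within !inE !eqxx orbT exy.
  rewrite !inE => /or3P[/eqP->|/eqP->|Sa] //.
  apply: (@connect_trans _ _ z).
    by apply: connect1; rewrite /within !inE eqxx Sz !orbT edge_sym ezx.
  have [//|_ //] := connect_map (P := fun=> True) (h := id)
    (e' := within (x |: (y |: S))) _ I (cS _ _ Sz Sa).
  move=> b c _ /and3P[Sb Sc e]; split=> //; apply: connect1.
  by rewrite /within !inE Sb Sc !orbT.
- by rewrite !inE eqxx orbT.
- rewrite !subUset !sub1set By (subset_trans sS sB) andbT /= andbT.
  exact: (subsetP (ball_mono (leqnSn j.*2.+1)) _ Bx).
- apply: leq_trans (leq_ltn_trans leS (_ : _ < #|w |: (frontier [set: G] S :&: ball j.*2)|)) _.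
    by rewrite cardsU1 inE (negPf nBw) andbF.
  apply/subset_leq_card/subsetP=> a; rewrite in_setU in_set1 in_setI => /orP[/eqP->|/andP[+ Ba]].
    rewrite doubleS inE (ball_edge Bx exw) andbT !inE !negb_or nSw andbT.
    rewrite eq_sym (edge_neq exw) eq_sym (edge_neq eyw) /=.
    by apply/existsP; exists x; rewrite !inE eqxx.
  rewrite in_setI (subsetP sB _ Ba) andbT !inE !negb_or.
  move=> /andP[/andP[nSa _] /existsP[b /andP[Sb e]]]; rewrite nSa.
  apply/andP; split; last by apply/existsP; exists b; rewrite !inE Sb !orbT.
  rewrite !andbT; apply/andP; split; apply: contraTneq Ba => ->.
    exact: nBx.
  by apply: nBy; rewrite doubleS.
Qed.

(** A vertex at distance 2 t from r would contradict [layer_frontier]; and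
    each layer, as the frontier of a ball, has fewer than t vertices. *)
Lemma card_all_triangles t : connected_in [set: G] -> starfree t [set: G] ->
  (forall u v : G, edge u v -> common_nbrs u v != set0) ->
  #|G| <= 1 + t.*2 * t.
Proof.
move=> cG sf tri; case: t sf => [|t] sf.
  have := sf [set r] (subsetT _); rewrite ltn0 => h; exfalso.
  suff : false by []; apply: h; first by apply/set0Pn; exists r; rewrite inE.
  by move=> a b; rewrite !inE => /eqP-> /eqP->; exact: connect0.
have st : ball t.+1.*2.-1.+1 \subset ball t.+1.*2.-1.
  apply/subsetP=> y By; apply: contraT => nBy.
  have [||S [cS Sy _ le]] := @layer_frontier t.+1 y tri.
  - by move: By; rewrite doubleS.
  - move=> i; rewrite doubleS ltnS => li; apply: contra nBy.
    by move: li => /ball_mono/subsetP; exact.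
  have := sf S (subsetT _) _ cS; rewrite ltnNge (leq_trans le) /=; last first.
    exact: subset_leq_card (subsetIl _ _).
  by move=> h; apply: h; apply/set0Pn; exists y.
rewrite -cardsT -(ball_stable cG st); apply: leq_trans (card_ball _ sf) _.
by rewrite leq_add2l leq_mul2r doubleS leqnSn orbT.
Qed.

End Layers.

(** The square of the bound in [card_all_triangles]. *)
Definition excess (t : nat) : nat := (1 + t.*2 * t) ^ 2.

(** Contracting an edge that lies in no triangle costs one vertex and only two
    arcs. When there is no such edge left, the order is bounded by
    [card_all_triangles]. *)
Lemma arcs_starfree t (G : graph) : connected_in [set: G] ->
  starfree t [set: G] -> #|arcs G| <= 2 * #|G| + excess t.
Proof.
have [m] := ubnP #|G|; elim: m G => // m IHm G leGm cG sf.
have [/existsP[u /existsP[v /andP[euv /eqP C0]]]|notri] :=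
    boolP [exists u : G, exists v : G, edge u v && (common_nbrs u v == set0)].
  have cardG : #|Defs.contract u v|.+1 = #|G| by exact: card_predC1.
  have [phi mphi] := contract_minor_model euv.
  have le : #|arcs (Defs.contract u v)| <= 2 * #|Defs.contract u v| + excess t.
    apply: IHm; last exact: starfree_model mphi sf.
      by rewrite -ltnS cardG.
    move=> x y _ _; have nuv := edge_neq euv.
    have [|_] := connect_map (P := fun=> True) (h := contract_map nuv)
      (e' := within [set: Defs.contract u v]) _ I (cG (val x) (val y) (in_setT _) (in_setT _)).
      move=> a b _ /and3P[_ _ e]; split=> //.
      have [->|ne] := eqVneq (contract_map nuv a) (contract_map nuv b).
        exact: connect0.
      apply: connect1; rewrite /within !in_setT.
      exact: contract_map_edge.
    by rewrite !contract_map_val.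
  apply: leq_trans (arcs_contract euv) _; rewrite C0 cards0 muln0 addn0.
  by rewrite -cardG mulnS addnC -addnA leq_add2l.
have [r _|G0] := pickP (xpredT : pred G); last first.
  by rewrite -sum_degree big_pred0.
have leG : #|G| <= 1 + t.*2 * t.
  apply: (card_all_triangles r) => // u v euv; apply: contra notri => /eqP C0.
  by apply/existsP; exists u; apply/existsP; exists v; rewrite euv C0 eqxx.
apply: leq_trans (leq_addl _ _); apply: leq_trans (max_card _) _.
by rewrite card_prod /excess expnS expn1 leq_mul.
Qed.

(** There are at most t vertices of degree 1: the other vertices form a
    connected set, of which they are the frontier. As the average degree
    exceeds 2 by little ([arcs_starfree]), few degrees are greater than 2. *)
Lemma card_branch_starfree t (G : graph) : connected_in [set: G] ->
  starfree t [set: G] -> #|[set x : G | 2 < degree x]| <= excess t + t.*2.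
Proof.
move=> cG sf; have [le2|gt2] := leqP #|G| 2.
  rewrite (_ : [set _ | _] = set0) ?cards0 //; apply/setP=> x; rewrite !inE.
  by rewrite ltnNge (leq_trans (max_card _)).
pose P := [set x : G | degree x <= 1].
have nbr x y z : x \in P -> edge x y -> edge x z -> y = z.
  rewrite inE => /card_le1_eqP h e1 e2; apply: h; by rewrite inE.
have nbrP x y : x \in P -> edge x y -> y \notin P.
  move=> Px e; apply/negP => Py; move: gt2; rewrite ltnNge => /negP; apply.
  suff xyT : [set x; y] = [set: G] by rewrite -cardsT -xyT cards2; case: eqP.
  apply/setP=> z; rewrite in_setT; have xx : x \in [set x; y] by rewrite !inE eqxx.
  case/(connect_map (P := fun z => z \in [set x; y]) (e' := within setT) (h := id)):
    (cG _ _ (in_setT x) (in_setT z)) => // a b ab /and3P[_ _ e']; split; last first.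
    by apply: connect1; rewrite /within !in_setT.
  move: ab; rewrite !inE => /orP[/eqP ax|/eqP ay].
    by rewrite (nbr x b y) ?eqxx ?orbT // -ax.
  by rewrite (nbr y b x) ?eqxx // -?ay // ay edge_sym.
have deg0 (x : G) : 0 < degree x.
  have [y xy] : exists y, y != x.
    apply: contrapT => no; move: gt2; rewrite ltnNge => /negP; apply.
    suff xT : [set: G] = [set x] by rewrite -cardsT xT cards1.
    apply/setP=> y; rewrite !inE; apply/esym/contraT => yx; case: no.
    by exists y.
  have /connectP[[|z p] /=] := cG _ _ (in_setT x) (in_setT y).
    by move=> _ yx; rewrite yx eqxx in xy.
  by case/andP=> /and3P[_ _ e] _ _; rewrite card_gt0; apply/set0Pn; exists z; rewrite inE.
have cardP : #|P| <= t.
  have [P0|[z0 nPz0]] := set_0Vmem (~: P).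
    have [x _] : exists x : G, True.
      by have /card_gt0P[x _] := ltnW (ltnW gt2); exists x.
    have /card_gt0P[y] := deg0 x; rewrite inE => e.
    have Px z : z \in P by apply: contraT; rewrite -in_setC P0 inE.
    by have := nbrP x y (Px x) e; rewrite Px.
  have sfP : #|frontier [set: G] (~: P)| < t.
    apply: sf; [exact: subsetT|by apply/set0Pn; exists z0|].
    (* A walk is kept away from P by sending each vertex of P to its only
       neighbour. *)
    move=> x y nPx nPy; pose h z := if z \in P then odflt z [pick w | edge z w] else z.
    have hP z w : z \in P -> edge z w -> h z = w.
      move=> Pz e; rewrite /h Pz; case: pickP => [w' e'|/(_ w)]; last by rewrite e.
      exact: nbr e' e.
    have hn z : z \notin P -> h z = z by rewrite /h => /negPf->.
    have [|_] := connect_map (P := fun=> True) (h := h)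
      (e' := within (~: P)) _ I (cG _ _ (in_setT x) (in_setT y)).
      move=> a b _ /and3P[_ _ e]; split=> //.
      have [Pa|nPa] := boolP (a \in P).
        by rewrite (hP _ _ Pa e) hn ?connect0 // (nbrP _ _ Pa e).
      have [Pb|nPb] := boolP (b \in P).
        by rewrite (hP b a Pb) ?hn ?connect0 // edge_sym.
      by rewrite !hn //; apply: connect1; rewrite /within !in_setC nPa nPb.
    by rewrite !hn // -in_setC.
  apply: leq_trans (ltnW sfP); apply/subset_leq_card/subsetP=> x Px.
  rewrite !inE negbK.
  have := Px; rewrite inE => ->; rewrite andbT /=.
  have /card_gt0P[y] := deg0 x; rewrite inE => e; apply/existsP; exists y.
  by rewrite edge_sym e andbT in_setC (nbrP _ _ Px e).
have := arcs_starfree cG sf; rewrite -sum_degree => le.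
suff : #|[set x : G | 2 < degree x]| + 2 * #|G| <= \sum_(x : G) degree x + 2 * #|P|.
  move=> h; rewrite -(leq_add2r (2 * #|G|)); apply: leq_trans h _.
  apply: leq_trans (leq_add le (leqnn _)) _.
  by rewrite -addnA [leqRHS]addnC leq_add2l leq_add2l -mul2n leq_mul2l cardP orbT.
rewrite -!sum1_card !big_distrr /= muln1.
rewrite [X in X + _]big_mkcond [X in _ + X <= _ + _]/=.
rewrite [in X in _ <= _ + X]big_mkcond /= -!big_split /=.
apply: leq_sum => x _; rewrite !inE.
by case: ltngtP (deg0 x); case: (degree x) => [|[|[|d]]].
Qed.

(** Remove the vertices of degree at least 3, and one arbitrary vertex r so
    that something is removed from a cycle, too. Since the graph is connected,
    each remaining component has a vertex that lost a neighbour, hence has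
    degree at most 1 now. *)
Lemma starfree_near_forest t (G : graph) : connected_in [set: G] ->
  starfree t [set: G] ->
  near_forest (excess t + t.*2).+1 (@Piece void G [set: G] (fun=> set0)).
Proof.
move=> cG sf; have [r _|G0] := pickP (xpredT : pred G); last first.
  exists set0; rewrite cards0; split; [exact: finset.sub0set|by []|].
  by split=> x; have := G0 x.
pose D := r |: [set x : G | 2 < degree x].
exists D; split=> /=; first exact: subsetT.
  rewrite cardsU1; apply: leq_trans (leq_add (leq_b1 _) (card_branch_starfree cG sf)) _.
  by rewrite add1n.
have degD x : x \notin D -> degree x <= 2.
  by rewrite !inE negb_or -leqNgt => /andP[].
split=> x; rewrite inE in_setT andbT => nDx.
  apply: leq_trans (degD _ nDx); apply/subset_leq_card/subsetP=> y.
  by rewrite !inE => /andP[_ ->].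
pose A := [set: G] :\: D; pose C := component A x.
have Ax : x \in A by rewrite inE nDx in_setT.
have [a [b [Ca Db eab]]] : exists a b, [/\ a \in C, b \in D & edge a b].
  apply: contrapT => no.
  have : r \in C.
    case: (connect_map (P := fun y => y \in C) (e' := within setT) (h := id) _
      (component_self Ax) (cG _ _ (in_setT x) (in_setT r))) => // a b Ca /and3P[_ _ e].
    split; last by apply: connect1; rewrite /within !in_setT.
    have [Db|nDb] := boolP (b \in D); first by case: no; exists a, b.
    by apply: component_edge Ca e; rewrite inE nDb in_setT.
  by move/(subsetP (component_sub _ _)); rewrite !inE eqxx.
have Aa := subsetP (component_sub _ _) _ Ca.
exists a; split=> //; first by move: Ca; rewrite inE => /andP[].
have nDa : a \notin D by move: Aa; rewrite inE => /andP[].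
have := degD _ nDa; rewrite /degree (cardsD1 b) inE eab ltnS.
apply: leq_trans; apply/subset_leq_card/subsetP=> y.
rewrite !inE andbT => /andP[nDy ->]; rewrite andbT.
by apply: contra nDy => /eqP->; move: Db; rewrite !inE.
Qed.

(** By [glue_wqo] it is enough to consider connected graphs, which are near
    forests. *)
Theorem starfree_wqo t :
  wqo_on (fun G : graph => starfree t [set: G]) minor_model.
Proof.
pose B := (excess t + t.*2).+1.
pose Q (X : piece void) := exists Y : piece void,
  [/\ near_forest B Y, lminor X Y & lminor Y X].
have wQ : wqo_on Q (@lminor void).
  move=> f /choice[g gP].
  have [|i [j [ij lij]]] := near_forest_wqo (B := B) (f := g).
    by move=> i; have [] := gP i.
  exists i, j; split=> //; have [_ l1 _] := gP i; have [_ _ l2] := gP j.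
  have tr := @lminor_trans void (fun=> True).
  exact: (tr _ _ _ I I I (tr _ _ _ I I I l1 lij) l2).
have triv (X Y : piece void) (phi : Y -> option X) :
    model (pset X) (pset Y) phi -> lminor X Y by move=> m; exists phi; split=> // ? [].
have wP : wqo_on (fun X : piece void => starfree t (pset X)) (@lminor void).
  apply: (glue_wqo wQ) => X sf.
  have [->|[x Xx]] := set_0Vmem (pset X); first by left.
  right; exists (component (pset X) x); have sC := component_sub (pset X) x.
  split=> //.
  - by apply/set0Pn; exists x; exact: component_self.
  - move=> y z Cy; rewrite inE => /andP[+ Az]; apply: contra => e.
    exact: component_edge Az Cy e.
  - pose K := induced (component (pset X) x).
    exists (@Piece void K [set: K] (fun=> set0)); split.
    + apply: starfree_near_forest; last first.
        exact: starfree_model (model_induced _) (starfreeS sC sf).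
      move=> a b _ _.
      have [|_] := connect_map (P := fun=> True) (h := insubd a : X -> K)
        (e' := within [set: K]) _ I
        (component_connected Xx (valP a) (valP b)).
        move=> y z _ /and3P[Cy Cz e]; split=> //; apply: connect1.
        by rewrite /within !in_setT /= /induced_edge !val_insubd Cy Cz.
      by rewrite !valKd.
    + by apply: triv; exact: model_of_induced.
    + by apply: triv; exact: model_induced.
  - exact: starfreeS (subsetDl _ _) sf.
move=> f Pf.
have [//|i [j [ij [phi [mphi _]]]]] :=
  wP (fun i => @Piece void (f i) [set: f i] (fun=> set0)).
by exists i, j; split=> //; exists phi.
Qed.

(** * Edge density without complete minors *)

Definition complete_edge (t : nat) : rel 'I_t := fun i j => i != j.

Lemma complete_sym t : symmetric (@complete_edge t).
Proof. by move=> i j; rewrite /complete_edge eq_sym. Qed.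

Lemma complete_irr t : irreflexive (@complete_edge t).
Proof. by move=> i; rewrite /complete_edge eqxx. Qed.

Definition complete (t : nat) : graph :=
  Graph (@complete_sym t) (@complete_irr t).

Lemma card_arcs_induced (G : graph) (A : {set G}) :
  #|arcs (induced A)| = \sum_(x in A) #|nbrs_in A x|.
Proof.
rewrite -sum_degree [RHS]big_sub; apply: eq_bigr => x _.
rewrite /degree -(card_imset _ val_inj); apply: eq_card => y; rewrite inE.
apply/imsetP/andP => [[z + ->]|[Ay e]]; first by rewrite inE (valP z).
by exists (Sub y Ay); rewrite ?inE.
Qed.

(** The vertex u is added to the model as a branch set of its own. *)
Lemma complete_minor_cone (G : graph) (t : nat) (u : G) :
  minor_model (complete t) (induced (nbrs_in [set: G] u)) ->
  minor_model (complete t.+1) G.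
Proof.
move=> [psi mpsi]; set A := nbrs_in _ u in psi mpsi.
have := model_comp mpsi (model_induced A); set chi := fun x => _ => mchi.
have chiu : chi u = None.
  case E: (chi u) => [i|//]; have [] := model_sub mchi E.
  by rewrite inE edge_irr andbF.
pose phi x : option (complete t.+1) :=
  if x == u then Some ord_max else omap (widen_ord (leqnSn t)) (chi x).
have phiu : phi u = Some ord_max by rewrite /phi eqxx.
have phiE x i : phi x = Some i -> x = u /\ i = ord_max \/
    exists2 j, chi x = Some j & i = widen_ord (leqnSn t) j.
  rewrite /phi; case: eqP => [-> [<-]|_]; first by left.
  by case: (chi x) => //= j [<-]; right; exists j.
have widen_max j : widen_ord (leqnSn t) j <> ord_max.
  by move/(congr1 val) => /= jt; have := ltn_ord j; rewrite jt ltnn.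
have widen_inj : injective (widen_ord (leqnSn t)).
  by move=> i j /(congr1 val) /= ij; exact: val_inj.
have ext x j : chi x = Some j -> phi x = Some (widen_ord (leqnSn t) j).
  rewrite /phi; case: eqP => [->|_ ->] //; by rewrite chiu.
have maxP (i : 'I_t.+1) : i = ord_max \/ exists j, i = widen_ord (leqnSn t) j.
  have [lt|ge] := ltnP i t; [right; exists (Ordinal lt)|left]; apply: val_inj => //=.
  by apply/eqP; rewrite eqn_leq ge andbT -ltnS.
exists phi; split=> [x y|i _|x1 x2|i1 i2 _ _ ni].
- by rewrite !inE.
- have [->|[j ->]] := maxP i; first by exists u.
  by have [x px] := model_surj mchi (in_setT j); exists x; exact: ext.
- case E1: (phi x1) => [i|//] _ /esym E2.
  case: (phiE _ _ E1) (phiE _ _ E2) => [[-> i1]|[j1 c1 i1]] [[-> i2]|[j2 c2 i2]].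
  + exact: connect0.
  + by case: (widen_max j2); rewrite -i2.
  + by case: (widen_max j1); rewrite -i1.
  + have j12 : j1 = j2 by apply: widen_inj; rewrite -i1 -i2.
    have : connect (fiber_edge chi) x1 x2.
      by apply: (model_conn mchi); rewrite c1 // c2 j12.
    case/(connect_map (P := fun x => chi x = Some j1) (e' := fiber_edge phi) (h := id)) => //.
    move=> a b ha /andP[eab]; rewrite ha => /eqP/esym hb; split=> //.
    by apply: connect1; rewrite /fiber_edge eab (ext _ _ ha) (ext _ _ hb) eqxx.
- have cone j : exists2 x, phi x = Some (widen_ord (leqnSn t) j) & edge u x.
    have [x px] := model_surj mchi (in_setT j); exists x; first exact: ext.
    by have [] := model_sub mchi px; rewrite inE => /andP[].
  case: (maxP i1) (maxP i2) ni => [->|[j1 ->]] [->|[j2 ->]].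
  + by rewrite /= /complete_edge eqxx.
  + by move=> _; have [x px e] := cone j2; exists u, x.
  + by move=> _; have [x px e] := cone j1; exists x, u; rewrite edge_sym.
  + move=> ni; have e : @edge (complete t) j1 j2.
      by apply: contra ni => /eqP ->.
    have [x [y [px py exy]]] := model_edge mchi (in_setT j1) (in_setT j2) e.
    by exists x, y; rewrite (ext _ _ px) (ext _ _ py).
Qed.

(** Contract edges as long as the density hypothesis is preserved. When this
    fails for each edge, the ends of an edge have at least 2 ^ t common
    neighbours, so the neighbourhood of a vertex u is dense enough to contain
    a complete minor with one vertex less. *)
Lemma mader (t : nat) (G : graph) :
  0 < #|G| -> 2 ^ t * #|G| <= #|arcs G| -> minor_model (complete t) G.
Proof.
elim: t G => [|t IHt] G.
  move=> _ _; apply: (@hom_minor_model (complete 0) G (fun i : 'I_0 => False_rect _ (notF (ltn_ord i)))).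
    by case.
  by case.
have [m] := ubnP #|G|; elim: m G => // m IHm G leGm G0 dense.
have [/existsP[u /existsP[v /andP[euv keep]]]|nokeep] :=
    boolP [exists u : G, exists v : G, edge u v &&
      (2 ^ t.+1 * #|Defs.contract u v| <= #|arcs (Defs.contract u v)|)].
  apply: minor_model_trans (contract_minor_model euv).
  have cardG : #|Defs.contract u v|.+1 = #|G| by exact: card_predC1.
  apply: IHm keep; first by rewrite -ltnS cardG.
  by apply/card_gt0P; exists (Sub u (edge_neq euv)).
have codeg (u v : G) : edge u v -> 2 ^ t <= #|common_nbrs u v|.
  move=> euv; rewrite leqNgt; apply/negP=> lt; case/negP: nokeep.
  apply/existsP; exists u; apply/existsP; exists v; rewrite euv /=.
  have cardG : #|Defs.contract u v|.+1 = #|G| by exact: card_predC1.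
  have := leq_trans dense (arcs_contract euv).
  rewrite -cardG mulnS [leqLHS]addnC => h.
  rewrite -(leq_add2r (2 ^ t.+1)); apply: leq_trans h _.
  by rewrite leq_add2l -mulnS expnS leq_mul2l lt.
have [u [v euv]] : exists u v : G, edge u v.
  have : 0 < #|arcs G| by apply: leq_trans dense; rewrite muln_gt0 expn_gt0.
  by case/card_gt0P=> -[u v]; rewrite inE; exists u, v.
apply: (@complete_minor_cone G t u); apply: IHt.
  have Nv : v \in nbrs_in [set: G] u by rewrite inE in_setT.
  by apply/card_gt0P; exists (Sub v Nv).
rewrite card_arcs_induced mulnC card_sig -sum_nat_const.
apply: leq_sum => x; rewrite inE => /andP[_ eux].
apply: leq_trans (codeg _ _ eux) _; apply/subset_leq_card/subsetP=> y.
by rewrite !inE.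
Qed.

(** * Cones and books as minors *)

Section Cone.
Variables (s m : nat) (Y : graph).

(** The join of a clique on s vertices with the disjoint union of m isolated
    vertices and Y. *)
Definition cone_edge : rel ('I_s + ('I_m + Y))%type :=
  fun x y => match x, y with
             | inl i, inl j => i != j
             | inr (inr a), inr (inr b) => edge a b
             | inr _, inr _ => false
             | _, _ => true
             end.

Lemma cone_sym : symmetric cone_edge.
Proof. by move=> [i|[i|a]] [j|[j|b]] //=; [rewrite eq_sym|rewrite edge_sym]. Qed.

Lemma cone_irr : irreflexive cone_edge.
Proof. by move=> [i|[i|a]] //=; [rewrite eqxx|rewrite edge_irr]. Qed.

Definition cone : graph := Graph cone_sym cone_irr.

End Cone.

(** A model described from the side of its vertices: f embeds those that are
    used, and g tells the branch set of each. *)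
Lemma quotient_minor_model (H G : graph) (B : finType) (f : B -> G) (g : B -> H) :
  injective f -> (forall h, exists b, g b = h) ->
  (forall b b', g b = g b' ->
     connect (fun c d => edge (f c) (f d) && (g c == g d)) b b') ->
  (forall h h', edge h h' ->
     exists b b', [/\ g b = h, g b' = h' & edge (f b) (f b')]) ->
  minor_model H G.
Proof.
move=> f_inj g_surj g_conn g_edge; pose p x := [pick b | f b == x].
have pf b : p (f b) = Some b.
  by rewrite /p; case: pickP => [c /eqP/f_inj-> //|/(_ b)]; rewrite eqxx.
have pE x b : p x = Some b -> x = f b.
  by rewrite /p; case: pickP => [c /eqP <- [->]|].
exists (fun x => omap g (p x)); split=> [x y|h _|x1 x2|h1 h2 _ _ /g_edge].
- by rewrite !inE.
- by have [b <-] := g_surj h; exists (f b); rewrite pf.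
- case E1: (p x1) => [b1|//] _; case E2: (p x2) => [b2|//] /= [g12].
  rewrite (pE _ _ E1) (pE _ _ E2).
  case: (connect_map (P := fun=> True) (h := f)
    (e' := fiber_edge (fun x => omap g (p x))) _ I (g_conn _ _ g12)) => //.
  move=> c d _ /andP[ecd /eqP gcd]; split=> //; apply: connect1.
  by rewrite /fiber_edge ecd !pf /= gcd eqxx.
- by case=> [b1 [b2 [<- <- e]]]; exists (f b1), (f b2); rewrite !pf.
Qed.

(** No edge inside K is required: the branch set of each vertex of K receives
    a vertex of W, which is adjacent to all of K. There remain m vertices of W
    to serve as isolated vertices. *)
Lemma cone_minor_model (G : graph) (K W Z : {set G}) (m : nat) :
  m + #|K| <= #|W| -> [disjoint W & Z] ->
  (forall k x, k \in K -> x \in W :|: Z -> edge k x) ->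
  minor_model (cone #|K| m (induced Z)) G.
Proof.
move=> leW dWZ eK.
pose f (b : ('I_#|K| + 'I_(m + #|K|)) + {x : G | x \in Z}) : G :=
  match b with
  | inl (inl i) => enum_val i
  | inl (inr j) => enum_val (widen_ord leW j)
  | inr z => val z
  end.
pose g (b : ('I_#|K| + 'I_(m + #|K|)) + {x : G | x \in Z}) :
    cone #|K| m (induced Z) :=
  match b with
  | inl (inl i) => inl i
  | inl (inr j) => match split j with inl a => inr (inl a) | inr i => inl i end
  | inr z => inr (inr z)
  end.
have kw i j : edge (f (inl (inl i))) (f (inl (inr j))).
  by apply: eK; rewrite ?enum_valP // inE enum_valP.
have kz i z : edge (f (inl (inl i))) (f (inr z)).
  by apply: eK; rewrite ?enum_valP // inE (valP z) orbT.
apply: (@quotient_minor_model _ _ _ f g).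
- have kw' i j : f (inl (inl i)) <> f (inl (inr j)).
    by move=> e; have := kw i j; rewrite e edge_irr.
  have kz' i z : f (inl (inl i)) <> f (inr z).
    by move=> e; have := kz i z; rewrite e edge_irr.
  have wz j z : f (inl (inr j)) <> f (inr z).
    by move=> e; have := disjointFl dWZ (valP z); rewrite -[val z]/(f (inr z)) -e enum_valP.
  move=> [[i|j]|z] [[i'|j']|z'] //.
  + by move/enum_val_inj => ->.
  + by move/kw'.
  + by move/kz'.
  + by move/esym/kw'.
  + by move/enum_val_inj/(congr1 val) => /= /val_inj ->.
  + by move/wz.
  + by move/esym/kz'.
  + by move/esym/wz.
  + by move/val_inj => ->.
- move=> [i|[a|z]].
  + by exists (inl (inl i)).
  + by exists (inl (inr (lshift _ a))); rewrite /g (unsplitK (inl a)).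
  + by exists (inr z).
- have side i j : g (inl (inl i)) = g (inl (inr j)) ->
      edge (f (inl (inl i))) (f (inl (inr j))) &&
        (g (inl (inl i)) == g (inl (inr j))).
    by move=> ->; rewrite kw eqxx.
  move=> [[i|j]|z] [[i'|j']|z'] //.
  + by move=> [->]; exact: connect0.
  + by move/side => h; exact: connect1.
  + move/esym/side => h; apply: connect1; move: h.
    by rewrite edge_sym eq_sym.
  + rewrite /g => h; suff -> : j = j' by exact: connect0.
    rewrite -[j]splitK -[j']splitK; move: h.
    by case: (split j) => a; case: (split j') => b // [->].
  + by rewrite /g; case: (split j).
  + by rewrite /g; case: (split j').
  + by move=> [->]; exact: connect0.
- have gr i : g (inl (inr (rshift m i))) = inl i by rewrite /g (unsplitK (inr i)).
  have gl a : g (inl (inr (lshift _ a))) = inr (inl a).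
    by rewrite /g (unsplitK (inl a)).
  move=> [i|[a|z]] [i'|[a'|z']] //= e.
  + by exists (inl (inl i)), (inl (inr (rshift m i'))); rewrite gr; split=> //; exact: kw.
  + by exists (inl (inl i)), (inl (inr (lshift _ a'))); rewrite gl; split=> //; exact: kw.
  + by exists (inl (inl i)), (inr z'); split=> //; exact: kz.
  + exists (inl (inr (lshift _ a))), (inl (inl i')); rewrite gl edge_sym.
    by split=> //; exact: kw.
  + by exists (inr z), (inl (inl i')); rewrite edge_sym; split=> //; exact: kz.
  + by exists (inr z), (inr z').
Qed.

Lemma common_nbrs_book (G : graph) (K W : {set G}) (m : nat) :
  m + #|K| <= #|W| -> (forall k x, k \in K -> x \in W -> edge k x) ->
  minor_model (book #|K| m) G.
Proof.
move=> leW eK.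
have W0 : [disjoint W & (set0 : {set G})] by rewrite disjoint_sym disjoints_subset finset.sub0set.
apply: minor_model_trans (cone_minor_model leW W0 _); last by move=> k x Kk; rewrite finset.setU0; exact: eK.
pose f (x : book #|K| m) : cone #|K| m (induced (set0 : {set G})) :=
  match x with inl i => inl i | inr j => inr (inl j) end.
by apply: (@hom_minor_model _ _ f) => -[i|i] [j|j] // [->].
Qed.

(** The set S is contracted to the last vertex of the spine, and B provides
    the pages. *)
Lemma clique_star_book (G : graph) (K S B : {set G}) (a : nat) :
  a <= #|B| -> S != set0 -> connected_in S -> [disjoint S & B] ->
  (forall k x, k \in K -> x \in K :|: (S :|: B) -> k != x -> edge k x) ->
  [disjoint K & S :|: B] ->
  (forall b, b \in B -> exists2 x, x \in S & edge x b) ->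
  minor_model (book #|K|.+1 a) G.
Proof.
move=> leB /set0Pn[x0 Sx0] cS dSB eK dK eB.
pose f (b : ('I_#|K| + {x : G | x \in S}) + 'I_a) : G :=
  match b with
  | inl (inl i) => enum_val i
  | inl (inr x) => val x
  | inr j => enum_val (widen_ord leB j)
  end.
pose g (b : ('I_#|K| + {x : G | x \in S}) + 'I_a) : book #|K|.+1 a :=
  match b with
  | inl (inl i) => inl (widen_ord (leqnSn _) i)
  | inl (inr x) => inl ord_max
  | inr j => inr j
  end.
have Kf i : f (inl (inl i)) \in K by exact: enum_valP.
have Sf x : f (inl (inr x)) \in S by exact: valP.
have Bf j : f (inr j) \in B by exact: enum_valP.
have KS i x : f (inl (inl i)) <> f (inl (inr x)).
  by move=> e; have := disjointFr dK (Kf i); rewrite e inE Sf.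
have KB i x : f (inl (inl i)) <> f (inr x).
  by move=> e; have := disjointFr dK (Kf i); rewrite e inE Bf orbT.
have SB x j : f (inl (inr x)) <> f (inr j).
  by move=> e; have := disjointFr dSB (Sf x); rewrite e Bf.
have eKS i x : edge (f (inl (inl i))) (f (inl (inr x))).
  by apply: eK; rewrite ?Kf // ?inE ?Sf ?orbT //; apply/eqP; exact: KS.
have eKB i j : edge (f (inl (inl i))) (f (inr j)).
  by apply: eK; rewrite ?Kf // ?inE ?Bf ?orbT //; apply/eqP; exact: KB.
have widen_max (i : 'I_#|K|) : widen_ord (leqnSn _) i <> ord_max.
  by move/(congr1 val) => /= jt; have := ltn_ord i; rewrite jt ltnn.
have maxP (i : 'I_#|K|.+1) : i = ord_max \/ exists j, i = widen_ord (leqnSn _) j.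
  have [lt|ge] := ltnP i #|K|; [right; exists (Ordinal lt)|left]; apply: val_inj => //=.
  by apply/eqP; rewrite eqn_leq ge andbT -ltnS.
pose s0 : {x : G | x \in S} := Sub x0 Sx0.
apply: (@quotient_minor_model _ _ _ f g).
- move=> [[i|x]|j] [[i'|x']|j'] //.
  + by move/enum_val_inj => ->.
  + by move/KS.
  + by move/KB.
  + by move/esym/KS.
  + by move/val_inj => ->.
  + by move/SB.
  + by move/esym/KB.
  + by move/esym/SB.
  + by move/enum_val_inj/(congr1 val) => /= /val_inj ->.
- move=> [i|j]; last by exists (inr j).
  have [->|[j ->]] := maxP i; first by exists (inl (inr s0)).
  by exists (inl (inl j)).
- move=> [[i|x]|j] [[i'|x']|j'] //.
  + by case=> ii; rewrite (_ : i = i') ?connect0 //; apply: val_inj.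
  + by case=> h; have := ltn_ord i; rewrite h ltnn.
  + by case=> h; have := ltn_ord i'; rewrite -h ltnn.
  + move=> _; have [|_] := connect_map (P := fun=> True)
      (h := fun y : G => inl (inr (insubd x y)) : ('I_#|K| + {x : G | x \in S}) + 'I_a)
      (e' := fun c d => edge (f c) (f d) && (g c == g d)) _ I
      (cS _ _ (valP x) (valP x')).
      move=> y z _ /and3P[Sy Sz e]; split=> //; apply: connect1.
      by rewrite /= !val_insubd Sy Sz e eqxx.
    by rewrite !valKd.
  + by case=> ->; exact: connect0.
- move=> [i|j] [i'|j'] //= e.
  + have [ii|[k ii]] := maxP i; have [ii'|[k' ii']] := maxP i'; subst i i'.
    * by rewrite eqxx in e.
    * by exists (inl (inr s0)), (inl (inl k')); rewrite edge_sym.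
    * by exists (inl (inl k)), (inl (inr s0)).
    * exists (inl (inl k)), (inl (inl k')); split=> //.
      apply: eK; rewrite ?Kf // ?inE ?Kf //.
      by apply: contra e => /eqP/enum_val_inj ->.
  + have [ii|[k ii]] := maxP i; subst i; last by exists (inl (inl k)), (inr j').
    by have [x Sx ex] := eB _ (Bf j'); exists (inl (inr (Sub x Sx))), (inr j').
  + have [ii|[k ii]] := maxP i'; subst i'.
      have [x Sx ex] := eB _ (Bf j); exists (inr j), (inl (inr (Sub x Sx))).
      by rewrite edge_sym.
    by exists (inr j), (inl (inl k)); rewrite edge_sym.
Qed.

Lemma cover_book (H : graph) (A : {set H}) :
  independent A -> minor_model H (book #|~: A| #|A|).
Proof.
move=> /forall_inP indA.
have /choice[p pP] : forall x : H, exists b : book #|~: A| #|A|,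
    match b with inl i => enum_val i = x | inr j => enum_val j = x end.
  move=> x; have [Ax|nAx] := boolP (x \in A).
    by exists (inr (enum_rank_in Ax x)); rewrite enum_rankK_in.
  have Cx : x \in ~: A by rewrite inE.
  by exists (inl (enum_rank_in Cx x)); rewrite enum_rankK_in.
apply: (@hom_minor_model _ _ p) => x y.
  move: (pP x) (pP y) => + + pxy; rewrite pxy.
  by case: (p y) => i <- <-.
move=> e; move: (pP x) (pP y); case: (p x) => i; case: (p y) => j // hx hy.
  by apply: contraTneq e => ij; rewrite -hx -hy ij edge_irr.
have Ax : x \in A by rewrite -hx enum_valP.
have Ay : y \in A by rewrite -hy enum_valP.
by have /forall_inP/(_ y Ay) := indA x Ax; rewrite e.
Qed.

(** In a cone, the centre of a star minor of Y can be added to the clique. *)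
Lemma starfree_of_cone (s m t : nat) (Y : graph) :
  ~ minor_model (book s.+1 t) (cone s m Y) -> starfree t [set: Y].
Proof.
move=> nm S _ S0 cS; rewrite ltnNge; apply/negP=> leF; apply: nm.
pose K : {set cone s m Y} := [set inl i | i in 'I_s].
pose j (y : Y) : cone s m Y := inr (inr y).
have j_inj : injective j by move=> x y [].
have cardK : #|K| = s by rewrite card_imset ?card_ord // => x y [].
rewrite -[s in book s.+1 _]cardK.
have dK x : x \in K -> exists i, x = inl i by move=> /imsetP[i _ ->]; exists i.
apply: (@clique_star_book _ K (j @: S) (j @: frontier [set: Y] S)).
- by rewrite card_imset.
- by case/set0Pn: S0 => y Sy; apply/set0Pn; exists (j y); exact: imset_f.
- move=> _ _ /imsetP[x Sx ->] /imsetP[y Sy ->].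
  have [|//] := connect_map (P := fun=> True) (h := j)
    (e' := within (j @: S)) _ I (cS _ _ Sx Sy).
  move=> a b _ /and3P[Sa Sb e]; split=> //; apply: connect1.
  by rewrite /within !imset_f.
- apply/pred0P=> x /=; apply/negP=> /andP[/imsetP[y Sy ->]].
  by rewrite mem_imset // !inE Sy.
- move=> _ x /imsetP[i _ ->]; rewrite !inE => /or3P[/imsetP[i' _ ->]|/imsetP[y _ ->]|/imsetP[y _ ->]] //=.
- apply/pred0P=> x /=; apply/negP=> /andP[/dK[i ->]]; rewrite inE.
  by case/orP=> /imsetP[].
- move=> _ /imsetP[y + ->]; rewrite !inE => /andP[_ /existsP[x /andP[Sx e]]].
  by exists (j x); [exact: imset_f|].
Qed.

Lemma cone_mono (s m m' : nat) (Y Y' : graph) :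
  m <= m' -> minor_model Y Y' -> minor_model (cone s m Y) (cone s m' Y').
Proof.
move=> le [phi mphi].
pose psi (x : cone s m' Y') : option (cone s m Y) :=
  match x with
  | inl i => Some (inl i)
  | inr (inl a) => omap (fun b => inr (inl b)) (insub (val a))
  | inr (inr y) => omap (fun b => inr (inr b)) (phi y)
  end.
have psia (a : 'I_m) : psi (inr (inl (widen_ord le a))) = Some (inr (inl a)).
  by rewrite /psi /= (_ : insub _ = Some a) //; exact: valK.
exists psi; split=> [x y|[i|[a|y]] _|x1 x2|y1 y2 _ _].
- by rewrite !inE.
- by exists (inl i).
- by exists (inr (inl (widen_ord le a))).
- by have [x px] := model_surj mphi (in_setT y); exists (inr (inr x)); rewrite /= px.
- case: x1 => [i|[a|x1]]; case: x2 => [i'|[a'|x2]] //=.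
  + by move=> _ [->]; exact: connect0.
  + by case: insub.
  + by case: (phi _).
  + by case: insub.
  + case: insubP => //= b _ ba _; case: insubP => //= b' _ ba' [bb].
    suff -> : a = a' by exact: connect0.
    by apply: val_inj; rewrite /= -[LHS]ba -[RHS]ba' bb.
  + by case: insub => // b _; case: (phi _).
  + by case: (phi _).
  + by case: (phi _) => // y _; case: insub.
  + case E1: (phi x1) => [y|//] _; case E2: (phi x2) => [y'|//] /= [yy].
    have c : connect (fiber_edge phi) x1 x2.
      by apply: (model_conn mphi); rewrite ?E1 ?E2 ?yy.
    have [|//] := connect_map (P := fun=> True) (e' := fiber_edge psi)
      (h := fun x => inr (inr x) : cone s m' Y') _ I c.
    move=> a b _ /andP[e /eqP ab]; split=> //; apply: connect1.
    by rewrite /fiber_edge /= e ab eqxx.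
- case: y1 => [i|[a|y1]]; case: y2 => [i'|[a'|y2]] //= e.
  + by exists (inl i), (inl i').
  + by exists (inl i), (inr (inl (widen_ord le a'))).
  + have [x px] := model_surj mphi (in_setT y2).
    by exists (inl i), (inr (inr x)); rewrite /= px.
  + by exists (inr (inl (widen_ord le a))), (inl i').
  + have [x px] := model_surj mphi (in_setT y1).
    by exists (inr (inr x)), (inl i'); rewrite /= px.
  + have [x1 [x2 [p1 p2 e']]] := model_edge mphi (in_setT y1) (in_setT y2) e.
    by exists (inr (inr x1)), (inr (inr x2)); rewrite /= p1 p2.
Qed.

(** * The parameters of the family *)

Lemma nat_minP (A : classical_sets.set nat) (k0 : nat) : A k0 ->
  A (nat_min A) /\ forall j, A j -> nat_min A <= j.
Proof.
move=> A0; rewrite /nat_min.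
have ex : exists k, A k /\ forall j, A j -> k <= j.
  have ex0 : exists k, `[< A k >] by exists k0; apply/asboolP.
  have := ex_minnP ex0; case=> k /asboolP Ak mink; exists k; split=> // j Aj.
  by apply: mink; apply/asboolP.
exact: (@xgetPex _ 0 (fun k => A k /\ forall j, A j -> k <= j) ex).
Qed.

Lemma indep_numberP (H : graph) :
  exists2 A : {set H}, independent A & #|A| = indep_number H.
Proof.
have : 0 < #|[pred A : {set H} | independent A]|.
  apply/card_gt0P; exists set0; rewrite inE.
  by apply/forall_inP=> x; rewrite inE.
by case/(eq_bigmax_cond (fun A : {set H} => #|A|)) => A iA eA; exists A.
Qed.

Lemma leq_indep_number (H : graph) (A : {set H}) :
  independent A -> #|A| <= indep_number H.
Proof. exact: (@leq_bigmax_cond _ _ (fun B : {set H} => #|B|)). Qed.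

Lemma min_degree_le (H : graph) (x : H) : min_degree H <= degree x.
Proof.
rewrite /min_degree; have := mem_index_enum x.
elim: (index_enum _) => // y r IH; rewrite inE big_cons geq_min.
by case/predU1P=> [->|/IH ->]; rewrite ?leqnn ?orbT.
Qed.

(** The single vertex of the cover is adjacent to all others, as none of these
    is isolated. *)
Lemma star_of_cover1 (H : graph) (A : {set H}) : 0 < min_degree H ->
  independent A -> #|~: A| = 1 -> is_star H.
Proof.
move=> deg /forall_inP iA /eqP/cards1P[c Ac].
have nA x : (x \notin A) = (x == c) by rewrite -in_setC Ac inE.
have Ae x y : x \in A -> y \in A -> edge x y = false.
  by move=> Ax Ay; have /forall_inP/(_ y Ay)/negPf := iA x Ax.
have ecx x : x != c -> edge c x.
  move=> xc; have : 0 < degree x by exact: leq_trans (min_degree_le x).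
  case/card_gt0P=> y; rewrite inE => e; have [<-|yc] := eqVneq y c.
    by rewrite edge_sym.
  have nc z : z != c -> z \in A by rewrite -nA negbK.
  by rewrite Ae ?nc in e.
have cA : c \notin A by rewrite nA.
exists #|A|.
pose g (b : book 1 #|A|) : H := match b with inl _ => c | inr j => enum_val j end.
have gA j : g (inr j) \in A by exact: enum_valP.
have /choice[f fK] : forall x, exists b, g b = x.
  move=> x; have [Ax|] := boolP (x \in A).
    by exists (inr (enum_rank_in Ax x)); rewrite /g enum_rankK_in.
  by rewrite nA => /eqP ->; exists (inl ord0).
have gI : injective g.
  move=> [i|i] [j|j].
  - by rewrite (ord1 i) (ord1 j).
  - by move=> e; have := gA j; rewrite -e (negPf cA).
  - by move=> e; have := gA i; rewrite e (negPf cA).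
  - by move/enum_val_inj => ->.
have gK : cancel g f by move=> b; apply: gI; rewrite fK.
exists f; first by exists g.
move=> x y; rewrite -{2}[x]fK -{2}[y]fK.
case: (f x) => [i|i]; case: (f y) => [j|j] /=.
- by rewrite (ord1 i) (ord1 j) edge_irr eqxx.
- by rewrite ecx //; apply: contraNneq cA => <-; exact: (gA j).
- by rewrite edge_sym ecx //; apply: contraNneq cA => <-; exact: (gA i).
- by rewrite Ae ?enum_valP.
Qed.

Lemma gamma_graph_gt0 (H : graph) :
  0 < min_degree H -> ~ is_star H -> 0 < gamma_graph H.
Proof.
move=> deg nstar; have [A iA cA] := indep_numberP H.
rewrite /gamma_graph -cA -(cardsC A) addKn subn_gt0 ltnNge leq_eqVlt ltnS leqn0.
apply/negP=> /orP[/eqP /(star_of_cover1 deg iA)//|/eqP/cards0_eq C0].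
have AT x : x \in A by apply: contraT; rewrite -in_setC C0 inE.
have [x _|H0] := pickP (xpredT : pred H); last first.
  by move: deg; rewrite /min_degree big_pred0 // eq_card0.
have : 0 < degree x by exact: leq_trans (min_degree_le x).
case/card_gt0P=> y; rewrite inE; apply/negP.
by move/forall_inP: iA => /(_ x (AT x))/forall_inP/(_ y (AT y)).
Qed.

(** The vertices of H whose branch sets meet the spine form a vertex cover:
    the branch sets of the others consist of pages, which are not adjacent. *)
Lemma book_cover (H : graph) (s m : nat) :
  minor_model H (book s m) -> #|H| - indep_number H <= s.
Proof.
move=> [phi mphi].
pose U := [set h | [exists i : 'I_s, phi (inl i) == Some h]].
have cU : #|U| <= s.
  have inj : injective (@Some H) by move=> x y [].
  rewrite -[s in _ <= s](card_ord s) -(card_imset _ inj).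
  apply: leq_trans (leq_imset_card (fun i => phi (inl i)) 'I_s).
  apply/subset_leq_card/subsetP=> _ /imsetP[h + ->].
  by rewrite inE => /existsP[i /eqP <-]; exact: imset_f.
suff iU : independent (~: U).
  rewrite leq_subLR; apply: leq_trans (leq_add (leq_indep_number iU) cU).
  by rewrite addnC cardsC.
have nU x h : phi x = Some h -> h \in ~: U -> exists j, x = inr j.
  case: x => [i|j]; last by exists j.
  by move=> px; rewrite !inE => /existsP[]; exists i; rewrite px.
apply/forall_inP=> x Ux; apply/forall_inP=> y Uy; apply/negP=> e.
have [a [b [pa pb eab]]] := model_edge mphi (in_setT x) (in_setT y) e.
have [j aj] := nU _ _ pa Ux; have [k bk] := nU _ _ pb Uy.
by rewrite aj bk in eab.
Qed.

Section Family.
Variable HH : graph -> Prop.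
Hypothesis HH_nonempty : exists H : graph, HH H.
Hypothesis HH_min_degree : forall H : graph, HH H -> (1 <= min_degree H)%N.
Hypothesis HH_not_star : forall H : graph, HH H -> ~ is_star H.

Lemma minor_free_model (G G' : graph) :
  minor_model G' G -> minor_free HH G -> minor_free HH G'.
Proof.
move=> mGG' mf H hH /minor_modelP mH; apply: (mf H hH).
by apply: minor_of_model; exact: minor_model_trans mH mGG'.
Qed.

Lemma gammaP : (exists2 H, HH H & gamma_graph H = gamma HH) /\
  forall H, HH H -> gamma HH <= gamma_graph H.
Proof.
have [H0 h0] := HH_nonempty; have [] := @nat_minP
  (fun k => exists2 H : graph, HH H & gamma_graph H = k) (gamma_graph H0).
  by exists H0.
by move=> ex mn; split=> // H hH; apply: mn; exists H.
Qed.

Lemma gamma_gt0 : 0 < gamma HH.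
Proof.
have [[H hH <-] _] := gammaP.
by apply: gamma_graph_gt0; [exact: HH_min_degree|exact: HH_not_star].
Qed.

Lemma alphaP : exists2 H, HH H &
  #|H| = (gamma HH).+1 + alpha HH /\ indep_number H = alpha HH.
Proof.
have [H [hH gH _] iH] : exists2 H, minimal HH H & indep_number H = alpha HH.
  have [[H0 h0 g0] _] := gammaP.
  pose N k := exists H : graph, [/\ HH H, gamma_graph H = gamma HH & #|H| = k].
  have N0 : N #|H0| by exists H0.
  have [[H1 [h1 g1 c1]] m1] := nat_minP N0.
  pose P a := exists2 H, minimal HH H & indep_number H = a.
  have exP : exists a, P a.
    exists (indep_number H1), H1 => //; split=> // H' h' g'.
    by rewrite c1; apply: m1; exists H'.
  by rewrite /alpha; exact: (@xgetPex _ 0 P exP).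
exists H => //; split=> //; rewrite -iH.
by move: gH gamma_gt0; rewrite /gamma_graph; lia.
Qed.

Lemma minor_free_book (m : nat) : minor_free HH (book (gamma HH) m).
Proof.
move=> H hH /minor_modelP/book_cover; have := gammaP.2 H hH.
by move: gamma_gt0; rewrite /gamma_graph; lia.
Qed.

(** A minimal member is contained in this book, its independent set among the
    pages. *)
Lemma minor_free_no_book (G : graph) :
  minor_free HH G -> ~ minor_model (book (gamma HH).+1 (alpha HH)) G.
Proof.
have [H hH [cH iH]] := alphaP; have [A iA cA] := indep_numberP H.
move=> mf mb; apply: (mf H hH); apply: minor_of_model; apply: minor_model_trans mb.
rewrite -[alpha HH]iH -cA; have -> : (gamma HH).+1 = #|~: A|.
  by have := cardsC A; rewrite cA iH cH; lia.
exact: cover_book.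
Qed.

(** The order of a member bounds the complete minors of G, hence the density
    of all induced subgraphs. *)
Lemma minor_free_sparse : exists C : nat, forall G : graph, minor_free HH G ->
  forall A : {set G}, \sum_(x in A) #|nbrs_in A x| <= C * #|A|.
Proof.
have [H hH] := HH_nonempty; exists (2 ^ #|H|) => G mf A.
rewrite -card_arcs_induced leqNgt; apply/negP=> dense; apply: (mf H hH).
apply: minor_of_model; apply: minor_model_trans (induced_minor_model A).
have cA : #|induced A| = #|A| by rewrite card_sig; apply: eq_card.
apply: (@minor_model_trans _ (complete #|H|)); last first.
  apply: mader; last by rewrite cA ltnW.
  rewrite cA; case: posnP => // A0; move: dense; rewrite A0 muln0.
  rewrite -sum_degree big_pred0 // => x.
  by have := card0_eq (etrans cA A0) x; rewrite !inE.
apply: (@hom_minor_model H (complete #|H|) enum_rank); first exact: enum_rank_inj.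
move=> x y e; apply: contraTneq e => /= /enum_rank_inj ->.
by rewrite edge_irr.
Qed.

(** If no w works, then for each w there are a graph Y w, with a minor-free
    cone on w isolated vertices, and a number q w of isolated vertices for
    which the cone is no longer minor-free. None of the graphs Y w has K_(1,
    alpha HH) as a minor. Choose values of w growing so fast that each exceeds
    the numbers q of all the preceding ones: then Y at one value is a minor of
    Y at a later one, and so is the forbidden cone over the former of the
    minor-free cone over the latter. *)
Lemma isolated_vertices_free : exists w : nat, forall Y : graph,
  minor_free HH (cone (gamma HH) w Y) ->
  forall m, minor_free HH (cone (gamma HH) m Y).
Proof.
apply: contrapT => nw.
have /choice[Y YP] : forall w, exists Y : graph,
    minor_free HH (cone (gamma HH) w Y) /\
    exists m, ~ minor_free HH (cone (gamma HH) m Y).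
  move=> w; apply: contrapT => noY; apply: nw; exists w => Y mfw m.
  by apply: contrapT => nm; apply: noY; exists Y; split=> //; exists m.
have /choice[q qP] : forall w, exists m,
    ~ minor_free HH (cone (gamma HH) m (Y w)) by move=> w; case: (YP w).
(* The cone over the i-th graph fails with q (w i) isolated vertices, a
   number that is at most w j for each j > i. *)
pose w := fix w n := if n is k.+1 then maxn (w k) (q (w k)) else 0.
have wq i j : i < j -> q (w i) <= w j.
  elim: j => // j IH; rewrite ltnS leq_eqVlt => /predU1P[->|/IH le] /=.
    exact: leq_maxr.
  exact: leq_trans le (leq_maxl _ _).
have [|i [j [ij mij]]] := @starfree_wqo (alpha HH) (fun i => Y (w i)).
  move=> i; apply: (@starfree_of_cone (gamma HH) (w i)).
  by apply: minor_free_no_book; case: (YP (w i)).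
apply: (qP (w i)); have [mf _] := YP (w j).
exact: minor_free_model (cone_mono _ (wq _ _ ij) mij) mf.
Qed.

End Family.
(** * The spectral radius as a maximal Rayleigh quotient *)

Local Open Scope ring_scope.

Section Rayleigh.
Variables (R : realType) (G : graph).
Implicit Types x y : G -> R.

Definition bform x y : R := \sum_u \sum_(v | edge u v) x u * y v.
Definition qform x : R := bform x x.
Definition inner x y : R := \sum_u x u * y u.
Definition sqnorm x : R := inner x x.

Lemma bform_sym x y : bform x y = bform y x.
Proof.
rewrite /bform (exchange_big_dep xpredT) //=; apply: eq_bigr => u _.
by apply: eq_big => [v|v _]; [rewrite edge_sym|rewrite mulrC].
Qed.

Lemma bformDl x x' y c :
  bform (fun u => x u + c * x' u) y = bform x y + c * bform x' y.
Proof.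
rewrite /bform mulr_sumr -big_split /=; apply: eq_bigr => u _.
rewrite mulr_sumr -big_split /=; apply: eq_bigr => v _.
by rewrite mulrDl mulrA.
Qed.

Lemma bformDr x y y' c :
  bform x (fun u => y u + c * y' u) = bform x y + c * bform x y'.
Proof. by rewrite bform_sym bformDl bform_sym (bform_sym y'). Qed.

Lemma innerDl x x' y c :
  inner (fun u => x u + c * x' u) y = inner x y + c * inner x' y.
Proof.
rewrite /inner mulr_sumr -big_split /=; apply: eq_bigr => u _.
by rewrite mulrDl mulrA.
Qed.

Lemma inner_sym x y : inner x y = inner y x.
Proof. by apply: eq_bigr => u _; rewrite mulrC. Qed.

Lemma innerDr x y y' c :
  inner x (fun u => y u + c * y' u) = inner x y + c * inner x y'.
Proof. by rewrite inner_sym innerDl inner_sym (inner_sym y'). Qed.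

Lemma sqnorm_ge0 x : 0 <= sqnorm x.
Proof. by apply: sumr_ge0 => u _; rewrite -expr2 sqr_ge0. Qed.

Lemma sqnorm_eq0 x : sqnorm x = 0 -> forall u, x u = 0.
Proof.
move=> /eqP; rewrite psumr_eq0 => [/allP x0 u|u _]; last by rewrite -expr2 sqr_ge0.
have := x0 u (mem_index_enum u).
by rewrite implyTb mulf_eq0 orbb => /eqP.
Qed.

Lemma qformZ x c : qform (fun u => c * x u) = c ^+ 2 * qform x.
Proof.
rewrite /qform /bform mulr_sumr; apply: eq_bigr => u _; rewrite mulr_sumr.
by apply: eq_bigr => v _; rewrite expr2 mulrACA.
Qed.

Lemma sqnormZ x c : sqnorm (fun u => c * x u) = c ^+ 2 * sqnorm x.
Proof.
rewrite /sqnorm /inner mulr_sumr; apply: eq_bigr => u _.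
by rewrite expr2 mulrACA.
Qed.

Lemma qform_norm x : qform x <= qform (fun u => `|x u|).
Proof.
apply: ler_sum => u _; apply: ler_sum => v _.
by rewrite -normrM ler_norm.
Qed.

Lemma sqnorm_norm x : sqnorm (fun u => `|x u|) = sqnorm x.
Proof. by apply: eq_bigr => u _; rewrite -normrM ger0_norm // -expr2 sqr_ge0. Qed.

(** The first-order condition at an extremum: the choice h = p / (`|c| + 1)
    makes the linear term prevail. *)
Lemma linear_term0 (p c : R) : (forall h, 2 * h * p <= h ^+ 2 * c) -> p = 0.
Proof.
move=> le; apply/eqP; apply: contraT => p0.
have k0 : 0 < `|c| + 1 by rewrite ltr_pwDr.
have := le (p / (`|c| + 1)); rewrite expr_div_n -subr_ge0.
have -> : p ^+ 2 / (`|c| + 1) ^+ 2 * c - 2 * (p / (`|c| + 1)) * p =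
    p ^+ 2 / (`|c| + 1) ^+ 2 * (c - 2 * (`|c| + 1)).
  by field; rewrite gt_eqF.
have pos : 0 < p ^+ 2 / (`|c| + 1) ^+ 2.
  by apply: divr_gt0; [rewrite exprn_even_gt0|exact: exprn_gt0].
by rewrite pmulr_rge0 //; have := ler_norm c; lra.
Qed.

Definition of_row (v : 'rV[R]_#|G|) : G -> R := fun u => v ord0 (enum_rank u).

Lemma continuous_sum (T : topologicalType) (I : Type) (r : seq I) (P : pred I)
    (F : I -> T -> R) :
  (forall i, continuous (F i)) -> continuous (fun v => \sum_(i <- r | P i) F i v).
Proof.
by move=> cF; apply: continuous_big => [|i _]; [exact: add_continuous|exact: cF].
Qed.

Lemma continuous_of_row u v :
  continuous (fun w : 'rV[R]_#|G| => of_row w u * of_row w v).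
Proof.
have cc (z : G) (w : 'rV[R]_#|G|) : (of_row v z @[v --> w] --> of_row w z)%classic.
  exact: (@coord_continuous R 1 #|G| ord0 (enum_rank z) w).
by move=> w; apply: cvgM; [exact: nbhs_filter|exact: cc|exact: cc].
Qed.

Lemma continuous_qform_row : continuous (fun v => qform (of_row v)).
Proof.
apply: continuous_sum => u; apply: continuous_sum => v.
exact: continuous_of_row.
Qed.

Lemma continuous_sqnorm_row : continuous (fun v => sqnorm (of_row v)).
Proof. by apply: continuous_sum => u; exact: continuous_of_row. Qed.

Definition row_of x : 'rV[R]_#|G| := \row_i x (enum_val i).

Lemma row_ofK x : of_row (row_of x) = x.
Proof. by apply/funext => u; rewrite /of_row mxE enum_rankK. Qed.

(** The unit sphere is compact, and replacing the entries of a maximizer by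
    their absolute values does not decrease the quadratic form. *)
Lemma rayleigh_max : (0 < #|G|)%N ->
  exists x, [/\ sqnorm x = 1, forall u, 0 <= x u &
    forall y, qform y <= qform x * sqnorm y].
Proof.
case/card_gt0P=> u0 _.
pose S : classical_sets.set 'rV[R]_#|G| := fun v => sqnorm (of_row v) = 1.
have S0 : exists v, S v.
  exists (row_of (fun u => (u == u0)%:R)); rewrite /S row_ofK /sqnorm /inner.
  rewrite (bigD1 u0) //= eqxx mulr1 big1 ?addr0 // => u /negPf ->.
  by rewrite mulr0.
have cS : compact S.
  pose B (i : 'I_#|G|) : classical_sets.set R := fun r => r \in `[-1, 1].
  pose box : classical_sets.set 'rV[R]_#|G| := fun v => forall i, B i (v ord0 i).
  have cbox : compact box by apply: rV_compact => i; exact: segment_compact.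
  apply: subclosed_compact cbox _.
  - rewrite (_ : S = (fun v => sqnorm (of_row v)) @^-1` (fun r : R => r = 1))%classic //.
    apply: preimage_closed; last exact: closed_eq.
    by move=> v _; exact: continuous_sqnorm_row.
  - move=> v Sv i; rewrite /B in_itv /= -ler_norml -(@ler_pXn2r _ 2) ?nnegrE //.
    rewrite expr1n -normrX ger0_norm ?sqr_ge0 // -Sv /sqnorm /inner.
    rewrite (bigD1 (enum_val i)) //= /of_row enum_valK -expr2 lerDl.
    by apply: sumr_ge0 => u _; rewrite -expr2 sqr_ge0.
have [|c /set_mem Sc maxc] := EVT_max_rV S0 cS (f := fun v => qform (of_row v)).
  by apply: continuous_subspaceT; exact: continuous_qform_row.
pose x u := `|of_row c u|.
have nx : sqnorm x = 1 by rewrite /x sqnorm_norm.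
exists x; split=> [//|u|y]; first exact: normr_ge0.
apply: (@le_trans _ _ (qform (of_row c) * sqnorm y)).
  have [y0|y0] := eqVneq (sqnorm y) 0.
    rewrite y0 mulr0 /qform /bform big1 // => u _; rewrite big1 // => v _.
    by rewrite (sqnorm_eq0 y0) mul0r.
  have ny : 0 < sqnorm y by rewrite lt_neqAle eq_sym y0 sqnorm_ge0.
  pose k := (Num.sqrt (sqnorm y))^-1.
  have k2 : k ^+ 2 = (sqnorm y)^-1 by rewrite exprVn sqr_sqrtr // ltW.
  have := maxc (row_of (fun u => k * y u)); rewrite row_ofK qformZ k2.
  rewrite mulrC ler_pdivrMr //; apply; apply/mem_set.
  by rewrite /S row_ofK sqnormZ k2 mulVf.
by rewrite ler_wpM2r ?sqnorm_ge0 // qform_norm.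
Qed.

Lemma bform_eigen x y (r : R) :
  (forall u, \sum_(v | edge u v) y v = r * y u) -> bform x y = r * inner x y.
Proof.
move=> ey; rewrite /bform mulr_sumr; apply: eq_bigr => u _.
by rewrite -mulr_sumr ey mulrCA.
Qed.

Lemma bform_delta x u :
  bform (fun v => (v == u)%:R) x = \sum_(v | edge u v) x v.
Proof.
rewrite /bform (bigD1 u) //= [X in _ + X]big1 => [|v /negPf ->].
  by rewrite addr0 eqxx; apply: eq_bigr => v _; rewrite mul1r.
by rewrite big1 // => w _; rewrite mul0r.
Qed.

Lemma inner_delta x u : inner (fun v => (v == u)%:R) x = x u.
Proof.
rewrite /inner (bigD1 u) //= [X in _ + X]big1 => [|v /negPf ->].
  by rewrite addr0 eqxx mul1r.
by rewrite mul0r.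
Qed.

(** Perturb x along the indicator function of u and apply [linear_term0]. *)
Lemma eigen_of_max x : sqnorm x = 1 ->
  (forall y, qform y <= qform x * sqnorm y) ->
  forall u, \sum_(v | edge u v) x v = qform x * x u.
Proof.
move=> nx maxx u; pose d (v : G) : R := (v == u)%:R.
apply/eqP; rewrite -subr_eq0; apply/eqP.
apply: (@linear_term0 _ (qform x * sqnorm d - qform d)) => h.
have := maxx (fun v => x v + h * d v).
rewrite /qform /sqnorm bformDl !bformDr innerDl !innerDr.
rewrite (bform_sym x d) (inner_sym x d) bform_delta inner_delta.
rewrite -/(qform x) -/(sqnorm x) -/(qform d) -/(sqnorm d) nx.
by move=> le; lra.
Qed.

Lemma eigenvalue_adjacencyP (a : R) : eigenvalue (adjacency R G) a <->
  exists2 x : G -> R, exists u, x u != 0 & forall u, \sum_(v | edge u v) x v = a * x u.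
Proof.
have adjE x i : (row_of x *m adjacency R G) ord0 i =
    \sum_(v | edge (enum_val i) v) x v.
  rewrite !mxE (reindex _ (onW_bij _ (@enum_rank_bij G))) /= [RHS]big_mkcond /=.
  apply: eq_bigr => v _; rewrite !mxE !enum_rankK edge_sym.
  by case: edge; rewrite ?mulr1 ?mulr0.
split=> [/eigenvalueP[v vA v0]|[x [u xu] ex]].
  exists (of_row v).
    apply: contrapT => nou; case/negP: v0; apply/eqP/rowP => i; rewrite mxE.
    apply/eqP; apply: contraT => vi; case: nou; exists (enum_val i).
    by rewrite /of_row enum_valK.
  move=> u; have rv : v = row_of (of_row v).
    by apply/rowP=> i; rewrite mxE /of_row enum_valK.
  have := congr1 (fun w : 'rV_#|G| => w ord0 (enum_rank u)) vA.
  by rewrite {1}rv adjE enum_rankK mxE.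
apply/eigenvalueP; exists (row_of x).
  by apply/rowP=> i; rewrite adjE ex !mxE.
apply: contra xu => /eqP x0.
by rewrite -[x]row_ofK x0 /of_row mxE.
Qed.

Lemma spectral_radius_max : (0 < #|G|)%N -> exists x : G -> R,
  [/\ sqnorm x = 1, forall u, 0 <= x u,
    forall y, qform y <= spectral_radius R G * sqnorm y &
    forall u, \sum_(v | edge u v) x v = spectral_radius R G * x u].
Proof.
move=> /rayleigh_max[x [nx x0 maxx]]; have ex := eigen_of_max nx maxx.
suff rE : spectral_radius R G = qform x by exists x; rewrite rE.
have ub : ubound (fun a : R => eigenvalue (adjacency R G) a) (qform x).
  move=> a /eigenvalue_adjacencyP[y [u yu] ey].
  have := maxx y; rewrite {1}/qform (bform_eigen _ ey) ler_pM2r //.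
  rewrite lt_neqAle sqnorm_ge0 andbT eq_sym; apply: contra yu => /eqP y0.
  by rewrite (sqnorm_eq0 y0).
have mem : eigenvalue (adjacency R G) (qform x).
  apply/eigenvalue_adjacencyP; exists x => //.
  apply: contrapT => nou; move: nx; rewrite /sqnorm /inner big1 => [/eqP|u _].
    by rewrite eq_sym oner_eq0.
  have [->|xu] := eqVneq (x u) 0; first by rewrite mul0r.
  by case: nou; exists u.
apply/eqP; rewrite eq_le /spectral_radius; apply/andP; split.
  by apply: ge_sup => //; exists (qform x).
by apply: ub_le_sup => //; exists (qform x).
Qed.

Lemma rayleigh y : qform y <= spectral_radius R G * sqnorm y.
Proof.
have [G0|G0] := posnP #|G|.
  have no (u : G) : False by have := fintype0 u G0.
  by rewrite /qform /bform /sqnorm /inner !big1 ?mulr0 // => u; case: (no u).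
by have [x [_ _ + _]] := spectral_radius_max G0; exact.
Qed.

Lemma perron : (0 < #|G|)%N -> exists x : G -> R,
  [/\ forall v, 0 <= x v <= 1, exists u, x u = 1 &
    forall v, \sum_(u | edge v u) x u = spectral_radius R G * x v].
Proof.
move=> G0; have [x [nx x0 _ ex]] := spectral_radius_max G0.
have /card_gt0P[u0 _] := G0.
have [u _ maxu] : exists2 u, true & forall v, x v <= x u.
  by case: (@arg_maxP _ _ _ u0 xpredT x) => // u _ maxu; exists u => // v; exact: maxu.
have xu : 0 < x u.
  rewrite lt_neqAle x0 andbT eq_sym; apply/eqP=> xu.
  have z v : x v = 0 by apply/eqP; rewrite eq_le x0 -xu maxu.
  by move/eqP: nx; rewrite /sqnorm /inner big1 ?(eq_sym 0) ?oner_eq0 // => v _; rewrite z mul0r.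
exists (fun v => x v / x u); split.
- by move=> v; rewrite divr_ge0 // ler_pdivrMr // mul1r maxu.
- by exists u; rewrite divff // gt_eqF.
- by move=> v; rewrite -mulr_suml ex mulrA.
Qed.

End Rayleigh.

Section SpexAttained.
Variable R : realType.

Lemma spectral_radius_hom (G G' : graph) (f : G -> G') :
  (0 < #|G|)%N -> bijective f -> {homo f : x y / edge x y} ->
  spectral_radius R G <= spectral_radius R G'.
Proof.
move=> G0 f_bij hom; have [x [nx x0 _ ex]] := spectral_radius_max R G0.
have [g fK gK] := f_bij; pose y v := x (g v).
have ny : sqnorm y = 1.
  rewrite -nx /sqnorm /inner (reindex f (onW_bij _ f_bij)) /=.
  by apply: eq_bigr => u _; rewrite /y fK.
have := rayleigh y; rewrite ny mulr1; apply: le_trans.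
have <- : qform x = spectral_radius R G.
  by rewrite /qform (bform_eigen _ ex) -/(sqnorm x) nx mulr1.
rewrite /qform /bform [leRHS](reindex f (onW_bij _ f_bij)) /=; apply: ler_sum => u _.
rewrite [leRHS](reindex f (onW_bij _ f_bij)) /= [leLHS]big_mkcond [leRHS]big_mkcond /=.
apply: ler_sum => v _; rewrite /y !fK; case: ifP => [/hom -> //|_].
by case: ifP => // _; rewrite mulr_ge0.
Qed.

Lemma spectral_radius_le_card (G : graph) :
  (0 < #|G|)%N -> spectral_radius R G <= #|G|%:R.
Proof.
move=> /(perron R)[x [x01 [u xu] ex]].
have := ex u; rewrite xu mulr1 => <-.
apply: (@le_trans _ _ (\sum_(v : G) 1)); last by rewrite sumr_const.
rewrite big_mkcond; apply: ler_sum => v _.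
by case: ifP => _; rewrite ?ler01 //; have /andP[_] := x01 v.
Qed.

Variable HH : graph -> Prop.

Lemma spex_ub (n : nat) (G : graph) : (0 < n)%N -> minor_free_order n HH G ->
  spectral_radius R G <= spex R n HH.
Proof.
move=> n0 mfG; apply: ub_le_sup; last by exists G.
exists n%:R => _ [H [cH _] <-]; rewrite -cH; apply: spectral_radius_le_card.
by rewrite cH.
Qed.

Section CodedGraph.
Variables (n : nat) (e : {ffun 'I_n * 'I_n -> bool}).

(** Symmetrizing and removing the diagonal makes any boolean matrix a graph,
    so that the graphs of order n are indexed by a finite type, up to
    isomorphism. *)
Definition coded_edge : rel 'I_n := fun i j => (i != j) && (e (i, j) || e (j, i)).

Lemma coded_sym : symmetric coded_edge.
Proof. by move=> i j; rewrite /coded_edge eq_sym orbC. Qed.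

Lemma coded_irr : irreflexive coded_edge.
Proof. by move=> i; rewrite /coded_edge eqxx. Qed.

Definition coded_graph : graph := Graph coded_sym coded_irr.

End CodedGraph.

Lemma coded_graphP (n : nat) (G : graph) : #|G| = n ->
  exists e : {ffun 'I_n * 'I_n -> bool}, iso (coded_graph e) G.
Proof.
move=> <-; exists [ffun p => edge (enum_val p.1) (enum_val p.2)].
exists enum_val; first exact: enum_val_bij.
move=> i j; rewrite /= /coded_edge !ffunE /= (edge_sym (enum_val j)) orbb.
by case: eqP => [->|//]; rewrite edge_irr.
Qed.

Lemma spectral_radius_iso (G H : graph) : (0 < #|G|)%N -> iso G H ->
  spectral_radius R G = spectral_radius R H.
Proof.
move=> G0 [f f_bij f_mono]; have [g fK gK] := f_bij.
apply/eqP; rewrite eq_le; apply/andP; split.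
  by apply: (spectral_radius_hom (f := f)) => // x y; rewrite f_mono.
apply: (spectral_radius_hom (f := g)); first by rewrite -(bij_eq_card f_bij).
  by exists f.
by move=> x y; rewrite -{1}[x]gK -{1}[y]gK f_mono.
Qed.

Lemma iso_minor_model (G H : graph) : iso G H -> minor_model G H.
Proof.
move=> [f f_bij f_mono]; apply: (@hom_minor_model _ _ f); first exact: bij_inj.
by move=> x y; rewrite f_mono.
Qed.

(** Up to isomorphism, there are finitely many graphs of order n. *)
Lemma spex_attained (n : nat) : (0 < n)%N ->
  (exists G, minor_free_order n HH G) -> exists G, SPEX R n HH G.
Proof.
move=> n0 [G0 [cG0 mfG0]].
pose good (e : {ffun 'I_n * 'I_n -> bool}) := `[< minor_free HH (coded_graph e) >].
have code (G : graph) : #|G| = n -> minor_free HH G -> exists e,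
    good e /\ spectral_radius R (coded_graph e) = spectral_radius R G.
  move=> cG mfG; have [e iso_e] := coded_graphP cG; exists e; split.
    by apply/asboolP; apply: minor_free_model mfG; exact: iso_minor_model.
  by apply: spectral_radius_iso => //; rewrite card_ord.
have [e0 [ge0 _]] := code _ cG0 mfG0.
have [e ge maxe] : exists2 e, good e & forall e', good e' ->
    spectral_radius R (coded_graph e') <= spectral_radius R (coded_graph e).
  by case: (arg_maxP (fun e => spectral_radius R (coded_graph e)) ge0) => e; exists e.
have mfe : minor_free_order n HH (coded_graph e).
  by split; [rewrite card_ord|exact/asboolP].
exists (coded_graph e); split=> //; apply/eqP; rewrite eq_le spex_ub //=.
apply: ge_sup; first by exists (spectral_radius R (coded_graph e)), (coded_graph e).
move=> _ [G [cG mfG] <-]; have [e' [ge' <-]] := code _ cG mfG.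
exact: maxe.
Qed.

End SpexAttained.
(** * Large entries of the Perron vector *)

Definition common (G : graph) (K : {set G}) : {set G} :=
  [set x | [forall k in K, edge k x]].

Lemma commonP (G : graph) (K : {set G}) x :
  reflect (forall k, k \in K -> edge k x) (x \in common K).
Proof. by rewrite inE; exact: forall_inP. Qed.

Lemma common_disjoint (G : graph) (K : {set G}) : [disjoint K & common K].
Proof.
apply/pred0P=> x /=; apply/negP=> /andP[Kx /commonP/(_ x Kx)].
by rewrite edge_irr.
Qed.

Lemma card_subset_of_size (T : finType) (A : {set T}) (m : nat) :
  (m <= #|A|)%N -> exists2 B : {set T}, B \subset A & #|B| = m.
Proof.
elim: m => [|m IH] le; first by exists set0; rewrite ?cards0 // finset.sub0set.
have [B sBA cB] := IH (ltnW le).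
have : (0 < #|A :\: B|)%N by rewrite cardsD (finset.setIidPr sBA) cB subn_gt0.
case/card_gt0P=> x; rewrite inE => /andP[nBx Ax]; exists (x |: B).
  by apply/subsetP=> y; rewrite !inE => /predU1P[->//|/(subsetP sBA)].
by rewrite cardsU1 nBx cB.
Qed.

Lemma card_bigcup_le (T I : finType) (P : pred I) (F : I -> {set T}) (t : nat) :
  (forall i, P i -> #|F i| <= t)%N -> (#|\bigcup_(i | P i) F i| <= #|P| * t)%N.
Proof.
move=> leF; rewrite -sum_nat_const.
apply: (@leq_trans (\sum_(i | P i) #|F i|)); last exact: leq_sum.
apply: (big_ind2 (fun (A : {set T}) m => (#|A| <= m)%N)) => //.
  by rewrite cards0.
move=> A m B k leA leB; apply: leq_trans (leq_card_setU _ _) _; exact: leq_add.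
Qed.

Lemma card_common (G : graph) (K : {set G}) :
  (#|G| <= #|common K| + \sum_(k in K) (#|G| - degree k))%N.
Proof.
rewrite -[leqLHS](cardsC (common K)) leq_add2l.
have sub : ~: common K \subset \bigcup_(k in K) ~: nbrs_in [set: G] k.
  apply/subsetP=> x; rewrite !inE => /forall_inPn[k Kk nkx].
  by apply/bigcupP; exists k; rewrite ?inE.
apply: leq_trans (subset_leq_card sub) _.
apply: (big_ind2 (fun (A : {set G}) m => (#|A| <= m)%N)) => [||k _].
- by rewrite cards0.
- move=> A m B k leA leB; apply: leq_trans (leq_card_setU _ _) _; exact: leq_add.
- rewrite cardsCs finset.setCK. apply: leq_sub2l.
  by apply/subset_leq_card/subsetP=> y; rewrite !inE.
Qed.

Section Perron.
Variables (R : realType) (G : graph) (s t C : nat) (x : G -> R) (rho : R).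
Hypothesis s_gt0 : (0 < s)%N.
Hypothesis C_gt0 : (0 < C)%N.
Hypothesis sparse :
  forall A : {set G}, (\sum_(u in A) #|nbrs_in A u| <= C * #|A|)%N.
Hypothesis no_bip :
  forall K : {set G}, #|K| = s.+1 -> (#|common K| < t)%N.
Hypothesis x01 : forall v, 0 <= x v <= 1.
Hypothesis eigen : forall v, \sum_(u | edge v u) x u = rho * x v.
Hypothesis rho_ge0 : 0 <= rho.

Local Notation n := (#|G|%:R : R).
Local Notation c := (C%:R : R).

Definition heavy (e : R) : {set G} := [set v | e <= x v].

Lemma x_ge0 v : 0 <= x v. Proof. by case/andP: (x01 v). Qed.
Lemma x_le1 v : x v <= 1. Proof. by case/andP: (x01 v). Qed.

Lemma degreeE (v : G) : degree v = #|nbrs_in [set: G] v|.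
Proof. by apply: eq_card => y; rewrite !inE. Qed.

Lemma sum_degree_le : \sum_(v : G) (degree v)%:R <= c * n.
Proof.
rewrite -natr_sum -natrM ler_nat -cardsT.
apply: leq_trans (sparse setT); rewrite leq_eqVlt; apply/orP; left; apply/eqP.
by apply: eq_big => [v|v _]; [rewrite in_setT|exact: degreeE].
Qed.

Lemma sum_degree_set_le (A : {set G}) : \sum_(v in A) (degree v)%:R <= c * n.
Proof.
apply: le_trans sum_degree_le; rewrite big_mkcond; apply: ler_sum => v _.
by case: ifP.
Qed.

Lemma bip_le (A B : {set G}) :
  (\sum_(a in A) #|nbrs_in B a| <= C * (#|A| + #|B|))%N.
Proof.
apply: (@leq_trans (\sum_(a in A :|: B) #|nbrs_in (A :|: B) a|)).
  rewrite [leqRHS](bigID (mem A)) /=.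
  apply: leq_trans (leq_addr _ _).
  rewrite [leqRHS](eq_bigl (mem A)) => [|a].
    by apply: leq_sum => a _; apply: nbrs_inS; exact: finset.subsetUr.
  rewrite inE; change (mem A a) with (a \in A).
  by case: (a \in A); rewrite ?andbF.
apply: leq_trans (sparse _) _; rewrite leq_mul2l leq_card_setU orbT //.
Qed.

(** Entries are at most 1, so the eigenvalue equation at v reads rho * x v <=
    degree v. *)
Lemma card_heavy_le e : e * rho * #|heavy e|%:R <= c * n.
Proof.
apply: le_trans (sum_degree_set_le (heavy e)).
rewrite -sum1_card natr_sum mulr_sumr; apply: ler_sum => v; rewrite inE => xv.
rewrite mulr1; apply: (@le_trans _ _ (rho * x v)).
  by rewrite mulrC ler_wpM2l.
rewrite -eigen /degree -sum1_card natr_sum.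
rewrite (eq_bigl (edge v)) => [|u]; last by rewrite inE.
by apply: ler_sum => u _; exact: x_le1.
Qed.

(** Iterating the eigenvalue equation expresses rho ^+ 2 * x v as a sum over
    the walks (v, u, w). Those that end at an entry below e contribute at most
    e times the sum of all degrees. *)
Lemma two_walk e v : 0 <= e ->
  rho ^+ 2 * x v <= e * (c * n) +
    \sum_(u | edge v u) \sum_(w in nbrs_in (heavy e) u) x w.
Proof.
move=> e0; rewrite expr2 -mulrA -eigen mulr_sumr.
under eq_bigr do rewrite -eigen.
have split_sum u : \sum_(w | edge u w) x w <=
    e * (degree u)%:R + \sum_(w in nbrs_in (heavy e) u) x w.
  rewrite (bigID (mem (heavy e))) /= addrC; apply: lerD.
    rewrite /degree -sum1_card natr_sum mulr_sumr.
    rewrite big_mkcond [leRHS]big_mkcond; apply: ler_sum => w _.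
    rewrite !inE; case: (edge u w) => //=; case: (leP e (x w)) => /= xw;
      by rewrite ?mulr1 // ltW.
  rewrite le_eqVlt; apply/orP; left; apply/eqP; apply: eq_bigl => w.
  by rewrite [in RHS]inE andbC.
apply: (@le_trans _ _ (\sum_(u | edge v u) (e * (degree u)%:R +
    \sum_(w in nbrs_in (heavy e) u) x w))).
  by apply: ler_sum => u _; exact: split_sum.
rewrite big_split /= lerD2r -mulr_sumr ler_wpM2l //.
apply: le_trans sum_degree_le; rewrite big_mkcond; apply: ler_sum => u _.
by case: ifP.
Qed.

Lemma sum_heavy_le e u :
  \sum_(w in nbrs_in (heavy e) u) x w <= #|nbrs_in (heavy e) u|%:R.
Proof.
by rewrite -sum1_card natr_sum; apply: ler_sum => w _; exact: x_le1.
Qed.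

(** Use two thresholds, eta and a much smaller e. Once rho is large,
    [card_heavy_le] makes the set of entries above e small compared with n. By
    [two_walk], a vertex whose entry is at least eta then has degree of order
    n, and the sum of all degrees leaves room for a bounded number of such
    vertices. *)
Lemma few_heavy eta : 0 < eta -> n / 2 <= rho ^+ 2 ->
  64 * c ^+ 3 <= eta ^+ 2 * rho -> eta * #|heavy eta|%:R <= 4 * c ^+ 2.
Proof.
move=> eta0 rho2 rho_big.
have c1 : 1 <= c by rewrite ler1n.
have [G0|G0] := posnP #|G|.
  rewrite (_ : #|heavy eta| = 0%N) ?mulr0 ?mulr_ge0 ?exprn_ge0 //.
  by apply/eqP; rewrite -leqn0 -G0 max_card.
have n0 : 0 < n by rewrite ltr0n.
have rho0 : 0 < rho.
  rewrite lt_neqAle rho_ge0 andbT; apply: contraTneq rho_big => <-.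
  by rewrite mulr0 -ltNge mulr_gt0 // exprn_gt0 // (lt_le_trans ltr01).
(* With this threshold the term e * (c * n) of the two-walk bound is eta * n
   / 8, against a left-hand side of at least eta * n / 2. *)
pose e := eta / (8 * c).
have c8 : 0 < 8 * c by lra.
have e0 : 0 < e by rewrite divr_gt0.
have eE : e * (8 * c) = eta by rewrite /e divfK // gt_eqF.
have card_e : c * #|heavy e|%:R <= eta * n / 8.
  have := card_heavy_le e => le.
  have : c * #|heavy e|%:R * (eta ^+ 2 * rho) <= eta * n / 8 * (eta ^+ 2 * rho).
    have -> : c * #|heavy e|%:R * (eta ^+ 2 * rho) =
        eta * (8 * c ^+ 2) * (e * rho * #|heavy e|%:R).
      by rewrite -eE; ring.
    apply: (@le_trans _ _ (eta * (8 * c ^+ 2) * (c * n))).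
      by rewrite ler_wpM2l // mulr_ge0 ?ltW // mulr_gt0 // exprn_gt0; lra.
    have -> : eta * (8 * c ^+ 2) * (c * n) = eta * n / 8 * (64 * c ^+ 3) by field.
    by rewrite ler_wpM2l // divr_ge0 // mulr_ge0 // ltW.
  by rewrite ler_pM2r // mulr_gt0 // exprn_gt0.
have deg v : v \in heavy eta -> eta * n / (4 * c) <= (degree v)%:R.
  rewrite inE => xv.
  have := two_walk v (ltW e0).
  have : \sum_(u | edge v u) \sum_(w in nbrs_in (heavy e) u) x w <=
      c * (degree v)%:R + c * #|heavy e|%:R.
    apply: (@le_trans _ _ (\sum_(u in nbrs_in setT v) #|nbrs_in (heavy e) u|%:R)).
      rewrite (eq_bigl (mem (nbrs_in setT v))) => [|u]; last by rewrite !inE.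
      by apply: ler_sum => u _; exact: sum_heavy_le.
    by rewrite -natr_sum degreeE -mulrDr -natrD -natrM ler_nat bip_le.
  have : eta * n / 2 <= rho ^+ 2 * x v.
    have -> : eta * n / 2 = n / 2 * eta by ring.
    by apply: ler_pM => //; rewrite ?divr_ge0 // ltW.
  have -> : e * (c * n) = eta * n / 8 by rewrite -eE; field.
  move: card_e; set D := (degree v)%:R; set H := #|heavy e|%:R.
  set S := \sum_(u | _) _; set X := rho ^+ 2 * x v => h1 h2 h3 h4.
  have h5 : eta * n / 4 <= c * D by lra.
  have -> : eta * n / (4 * c) = eta * n / 4 / c by field; lra.
  by rewrite ler_pdivrMr ?(mulrC D) //; lra.
have : \sum_(v in heavy eta) (eta * n / (4 * c)) <= c * n.
  by apply: le_trans (sum_degree_set_le (heavy eta)); apply: ler_sum.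
rewrite sumr_const -[_ *+ _]mulr_natr => le.
have : eta * #|heavy eta|%:R * n <= 4 * c ^+ 2 * n.
  have -> : eta * #|heavy eta|%:R * n =
      (4 * c) * (eta * n / (4 * c) * #|heavy eta|%:R) by field; lra.
  have -> : 4 * c ^+ 2 * n = (4 * c) * (c * n) by ring.
  by rewrite ler_wpM2l //; lra.
by rewrite ler_pM2r.
Qed.

Definition crowded (L : {set G}) : {set G} := [set u | s < #|nbrs_in L u|]%N.

(** Each set of s.+1 vertices of L has fewer than t common neighbours. *)
Lemma card_crowded (L : {set G}) : (#|crowded L| <= 2 ^ #|L| * t)%N.
Proof.
pose P (K : {set G}) := (K \subset L) && (#|K| == s.+1).
have sub : crowded L \subset \bigcup_(K | P K) common K.
  apply/subsetP=> u; rewrite inE => /card_subset_of_size[K sK cK].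
  apply/bigcupP; exists K.
    rewrite /P cK eqxx andbT; apply: subset_trans sK _.
    by apply/subsetP=> w; rewrite inE => /andP[].
  by apply/commonP=> k /(subsetP sK); rewrite inE edge_sym => /andP[].
apply: leq_trans (subset_leq_card sub) _.
apply: (@leq_trans (#|P| * t)).
  by apply: card_bigcup_le => K /andP[_ /eqP cK]; rewrite ltnW // no_bip.
rewrite leq_mul2r -card_powerset; apply/orP; right.
by apply/subset_leq_card/subsetP=> K /andP[sK _]; rewrite inE.
Qed.

Lemma sum_uncrowded (L A : {set G}) (f : G -> R) (q : R) (B : nat) :
  (#|L| <= B)%N -> 0 <= q ->
  (forall u, u \in A -> u \notin crowded L -> f u <= q) ->
  (forall u, f u <= #|nbrs_in L u|%:R) ->
  \sum_(u in A) f u <= q * #|A|%:R + (B * (2 ^ B * t))%:R.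
Proof.
move=> LB q0 fq fL.
rewrite (bigID (mem (crowded L))) /= addrC; apply: lerD.
  rewrite -sum1_card natr_sum mulr_sumr big_mkcond [leRHS]big_mkcond.
  apply: ler_sum => u _; case: (boolP (u \in A)) => //= Au.
  by case: ifP; rewrite mulr1 // => /(fq _ Au).
apply: (@le_trans _ _ (\sum_(u in crowded L) B%:R)).
  rewrite big_mkcond [leRHS]big_mkcond; apply: ler_sum => u _.
  case: (u \in A); case: (u \in crowded L) => //=.
  apply: le_trans (fL u) _; rewrite ler_nat; apply: leq_trans LB.
  by apply/subset_leq_card/subsetP=> w; rewrite inE => /andP[].
by rewrite sumr_const -mulrnA ler_nat leq_mul2l (leq_trans (card_crowded L)) ?orbT // leq_mul2r leq_exp2l // LB orbT.
Qed.

Lemma nbrs_sum (F : G -> R) v :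
  \sum_(u | edge v u) F u = \sum_(u in nbrs_in setT v) F u.
Proof. by apply: eq_bigl => u; rewrite !inE. Qed.

Section Dominating.
Variables (delta : R) (B : nat).
Hypothesis delta_gt0 : 0 < delta.
Hypothesis delta_small : 8 * (s%:R + 1) * delta <= 1.
Let eta : R := delta / (4 * c).
Let Q : R := (B * (2 ^ B * t))%:R.
Hypothesis heavy_le : (#|heavy eta| <= B)%N.
Hypothesis rho_big : s%:R * n - s%:R ^+ 2 <= rho ^+ 2.
Hypothesis n_big : 4 * (s%:R ^+ 2 + Q + t%:R + s%:R) <= delta * n.

Local Notation sR := (s%:R : R).

Lemma s_ge1 : 1 <= sR. Proof. by rewrite ler1n. Qed.

Lemma Q_ge0 : 0 <= Q. Proof. exact: ler0n. Qed.

Lemma delta_le : delta <= 1 / 16.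
Proof. by have := s_ge1; have := delta_small; have := delta_gt0; nra. Qed.

Lemma eta_gt0 : 0 < eta.
Proof. by rewrite divr_gt0 // mulr_gt0 // ltr0n. Qed.

Lemma etaE : eta * (c * n) = delta / 4 * n.
Proof. by rewrite /eta; field; rewrite pnatr_eq0 -lt0n. Qed.

(** All but boundedly many neighbours of v have at most s heavy neighbours. *)
Lemma walk_le_degree v :
  rho ^+ 2 * x v <= delta / 4 * n + sR * (degree v)%:R + Q.
Proof.
apply: le_trans (two_walk v (ltW eta_gt0)) _; rewrite etaE -addrA lerD2l nbrs_sum.
rewrite degreeE; apply: (@sum_uncrowded (heavy eta)) => //.
  move=> u _; rewrite inE -leqNgt => le.
  by apply: le_trans (sum_heavy_le _ _) _; rewrite ler_nat.
by move=> u; exact: sum_heavy_le.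
Qed.

Lemma degree_le_n (v : G) : (degree v)%:R <= n.
Proof. by rewrite ler_nat max_card. Qed.

Let K := heavy (1 - delta).

Lemma degree_dominating v : v \in K -> (1 - 2 * delta) * n <= (degree v)%:R.
Proof.
rewrite inE => xv; have le := walk_le_degree v.
have s1 := s_ge1; have s0 : 0 < sR by lra.
rewrite -(ler_pM2l s0).
have h : (sR * n - sR ^+ 2) * (1 - delta) <= rho ^+ 2 * x v.
  apply: (@le_trans _ _ (rho ^+ 2 * (1 - delta))).
    by apply: ler_wpM2r => //; have := delta_le; lra.
  by apply: ler_wpM2l => //; exact: sqr_ge0.
have sm : delta * n <= sR * (delta * n).
  by rewrite ler_peMl // mulr_ge0 // ltW.
have ss : 0 <= sR ^+ 2 * delta by rewrite mulr_ge0 ?sqr_ge0 // ltW.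
have t0 : 0 <= t%:R :> R by [].
move: le h sm ss n_big Q_ge0.
have -> : (sR * n - sR ^+ 2) * (1 - delta) =
  sR * n - sR ^+ 2 - sR * (delta * n) + sR ^+ 2 * delta by ring.
have -> : sR * ((1 - 2 * delta) * n) = sR * n - 2 * (sR * (delta * n)) by ring.
have -> : delta / 4 * n = delta * n / 4 by ring.
set D := sR * (degree v)%:R; set X := rho ^+ 2 * x v; set E := sR ^+ 2 * delta.
set S2 := sR ^+ 2; set M := sR * (delta * n); set m := delta * n; set P := sR * n.
have S20 : 0 <= S2 by exact: sqr_ge0.
by lra.
Qed.

(** Count the walks of length 2 that start from the vertex with entry 1. If K
    has fewer than s elements, an uncrowded vertex has either fewer than s
    heavy neighbours or exactly s, one of which has entry below 1 - delta; it
    sees a total weight of at most s - delta, and rho ^+ 2 cannot be reached. *)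
Lemma card_dominating_ge (u0 : G) : x u0 = 1 -> (s <= #|K|)%N.
Proof.
move=> xu; rewrite leqNgt; apply/negP=> ltK.
have : rho ^+ 2 * x u0 <= delta / 4 * n + ((sR - delta) * (degree u0)%:R + Q).
  apply: le_trans (two_walk u0 (ltW eta_gt0)) _; rewrite etaE lerD2l nbrs_sum.
  have dl := delta_le; have s1 := s_ge1.
  rewrite degreeE; apply: (@sum_uncrowded (heavy eta)) => //; first by lra.
    move=> u _; rewrite inE -leqNgt => le.
    have [lt|] := ltnP #|nbrs_in (heavy eta) u| s.
      apply: le_trans (sum_heavy_le _ _) _.
      apply: (@le_trans _ _ (s.-1%:R)); first by rewrite ler_nat -ltnS prednK.
      by rewrite -subn1 natrB //; lra.
    move=> ge; have cN : #|nbrs_in (heavy eta) u| = s by apply/eqP; rewrite eqn_leq le.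
    have [w Nw nKw] : exists2 w, w \in nbrs_in (heavy eta) u & w \notin K.
      apply/subsetPn; apply/negP=> /subset_leq_card; rewrite cN.
      by rewrite leqNgt ltK.
    rewrite (bigD1 w) //=; apply: (@le_trans _ _ ((1 - delta) + (s.-1)%:R)).
      apply: lerD; first by move: nKw; rewrite inE -ltNge => /ltW.
      rewrite -cN (cardsD1 w) Nw /= -sum1_card natr_sum.
      rewrite [leRHS](eq_bigl (fun i => (i \in nbrs_in (heavy eta) u) && (i != w))).
        by apply: ler_sum => z _; exact: x_le1.
      by move=> z; rewrite in_setD1 andbC.
    by rewrite -subn1 natrB //; lra.
  by move=> u; exact: sum_heavy_le.
rewrite xu mulr1 => le; have dn := degree_le_n u0.
have dl := delta_le; have s1 := s_ge1.
have : (sR - delta) * (degree u0)%:R <= (sR - delta) * n.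
  by rewrite ler_wpM2l //; lra.
have S2 : 0 <= sR ^+ 2 by exact: sqr_ge0.
have t0 : 0 <= t%:R :> R by [].
move: le dn n_big Q_ge0 rho_big S2.
have -> : (sR - delta) * n = sR * n - delta * n by ring.
have -> : delta / 4 * n = delta * n / 4 by ring.
set D := (sR - delta) * _; set X := rho ^+ 2; set Y := sR ^+ 2.
by set m := delta * n; set P := sR * n; lra.
Qed.

Lemma common_dominating (A : {set G}) : A \subset K ->
  n <= #|common A|%:R + #|A|%:R * (2 * delta * n).
Proof.
move=> sAK; have := card_common A; rewrite -(ler_nat R) natrD => /le_trans; apply.
rewrite lerD2l natr_sum -sum1_card natr_sum mulr_suml; apply: ler_sum => k Ak.
rewrite natrB ?max_card // mul1r.
by have := degree_dominating (subsetP sAK _ Ak); lra.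
Qed.

(** Otherwise s.+1 vertices of K would have almost all vertices as common
    neighbours. *)
Lemma card_dominating (u0 : G) : x u0 = 1 -> #|K| = s.
Proof.
move=> xu; apply/eqP; rewrite eqn_leq (card_dominating_ge xu) andbT leqNgt.
apply/negP=> /card_subset_of_size[A sA cA].
have := common_dominating sA; have := no_bip cA; rewrite cA -(ltr_nat R).
move=> lt le; have S2 : 0 <= sR ^+ 2 by exact: sqr_ge0.
have n0 : 0 <= n by [].
have t0 : 0 <= t%:R :> R by [].
have h : 8 * (sR + 1) * delta * n <= n by rewrite ler_piMl.
have dn : delta * n <= 1 / 16 * n by rewrite ler_wpM2r // delta_le.
move: lt le n_big Q_ge0 h dn s_ge1; rewrite -natr1.
set Z := #|common A|%:R; set Y := sR ^+ 2 in S2 *.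
have -> : (sR + 1) * (2 * delta * n) = 8 * (sR + 1) * delta * n / 4 by field.
by set W := 8 * (sR + 1) * delta * n; lra.
Qed.

Lemma card_common_dominating (u0 : G) : x u0 = 1 ->
  n - 2 * sR * delta * n <= #|common K|%:R.
Proof.
move=> xu; have := common_dominating (subxx _); rewrite (card_dominating xu).
by rewrite -/K; nra.
Qed.

Lemma nbrs_common (v : G) (u0 : G) : x u0 = 1 -> v \notin K ->
  (#|nbrs_in (common K) v| < t)%N.
Proof.
move=> xu nKv; have cK : #|v |: K| = s.+1 by rewrite cardsU1 nKv (card_dominating xu).
apply: leq_ltn_trans (no_bip cK); apply/subset_leq_card/subsetP=> y.
rewrite in_set => /andP[/commonP cy e]; apply/commonP=> k.
by rewrite !inE => /predU1P[->//|Kk]; apply: cy; rewrite inE.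
Qed.

(** By [nbrs_common], a vertex outside K has few neighbours among the common
    neighbours of K, that is, among almost all vertices; so its degree is
    small, and [walk_le_degree] applies. *)
Lemma small_outside (v : G) (u0 : G) : x u0 = 1 -> v \notin K ->
  x v <= 3 * sR * delta.
Proof.
move=> xu nKv; have le := walk_le_degree v.
have deg : (degree v)%:R <= t%:R + 2 * sR * delta * n.
  have h : (degree v <= #|nbrs_in (common K) v| + #|~: common K|)%N.
    rewrite degreeE; apply: leq_trans (leq_card_setU _ _).
    by apply/subset_leq_card/subsetP=> y; rewrite !inE => /andP[_ ->]; rewrite andbT orbN.
  have h2 : (#|~: common K|%:R : R) = n - #|common K|%:R.
    by rewrite -(cardsC (common K)) natrD; ring.
  have := card_common_dominating xu; have := nbrs_common xu nKv.
  move: h; rewrite -(ler_nat R) -(ltr_nat R) natrD h2.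
  by set a := #|nbrs_in _ _|%:R; set b := #|common K|%:R; lra.
have s1 := s_ge1; have n0 : 0 <= n by [].
have t0 : 0 <= t%:R :> R by [].
have Gn0 : 0 < n.
  by rewrite ltr0n; apply/card_gt0P; exists v.
have m0 : 0 < delta * n by rewrite mulr_gt0.
have S2 : sR <= sR ^+ 2 by rewrite expr2 ler_peMl //; lra.
have h1 : (sR * n - sR ^+ 2) * x v <= rho ^+ 2 * x v.
  by rewrite ler_wpM2r // x_ge0.
have sn0 : 0 < sR * n by rewrite mulr_gt0 //; lra.
rewrite -(ler_pM2l sn0).
have hx : sR ^+ 2 * x v <= sR ^+ 2 by rewrite ler_piMr ?sqr_ge0 ?x_le1.
have hd : sR * (degree v)%:R <= sR * (t%:R + 2 * sR * delta * n).
  by rewrite ler_wpM2l //; lra.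
have ht : sR * t%:R <= sR * (delta * n / 4).
  by rewrite ler_wpM2l //; have := n_big; have := Q_ge0; lra.
have hs : sR * (delta * n) <= sR ^+ 2 * (delta * n) by rewrite ler_wpM2r // ltW.
have h1s : delta * n <= sR * (delta * n) by rewrite ler_peMl // ltW.
move: le h1 hx hd ht hs h1s n_big Q_ge0.
have -> : sR * n * (3 * sR * delta) = 3 * (sR ^+ 2 * (delta * n)) by ring.
have -> : (sR * n - sR ^+ 2) * x v = sR * n * x v - sR ^+ 2 * x v by ring.
have -> : sR * (t%:R + 2 * sR * delta * n) = sR * t%:R + 2 * (sR ^+ 2 * (delta * n)) by ring.
set Y := sR ^+ 2 * (delta * n); set Z := sR * (delta * n).
have -> : sR * (delta * n / 4) = Z / 4 by rewrite /Z; ring.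
have -> : delta / 4 * n = delta * n / 4 by ring.
set X := sR * n * x v; set W := sR ^+ 2 * x v; set V := rho ^+ 2 * x v.
set U := sR * (degree v)%:R; set T := sR * t%:R; set m := delta * n.
by lra.
Qed.

End Dominating.

End Perron.

(** * Joining the dominating vertices to everything *)

Section Rewire.
Variables (G : graph) (K Y : {set G}).

(** Outside K, only the edges inside Y survive: up to isolated vertices, this
    is the cone over the subgraph induced by Y. *)
Definition rewire_edge : rel G := fun u v =>
  (u != v) && [|| u \in K, v \in K | [&& u \in Y, v \in Y & edge u v]].

Lemma rewire_sym : symmetric rewire_edge.
Proof.
move=> u v; rewrite /rewire_edge eq_sym edge_sym.
by case: (u \in K); case: (v \in K); case: (u \in Y); case: (v \in Y).
Qed.

Lemma rewire_irr : irreflexive rewire_edge.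
Proof. by move=> u; rewrite /rewire_edge eqxx. Qed.

Definition rewire : graph := Graph rewire_sym rewire_irr.

End Rewire.

Section Compare.
Variables (R : realType) (G : graph) (K W : {set G}) (t C : nat).
Variables (x : G -> R) (rho theta b : R).

Let A : {set G} := common K.
Let B : {set G} := ~: (K :|: A).
Let sigma : R := \sum_(k in K) x k.
Let E (u v : G) : R := (edge u v)%:R.

Hypothesis sparse :
  forall A : {set G}, (\sum_(u in A) #|nbrs_in A u| <= C * #|A|)%N.
Hypothesis x_ge0 : forall v, 0 <= x v.
Hypothesis eigen : forall v, \sum_(u | edge v u) x u = rho * x v.
Hypothesis rho_ge1 : 1 <= rho.
Hypothesis K_gt0 : (0 < #|K|)%N.
Hypothesis x_K : forall k, k \in K -> 3 / 4 <= x k.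
Hypothesis x_out : forall v, v \notin K -> x v <= theta.
Hypothesis few_nbrs : forall v, v \notin K -> (#|nbrs_in A v| <= t)%N.
Hypothesis theta_small : (t%:R + C%:R) * theta <= 1 / 4.
Hypothesis W_sub : W \subset A.
Hypothesis x_W : forall w, w \in W -> rho * x w <= b.
Hypothesis b_small : 2 * (#|W|%:R * (b * (t%:R * theta))) < 1 / 2.
Hypothesis theta_ge0 : 0 <= theta.

Lemma A_notK v : v \in A -> v \notin K.
Proof. by move=> Av; rewrite (disjointFl (common_disjoint K) Av). Qed.

Lemma sum3 (F : G -> R) :
  \sum_v F v = \sum_(v in K) F v + \sum_(v in A) F v + \sum_(v in B) F v.
Proof.
rewrite (bigID (mem K)) /= -addrA; congr (_ + _).
rewrite (bigID (mem A)) /=; congr (_ + _); apply: eq_bigl => v.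
  by apply/andP/idP => [[]//|Av]; rewrite A_notK.
by rewrite !inE negb_or.
Qed.

Lemma sum_edge u (F : G -> R) : \sum_(v | edge u v) F v = \sum_v E u v * F v.
Proof.
rewrite big_mkcond; apply: eq_bigr => v _; rewrite /E.
by case: edge; rewrite ?mul1r ?mul0r.
Qed.

Lemma E_sym u v : E u v = E v u. Proof. by rewrite /E edge_sym. Qed.
Lemma E_ge0 u v : 0 <= E u v. Proof. exact: ler0n. Qed.

Lemma E_KA u v : u \in K -> v \in A -> E u v = 1.
Proof. by move=> Ku /commonP/(_ u Ku); rewrite /E => ->. Qed.

Lemma rho_gt0 : 0 < rho. Proof. exact: lt_le_trans ltr01 rho_ge1. Qed.

Lemma sigma_ge : 3 / 4 <= sigma.
Proof.
have /card_gt0P[k Kk] := K_gt0; rewrite /sigma (bigD1 k) //=.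
by apply: ler_wpDr; [apply: sumr_ge0|exact: x_K].
Qed.

Lemma sum_nbrs_le (S : {set G}) v : (forall u, u \in S -> u \notin K) ->
  \sum_(u in S) E v u * x u <= theta * #|nbrs_in S v|%:R.
Proof.
move=> nK; rewrite -sum1_card natr_sum mulr_sumr big_mkcond [leRHS]big_mkcond.
apply: ler_sum => u _; rewrite inE /E; case: (boolP (u \in S)) => //= Su.
by case: edge; rewrite ?mul0r // mul1r mulr1 x_out // nK.
Qed.

(** The eigenvalue equation at v, without the terms from B. *)
Definition pull (v : G) : R := \sum_(u in K) E u v * x u + \sum_(u in A) E u v * x u.

(** A vertex of B misses an entry of K, which is at least 3 / 4. *)
Lemma pull_le v : v \in B -> pull v <= sigma - 3 / 4 + t%:R * theta.
Proof.
rewrite !inE negb_or => /andP[nKv /forall_inPn[k Kk nkv]].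
apply: lerD.
  rewrite /sigma !(bigD1 k Kk) /= /E (negPf nkv) mul0r add0r.
  apply: (@le_trans _ _ (\sum_(i in K | i != k) x i)).
    by apply: ler_sum => u _; rewrite ler_piMl // lern1 leq_b1.
  by have := x_K Kk; lra.
rewrite (eq_bigr (fun u => E v u * x u)) => [|u _]; last by rewrite E_sym.
apply: le_trans (sum_nbrs_le _ (fun u => @A_notK u)) _.
by rewrite mulrC ler_wpM2r // ler_nat few_nbrs.
Qed.

(** Sum the eigenvalue equations over B. By sparsity, the arcs inside B
    contribute no more than C theta for each vertex on average. *)
Lemma sum_B_le : rho * \sum_(v in B) x v <= #|B|%:R * (sigma - 1 / 2).
Proof.
have BK u : u \in B -> u \notin K by rewrite !inE negb_or => /andP[].
have row v : v \in B -> rho * x v <= sigma - 3 / 4 + t%:R * theta + theta * #|nbrs_in B v|%:R.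
  move=> Bv; rewrite -eigen sum_edge sum3; apply: lerD; last exact: sum_nbrs_le.
  apply: le_trans (pull_le Bv); rewrite le_eqVlt; apply/orP; left; apply/eqP.
  by congr (_ + _); apply: eq_bigr => u _; rewrite E_sym.
rewrite mulr_sumr; apply: le_trans (ler_sum _ row) _.
rewrite big_split /= sumr_const -[_ *+ #|_|]mulr_natl -mulr_sumr -natr_sum.
have := sparse B; rewrite -(ler_nat R) natrM => h.
have h' : theta * (\sum_(i in B) #|nbrs_in B i|)%:R <= theta * (C%:R * #|B|%:R).
  by rewrite ler_wpM2l.
have hB : #|B|%:R * ((t%:R + C%:R) * theta) <= #|B|%:R * (1 / 4) :> R.
  by rewrite ler_wpM2l.
move: h' hB; set P := theta * _; set Q := #|B|%:R.
have -> : Q * (sigma - 3 / 4 + t%:R * theta) + P =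
  Q * (sigma - 3 / 4) + Q * ((t%:R + C%:R) * theta) + (P - theta * (C%:R * Q)) by ring.
have -> : Q * (sigma - 1 / 2) = Q * (sigma - 3 / 4) + Q * (1 / 4) by field.
set U := theta * (C%:R * Q); set V := Q * (sigma - 3 / 4).
by set X := Q * (_ * _); lra.
Qed.

(** The value sigma / rho solves the eigenvalue equation for a vertex whose
    neighbourhood is K. *)
Definition new_vec (v : G) : R := if v \in B then sigma / rho else x v.

Local Notation G' := (rewire K (A :\: W)).

(** The sum of new_vec u * residual u tells whether the Rayleigh quotient of
    new_vec in the rewired graph exceeds rho. *)
Definition residual (u : G) : R :=
  \sum_(v : G | rewire_edge K (A :\: W) u v) new_vec v - rho * new_vec u.

Lemma new_vecP v : v \notin B -> new_vec v = x v.
Proof. by rewrite /new_vec => /negPf->. Qed.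

Lemma K_notB v : v \in K -> v \notin B.
Proof. by move=> Kv; rewrite !inE Kv. Qed.

Lemma A_notB v : v \in A -> v \notin B.
Proof. by move=> Av; rewrite in_setC in_setU Av orbT. Qed.

Lemma sum_edge' u (F : G -> R) : \sum_(v : G | rewire_edge K (A :\: W) u v) F v =
  \sum_v (rewire_edge K (A :\: W) u v)%:R * F v.
Proof.
rewrite big_mkcond; apply: eq_bigr => v _.
by case: rewire_edge; rewrite ?mul1r ?mul0r.
Qed.

Lemma residual_B u : u \in B -> residual u = 0.
Proof.
move=> Bu; rewrite /residual {2}/new_vec Bu mulrC divfK ?gt_eqF ?rho_gt0 //.
apply/eqP; rewrite subr_eq0 /sigma; apply/eqP.
have nKu : u \notin K by move: Bu; rewrite !inE negb_or => /andP[].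
have nAu : u \notin A by move: Bu; rewrite in_setC in_setU negb_or => /andP[].
apply: eq_big => v.
  rewrite /rewire_edge (negPf nKu) in_setD (negPf nAu) andbF /= orbF.
  by case: eqP => // <-; rewrite (negPf nKu).
by move=> e; rewrite new_vecP //; apply: K_notB; move: e; rewrite /rewire_edge (negPf nKu) in_setD (negPf nAu) andbF /= orbF => /andP[].
Qed.

Lemma residual_K u : u \in K ->
  residual u = #|B|%:R * (sigma / rho) - \sum_(v in B) E u v * x v +
    \sum_(v in K) ((u != v)%:R - E u v) * x v.
Proof.
move=> Ku; rewrite /residual (new_vecP (K_notB Ku)) -eigen sum_edge sum_edge' !sum3.
have ne v : v \notin K -> u != v by apply: contraNneq => <-.
rewrite (eq_bigr (fun v => (u != v)%:R * x v)) => [|v Kv]; last first.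
  by rewrite /rewire_edge Ku /= andbT new_vecP // K_notB.
rewrite (eq_bigr (P := fun v => v \in A) (fun v => E u v * x v)) => [|v Av]; last first.
  rewrite /rewire_edge Ku /= andbT new_vecP ?A_notB // (E_KA Ku Av).
  by rewrite ne // A_notK.
rewrite (eq_bigr (P := fun v => v \in B) (fun=> sigma / rho)) => [|v Bv]; last first.
  rewrite /rewire_edge Ku /= andbT /new_vec Bv ne ?mul1r //.
  by apply: contraL Bv; exact: K_notB.
rewrite sumr_const -[_ *+ _]mulr_natl.
rewrite [in RHS](eq_bigr (P := fun v => v \in K) (fun v => (u != v)%:R * x v - E u v * x v)) => [|v _]; last by rewrite mulrBl.
rewrite sumrB; set a := \sum_(v in K) _; set d := \sum_(v in A) _.
by set e := \sum_(v in K) _; set f := \sum_(v in B) _; ring.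
Qed.

(** The indicator function of the edges that the rewiring removes inside A. *)
Definition cut (u v : G) : R := E u v * ((u \in W) || (v \in W))%:R.

Lemma residual_A u : u \in A ->
  residual u = - \sum_(v in B) E u v * x v - \sum_(v in A) cut u v * x v.
Proof.
move=> Au; have nKu := A_notK Au.
rewrite /residual (new_vecP (A_notB Au)) -eigen sum_edge sum_edge' !sum3.
rewrite (eq_bigr (P := fun v => v \in K) (fun v => E u v * x v)) => [|v Kv]; last first.
  rewrite E_sym (E_KA Kv Au) /rewire_edge Kv orbT andbT new_vecP ?K_notB //.
  by rewrite (_ : u != v) //; apply: contraNneq nKu => ->.
rewrite (eq_bigr (P := fun v => v \in A) (fun v => (E u v - cut u v) * x v)) => [|v Av]; last first.
  rewrite /rewire_edge (negPf nKu) (negPf (A_notK Av)) !in_setD Au Av !andbT /=.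
  rewrite new_vecP ?A_notB //; congr (_ * _); rewrite /cut /E.
  have [<-|_] := eqVneq u v; first by rewrite edge_irr mul0r subrr.
  by case: (u \in W); case: (v \in W); case: edge; rewrite /= ?mulr1 ?mulr0 ?subrr ?subr0.
rewrite (eq_bigr (P := fun v => v \in B) (fun=> 0)) => [|v Bv]; last first.
  have nKv : v \notin K by apply: contraL Bv; exact: K_notB.
  have nAv : v \notin A by apply: contraL Bv; exact: A_notB.
  by rewrite /rewire_edge (negPf nKu) (negPf nKv) !in_setD (negPf nAv) !andbF /= mul0r.
rewrite big1_eq (eq_bigr (P := fun v => v \in A) (fun v => E u v * x v - cut u v * x v)) => [|v _]; last by rewrite mulrBl.
rewrite sumrB; set a := \sum_(v in K) _; set d := \sum_(v in A) E u v * _.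
by set e := \sum_(v in A) _; set f := \sum_(v in B) _; ring.
Qed.

(** Each edge concerned has an end in W, where the entry is at most b / rho; a
    vertex of W has at most t neighbours in A, with entries at most theta. *)
Lemma cut_sum_le : rho * \sum_(u in A) x u * \sum_(v in A) cut u v * x v < 1 / 2.
Proof.
apply: le_lt_trans b_small.
have cut_le u v : cut u v <= (u \in W)%:R * E u v + (v \in W)%:R * E u v.
  rewrite /cut; have := E_ge0 u v.
  by case: (u \in W); case: (v \in W) => /=; lra.
pose S := \sum_(u in W) x u * \sum_(v in A) E u v * x v.
have W_le : rho * S <= #|W|%:R * (b * (t%:R * theta)).
  rewrite mulr_sumr -sum1_card natr_sum mulr_suml; apply: ler_sum => w Ww.
  rewrite mul1r mulrA; apply: ler_pM.
  - by rewrite mulr_ge0 // ltW // rho_gt0.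
  - by apply: sumr_ge0 => v _; rewrite mulr_ge0 // E_ge0.
  - exact: x_W.
  - apply: le_trans (sum_nbrs_le _ (fun u => @A_notK u)) _.
    by rewrite mulrC ler_wpM2r // ler_nat few_nbrs // A_notK // (subsetP W_sub).
apply: (@le_trans _ _ (rho * (2 * S))); last by rewrite mulrCA ler_wpM2l.
rewrite ler_wpM2l ?(ltW rho_gt0) //.
have SE : S = \sum_(u in A) x u * \sum_(v in A) (u \in W)%:R * E u v * x v.
  rewrite [RHS](bigID (mem W)) /= [X in _ = _ + X]big1 => [|u /andP[_ /negPf nWu]].
    rewrite addr0 [RHS](eq_bigl (fun u => u \in W)) => [|u].
      apply: eq_bigr => u Wu; congr (_ * _); apply: eq_bigr => v _.
      by rewrite Wu mul1r.
    by apply/andP/idP => [[]//|Wu]; rewrite (subsetP W_sub).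
  by rewrite big1 ?mulr0 // => v _; rewrite nWu !mul0r.
have SE' : S = \sum_(u in A) x u * \sum_(v in A) (v \in W)%:R * E u v * x v.
  rewrite SE; under eq_bigr do rewrite mulr_sumr.
  rewrite exchange_big /=; apply: eq_bigr => u _; rewrite mulr_sumr.
  by apply: eq_bigr => v _; rewrite (E_sym u v); ring.
have -> : 2 * S = S + S by ring.
rewrite [X in X + _]SE [X in _ + X]SE' -big_split /=; apply: ler_sum => u _.
rewrite -mulrDr ler_wpM2l // -big_split /=; apply: ler_sum => v _.
by rewrite -mulrDl ler_wpM2r.
Qed.

(** Multiply everything by rho. A vertex of B gains sigma ^+ 2, by its new
    edges to K, and loses at most (sigma - 1 / 2) ^+ 2 with its former edges
    to K and A, on average; the difference is at least 1 / 2, since sigma >= 3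
    / 4. A missing edge inside K gains at least (3 / 4) ^+ 2. Both exceed the
    loss from W ([cut_sum_le]). *)
Lemma rewire_gain :
  B != set0 \/ (exists k l, [/\ k \in K, l \in K, k != l & ~~ edge k l]) ->
  rho * sqnorm new_vec < @qform R G' new_vec.
Proof.
move=> gain; rewrite -subr_gt0.
have -> : @qform R G' new_vec - rho * sqnorm new_vec = \sum_u new_vec u * residual u.
  rewrite /qform /bform /sqnorm /inner mulr_sumr -sumrB; apply: eq_bigr => u _.
  rewrite /residual mulrBr mulr_sumr; congr (_ - _); ring.
rewrite sum3 [X in _ + X]big1 ?addr0 => [|u Bu]; last by rewrite residual_B ?mulr0.
pose N u := \sum_(v in K) ((u != v)%:R - E u v) * x v.
rewrite (eq_bigr (fun u => x u * (#|B|%:R * (sigma / rho)) -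
    x u * (\sum_(v in B) E u v * x v) + x u * N u)) => [|u Ku]; last first.
  by rewrite residual_K // new_vecP ?K_notB // -/(N u); ring.
rewrite (eq_bigr (P := fun v => v \in A) (fun u => - (x u * (\sum_(v in B) E u v * x v)) -
    x u * (\sum_(v in A) cut u v * x v))) => [|u Au]; last first.
  by rewrite residual_A // new_vecP ?A_notB //; ring.
rewrite !big_split /= !sumrN -mulr_suml -/sigma.
have exch (S : {set G}) : \sum_(u in S) x u * (\sum_(v in B) E u v * x v) =
    \sum_(v in B) x v * \sum_(u in S) E u v * x u.
  under eq_bigr do rewrite mulr_sumr.
  rewrite exchange_big /=; apply: eq_bigr => v _; rewrite mulr_sumr.
  by apply: eq_bigr => u _; ring.
rewrite !exch.
set p1 := \sum_(v in B) _; set p2 := \sum_(v in B) _.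
have p12 : p1 + p2 = \sum_(v in B) x v * pull v.
  by rewrite /p1 /p2 -big_split /=; apply: eq_bigr => v _; rewrite -mulrDr.
have s34 := sigma_ge; have r0 := rho_gt0.
have p_le : rho * (p1 + p2) <= #|B|%:R * ((sigma - 1 / 2) * (sigma - 1 / 2)).
  rewrite p12; apply: (@le_trans _ _ (rho * ((\sum_(v in B) x v) * (sigma - 1 / 2)))).
    rewrite ler_wpM2l ?(ltW r0) // mulr_suml; apply: ler_sum => v Bv.
    rewrite ler_wpM2l //; apply: le_trans (pull_le Bv) _.
    have : 0 <= C%:R * theta by rewrite mulr_ge0.
    by move: theta_small; rewrite mulrDl; lra.
  by rewrite !mulrA ler_wpM2r ?sum_B_le //; lra.
have := cut_sum_le; set q := \sum_(u in A) x u * _ => q_lt.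
have N0 u : 0 <= N u.
  apply: sumr_ge0 => v _; apply: mulr_ge0 => //; rewrite /E subr_ge0 ler_nat.
  by case: eqP => [->|_]; rewrite ?edge_irr ?leq_b1.
set m := \sum_(u in K) x u * N u.
have m0 : 0 <= m by apply: sumr_ge0 => u _; rewrite mulr_ge0.
rewrite -(pmulr_rgt0 _ r0).
have -> : rho * (sigma * (#|B|%:R * (sigma / rho)) - p1 + m + (- p2 - q)) =
    #|B|%:R * sigma ^+ 2 - rho * (p1 + p2) + rho * m - rho * q.
  by field; rewrite gt_eqF.
have sq : #|B|%:R * (1 / 2) <= #|B|%:R * sigma ^+ 2 -
    #|B|%:R * ((sigma - 1 / 2) * (sigma - 1 / 2)) :> R.
  by rewrite -mulrBr ler_wpM2l //; nra.
move: p_le sq.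
set Z := #|B|%:R * (_ * _); set U := #|B|%:R * sigma ^+ 2; set V := rho * (p1 + p2).
move=> hV hU.
have rm0 : 0 <= rho * m by rewrite mulr_ge0 // ltW.
case: gain => [/set0Pn[v Bv]|[k [l [Kk Kl kl nkl]]]].
  have B1 : 1 <= #|B|%:R :> R by rewrite ler1n; apply/card_gt0P; exists v.
  by lra.
have m_ge : 1 / 2 <= m.
  have Nk : 3 / 4 <= N k.
    rewrite /N (bigD1 l) //= kl /E (negPf nkl) subr0 mul1r.
    apply: ler_wpDr; last exact: x_K.
    apply: sumr_ge0 => v _; apply: mulr_ge0 => //; rewrite subr_ge0 ler_nat.
    by case: eqP => [->|_]; rewrite ?edge_irr ?leq_b1.
  rewrite /m (bigD1 k) //=.
  have : 0 <= \sum_(i in K | i != k) x i * N i by apply: sumr_ge0 => i _; rewrite mulr_ge0.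
  have : (3 / 4) * (3 / 4) <= x k * N k.
    by apply: ler_pM => //; rewrite ?x_K //; lra.
  by lra.
have : 1 / 2 <= rho * m by apply: le_trans m_ge _; rewrite ler_peMl.
have B0 : 0 <= #|B|%:R :> R by [].
by lra.
Qed.

Lemma rewire_lt (rhoE : rho = spectral_radius R G) :
  B != set0 \/ (exists k l, [/\ k \in K, l \in K, k != l & ~~ edge k l]) ->
  spectral_radius R G < spectral_radius R G'.
Proof.
move=> /rewire_gain; rewrite rhoE => lt; rewrite ltNge; apply/negP => le.
have := lt_le_trans lt (rayleigh (G := G') new_vec); apply/negP; rewrite -leNgt.
by apply: ler_wpM2r => //; exact: (@sqnorm_ge0 R G).
Qed.

End Compare.

(** * Graphs with large spectral radius *)

(** All the smallness conditions bear on delta, which is the inverse of a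
    constant M, and n is then taken large enough. The set W exists since small
    entries are frequent: the sum of all rho * x v is at most (s + 1) n, so no
    more than a quarter of the vertices have rho * x v > b. *)
Lemma improving_rewiring (R : realType) (s t C w : nat) : (0 < s)%N -> (0 < C)%N ->
  exists n0 : nat, forall G : graph, (n0 <= #|G|)%N ->
    (forall A : {set G}, (\sum_(u in A) #|nbrs_in A u| <= C * #|A|)%N) ->
    (forall K : {set G}, #|K| = s.+1 -> (#|common K| < t)%N) ->
    s%:R * #|G|%:R - s%:R ^+ 2 <= spectral_radius R G ^+ 2 ->
    0 <= spectral_radius R G ->
    exists K W : {set G}, [/\ #|K| = s, W \subset common K, #|W| = w &
      ~: (K :|: common K) != set0 \/
        (exists k l, [/\ k \in K, l \in K, k != l & ~~ edge k l]) ->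
      spectral_radius R G < spectral_radius R (rewire K (common K :\: W))].
Proof.
move=> s0 C0; pose sR : R := s%:R; pose tR : R := t%:R; pose c : R := C%:R.
pose b : R := 4 * (sR + 1); pose wR : R := w%:R.
have s1 : 1 <= sR by rewrite ler1n.
have c1 : 1 <= c by rewrite ler1n.
have t0 : 0 <= tR by exact: ler0n.
have w0 : 0 <= wR by exact: ler0n.
pose M : R := 8 * (sR + 1) + 12 * (sR * (tR + c)) + 12 * (sR * (wR * (b * tR))).
have b0 : 0 <= b by rewrite /b; lra.
have h1 : 0 <= sR * (tR + c) by rewrite mulr_ge0 //; lra.
have h2 : 0 <= sR * (wR * (b * tR)) by rewrite !mulr_ge0 //; lra.
have M0 : 0 < M by rewrite /M; lra.
pose delta := M^-1; pose theta := 3 * sR * delta.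
have d0 : 0 < delta by rewrite invr_gt0.
have dM : M * delta = 1 by rewrite divff // gt_eqF.
have le_M z : z <= M -> z * delta <= 1 by move/(ler_wpM2r (ltW d0)); rewrite dM.
have d_small : 8 * (sR + 1) * delta <= 1 by apply: le_M; rewrite /M; lra.
have th_small : (tR + c) * theta <= 1 / 4.
  have -> : (tR + c) * theta = (12 * (sR * (tR + c))) * delta / 4 by rewrite /theta; field.
  by rewrite ler_wpM2r // le_M // /M; lra.
have b_small : 2 * (wR * (b * (tR * theta))) < 1 / 2.
  have -> : 2 * (wR * (b * (tR * theta))) = (12 * (sR * (wR * (b * tR)))) * delta / 2.
    by rewrite /theta; field.
  by rewrite ltr_pM2r // -[ltRHS]dM ltr_pM2r // /M; lra.
have th0 : 0 <= theta by rewrite /theta !mulr_ge0 //; lra.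
pose eta := delta / (4 * c).
have eta0 : 0 < eta by rewrite divr_gt0 // mulr_gt0 //; lra.
pose B := Num.bound (4 * c ^+ 2 / eta).
pose Q : R := (B * (2 ^ B * t))%:R.
have Q0 : 0 <= Q by exact: ler0n.
pose m1 := Num.bound (4 * (sR ^+ 2 + Q + tR + sR) * M).
pose m2 := Num.bound (2 * (64 * c ^+ 3 / eta ^+ 2) ^+ 2).
exists (maxn (maxn m1 m2) (maxn (2 * s) (maxn (4 * w) 2))) => G.
rewrite !geq_max => /andP[/andP[Gm1 Gm2] /andP[Gs /andP[Gw G2]]] sparse no_bip rho2 rho0.
have G0 : (0 < #|G|)%N by exact: ltnW.
have [x [x01 [u0 xu0] eigen]] := perron R G0.
set rho := spectral_radius R G in rho2 rho0 eigen *.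
pose n : R := #|G|%:R.
have n2s : 2 * sR <= n by rewrite /n /sR -natrM ler_nat.
have n2 : 2 <= n by rewrite /n ler_nat.
have nw : 4 * wR <= n by rewrite /n /wR -natrM ler_nat.
have n_big : 4 * (sR ^+ 2 + Q + tR + sR) <= delta * n.
  have : 4 * (sR ^+ 2 + Q + tR + sR) * M <= n.
    apply: (@le_trans _ _ m1%:R); last by rewrite /n ler_nat.
    apply/ltW/archi_boundP; rewrite mulr_ge0 ?(ltW M0) //.
    by have := sqr_ge0 sR; lra.
  move/(ler_wpM2r (ltW d0)); rewrite -[leLHS]mulrA dM mulr1; by rewrite [leRHS]mulrC.
have rho2n : n / 2 <= rho ^+ 2.
  apply: le_trans rho2; rewrite -/n -/sR.
  have : 0 <= (sR - 1) * (n - sR) by rewrite mulr_ge0 //; lra.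
  have -> : (sR - 1) * (n - sR) = sR * n - sR ^+ 2 - n + sR by ring.
  lra.
have rho_big : 64 * c ^+ 3 <= eta ^+ 2 * rho.
  have e2 : 0 < eta ^+ 2 by rewrite exprn_gt0.
  rewrite [leRHS]mulrC -ler_pdivrMr // -(@ler_pXn2r _ 2) ?nnegrE //; last first.
    by apply: divr_ge0; [rewrite mulr_ge0 // exprn_ge0 //; lra|exact: ltW].
  have : 2 * (64 * c ^+ 3 / eta ^+ 2) ^+ 2 <= n.
    apply: (@le_trans _ _ m2%:R); last by rewrite /n ler_nat.
    by apply/ltW/archi_boundP; rewrite mulr_ge0 // sqr_ge0.
  lra.
have rho1 : 1 <= rho.
  rewrite -(@ler_pXn2r _ 2) ?nnegrE // expr1n; lra.
have heavy_le : (#|heavy x eta| <= B)%N.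
  have := few_heavy C0 sparse x01 eigen rho0 eta0 rho2n rho_big.
  rewrite mulrC -ler_pdivlMr // => le; rewrite -(ler_nat R); apply: le_trans le _.
  apply/ltW/archi_boundP; apply: divr_ge0; last exact: ltW.
  by rewrite mulr_ge0 // sqr_ge0.
pose K := heavy x (1 - delta).
have cK : #|K| = s.
  exact: (card_dominating s0 C0 sparse no_bip x01 eigen d0 d_small heavy_le rho2 n_big xu0).
have xout v : v \notin K -> x v <= theta.
  exact: (small_outside s0 C0 sparse no_bip x01 eigen d0 d_small heavy_le rho2 n_big xu0).
have few v : v \notin K -> (#|nbrs_in (common K) v| < t)%N.
  exact: (nbrs_common s0 C0 sparse no_bip x01 eigen d0 d_small heavy_le rho2 n_big xu0).
have cc : n - 2 * sR * delta * n <= #|common K|%:R.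
  exact: (card_common_dominating s0 C0 sparse no_bip x01 eigen d0 d_small heavy_le rho2 n_big xu0).
have x0 v : 0 <= x v by case/andP: (x01 v).
have n0 : 0 <= n by exact: ler0n.
have sum_x : \sum_v rho * x v <= (sR + 1) * n.
  under eq_bigr do rewrite -eigen.
  have -> : \sum_v \sum_(u | edge v u) x u = \sum_u x u * (degree u)%:R.
    transitivity (bform (fun=> 1) x).
      by apply: eq_bigr => v _; apply: eq_bigr => u _; rewrite mul1r.
    rewrite bform_sym; apply: eq_bigr => u _; rewrite -mulr_sumr; congr (_ * _).
    by rewrite /degree -sum1_card natr_sum; apply: eq_bigl => v; rewrite inE.
  rewrite (bigID (mem K)) /= mulrDl mul1r; apply: lerD.
    rewrite /sR -cK -sum1_card natr_sum mulr_suml; apply: ler_sum => u _.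
    by apply: ler_pM => //; [case/andP: (x01 u)|rewrite ler_nat max_card].
  apply: (@le_trans _ _ (theta * (c * n))).
    apply: (@le_trans _ _ (theta * \sum_(u : G) (degree u)%:R)).
      rewrite mulr_sumr big_mkcond; apply: ler_sum => u _.
      case: ifP => [nKu|_]; last by rewrite mulr_ge0.
      by rewrite ler_wpM2r // xout.
    by rewrite ler_wpM2l // (sum_degree_le R sparse).
  rewrite mulrA; apply: ler_piMl => //.
  have : 0 <= tR * theta by rewrite mulr_ge0.
  by move: th_small; rewrite mulrDl; lra.
pose A' := [set v in common K | rho * x v <= b].
have cA' : (w <= #|A'|)%N.
  have bad : b * #|common K :\: A'|%:R <= (sR + 1) * n.
    apply: le_trans sum_x; rewrite -sum1_card natr_sum mulr_sumr.
    rewrite [leLHS]big_mkcond; apply: ler_sum => v _.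
    rewrite mulr1; case: ifP => [|_]; last by rewrite mulr_ge0.
    by rewrite !inE => /andP[+ Kv]; rewrite Kv /= -ltNge => /ltW.
  have bad' : #|common K :\: A'|%:R <= n / 4.
    have sp : 0 < sR + 1 by lra.
    by rewrite -(ler_pM2l sp); move: bad; rewrite /b; lra.
  have sub : A' \subset common K by apply/subsetP=> v; rewrite inE => /andP[].
  have := cardsID A' (common K); rewrite (finset.setIidPr sub).
  move/(congr1 (fun k => k%:R : R)); rewrite natrD => cA.
  rewrite -(ler_nat R) -/wR.
  have : 8 * (sR + 1) * delta * n <= n by rewrite ler_piMl.
  have -> : 8 * (sR + 1) * delta * n = 4 * (2 * sR * delta * n) + 8 * (delta * n) by ring.
  have : 0 <= delta * n by rewrite mulr_ge0 // ltW.
  move: cc cA bad'; set z := 2 * sR * delta * n; set d := delta * n.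
  by lra.
have [W sW cW] := card_subset_of_size cA'.
exists K, W; split=> //.
  by apply: subset_trans sW _; apply/subsetP=> v; rewrite inE => /andP[].
apply: (@rewire_lt R G K W t C x rho theta b) => //.
- by rewrite cK.
- move=> k; rewrite inE => kK; apply: le_trans kK.
  by move: d_small; nra.
- by move=> v /few /ltnW.
- by apply: subset_trans sW _; apply/subsetP=> v; rewrite inE => /andP[].
- by move=> v /(subsetP sW); rewrite inE => /andP[].
- by rewrite cW.
Qed.

Lemma rewire_cone (G : graph) (K Z : {set G}) : [disjoint K & Z] ->
  minor_model (rewire K Z) (cone #|K| #|~: (K :|: Z)| (induced Z)).
Proof.
move=> dKZ; set m := #|~: _|.
pose g (b : cone #|K| m (induced Z)) : G :=
  match b with
  | inl i => enum_val i
  | inr (inl j) => enum_val j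
  | inr (inr z) => val z
  end.
have /choice[f fP] : forall v : rewire K Z, exists b, g b = v.
  move=> v; have [Kv|nKv] := boolP (v \in K).
    by exists (inl (enum_rank_in Kv v)); rewrite /g enum_rankK_in.
  have [Zv|nZv] := boolP (v \in Z); first by exists (inr (inr (Sub v Zv))).
  have Cv : v \in ~: (K :|: Z) by rewrite !inE negb_or nKv.
  by exists (inr (inl (enum_rank_in Cv v))); rewrite /g enum_rankK_in.
apply: (@hom_minor_model _ _ f) => [u v fuv|u v].
  by rewrite -[u]fP -[v]fP fuv.
case/andP=> nuv e; move: (fP u) (fP v); case: (f u) => [i|[i|a]]; case: (f v) => [j|[j|b']] //=.
- by move=> iu jv; apply: contraNneq nuv => ij; rewrite -iu -jv ij.
- move=> iu jv; have := enum_valP i; have := enum_valP j; rewrite iu jv !inE !negb_or.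
  case/andP=> /negPf Kv /negPf Zv /andP[/negPf Ku /negPf Zu].
  by move: e; rewrite Ku Kv Zu.
- move=> iu bv; have := enum_valP i; rewrite iu inE inE negb_or => /andP[/negPf Ku /negPf Zu].
  have Kv : v \in K = false by rewrite -bv (disjointFl dKZ (valP b')).
  by move: e; rewrite Ku Kv Zu.
- move=> au jv; have := enum_valP j; rewrite jv inE inE negb_or => /andP[/negPf Kv /negPf Zv].
  have Ku : u \in K = false by rewrite -au (disjointFl dKZ (valP a)).
  by move: e; rewrite Ku Kv Zv andbF.
- move=> au bv; have euv : @edge G u v.
    move: e; have -> : u \in K = false by rewrite -au (disjointFl dKZ (valP a)).
    have -> : v \in K = false by rewrite -bv (disjointFl dKZ (valP b')).
    by move=> /= /and3P[].
  by rewrite -au -bv in euv.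
Qed.

Lemma spanning_book (G : graph) (K : {set G}) :
  (forall k v, k \in K -> k != v -> edge k v) ->
  has_spanning (book #|K| (#|G| - #|K|)%N) G.
Proof.
move=> eK; have cC : (#|G| - #|K| = #|~: K|)%N by rewrite -(cardsC K) addKn.
rewrite cC; pose f (b : book #|K| #|~: K|) : G :=
  match b with inl i => enum_val i | inr j => enum_val j end.
have f_inj : injective f.
  move=> [i|i] [j|j] /=.
  - by move/enum_val_inj => ->.
  - by move=> e; have := enum_valP j; rewrite -e inE enum_valP.
  - by move=> e; have := enum_valP i; rewrite e inE enum_valP.
  - by move/enum_val_inj => ->.
exists f; first by apply: inj_card_bij => //; rewrite card_sum !card_ord cardsC.
move=> [i|i] [j|j] //= e.
- by apply: eK; rewrite ?enum_valP //; apply: contra e => /eqP/enum_val_inj ->.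
- apply: eK; rewrite ?enum_valP //; apply/eqP => h; have := enum_valP j.
  by rewrite -h inE enum_valP.
- rewrite edge_sym; apply: eK; rewrite ?enum_valP //; apply/eqP => h.
  by have := enum_valP i; rewrite -h inE enum_valP.
Qed.

Lemma spanning_bookP (G : graph) (s m : nat) : has_spanning (book s m) G ->
  exists2 K : {set G}, #|K| = s & forall k v, k \in K -> k != v -> edge k v.
Proof.
move=> [f f_bij f_hom]; have [g fK gK] := f_bij.
exists [set f (inl i) | i in 'I_s].
  by rewrite card_imset ?card_ord // => i j /(bij_inj f_bij)[].
move=> _ v /imsetP[i _ ->] nv; rewrite -[v]gK; apply: f_hom.
have : inl i != g v by apply: contraNneq nv => ->; rewrite gK.
by case: (g v).
Qed.

(** The test vector takes the value sqrt m on the spine and sqrt s on the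
    pages, so that both halves have the same norm. *)
Lemma book_radius_ge (R : realType) (s m : nat) : (0 < s)%N -> (0 < m)%N ->
  (s%:R - 1) / 2 + Num.sqrt (s%:R * m%:R) <= spectral_radius R (book s m).
Proof.
move=> s0 m0; pose p : R := Num.sqrt m%:R; pose q : R := Num.sqrt s%:R.
have p2 : p * p = m%:R by rewrite -expr2 sqr_sqrtr.
have q2 : q * q = s%:R by rewrite -expr2 sqr_sqrtr.
have pq : Num.sqrt (s%:R * m%:R) = q * p by rewrite sqrtrM.
have sR0 : 0 < s%:R :> R by rewrite ltr0n.
have mR0 : 0 < m%:R :> R by rewrite ltr0n.
pose y (b : book s m) : R := match b with inl _ => p | inr _ => q end.
have ny : sqnorm y = 2 * (s%:R * m%:R).
  rewrite /sqnorm /inner big_sumType /= !sumr_const !card_ord p2 q2.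
  by rewrite -(mulr_natr m%:R s) -(mulr_natr s%:R m); ring.
have qy : qform y = s%:R * m%:R * (s%:R - 1) + 2 * (s%:R * m%:R) * (q * p).
  rewrite /qform /bform big_sumType /=.
  have row_l (i : 'I_s) : \sum_(v : book s m | book_edge (inl i) v) p * y v =
      p * (p * (s%:R - 1) + q * m%:R).
    rewrite -mulr_sumr; congr (_ * _); rewrite big_mkcond big_sumType /=.
    rewrite sumr_const card_ord -(mulr_natr q m); congr (_ + _).
    rewrite -big_mkcond sumr_const -(mulr_natr p); congr (_ * _).
    rewrite (eq_card (B := predC1 i)) => [|j]; last by rewrite !inE eq_sym.
    by rewrite cardC1 card_ord -subn1 natrB.
  have row_r (j : 'I_m) : \sum_(v : book s m | book_edge (inr j) v) q * y v =
      q * (p * s%:R).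
    rewrite -mulr_sumr; congr (_ * _); rewrite big_mkcond big_sumType /=.
    rewrite [X in _ + X]big1_eq addr0 sumr_const card_ord; exact/esym/mulr_natr.
  transitivity (\sum_(i < s) p * (p * (s%:R - 1) + q * m%:R) +
      \sum_(j < m) q * (p * s%:R)).
    by congr (_ + _); apply: eq_bigr => i _; [exact: row_l|exact: row_r].
  rewrite !sumr_const !card_ord -(mulr_natr _ s) -(mulr_natr (q * _) m).
  rewrite mulrDr mulrA p2; ring.
have := rayleigh y; rewrite ny qy pq.
have sm : 0 < 2 * (s%:R * m%:R) :> R by rewrite !mulr_gt0.
move=> le; rewrite -(ler_pM2r sm); apply: le_trans le.
by rewrite le_eqVlt; apply/orP; left; apply/eqP; field.
Qed.

(** Let S be the sum of the entries over K and b the largest entry outside K.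
    The eigenvalue equations give rho b <= S + (a - 1) b and (rho - #|K| + 1)
    S <= #|K| #|G| b; multiply these and cancel. *)
Lemma spanning_radius_le (R : realType) (G : graph) (K : {set G}) (a : nat) :
  (0 < #|K|)%N -> (forall v, v \notin K -> (#|nbrs_in (~: K) v| < a)%N) ->
  a%:R < spectral_radius R G ->
  (spectral_radius R G - #|K|%:R + 1) * (spectral_radius R G - a%:R + 1) <=
    #|K|%:R * #|G|%:R.
Proof.
move=> K0 deg; set rho := spectral_radius R G => rho_a.
have /card_gt0P[k0 Kk0] := K0.
have [x [x01 [u0 xu0] eigen]] : exists x : G -> R, [/\ forall v, 0 <= x v <= 1,
    exists u, x u = 1 & forall v, \sum_(u | edge v u) x u = rho * x v].
  by apply: perron; apply/card_gt0P; exists k0.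
have x0 v : 0 <= x v by case/andP: (x01 v).
have a0 : 0 <= a%:R :> R by [].
pose S := \sum_(k in K) x k.
have S0 : 0 <= S by apply: sumr_ge0.
have S_out v : v \notin K -> forall b : R, (forall u, u \notin K -> x u <= b) ->
    0 <= b -> rho * x v <= S + (a%:R - 1) * b.
  move=> nKv b xb b0; rewrite -eigen (bigID (mem K)) /=; apply: lerD.
    rewrite big_mkcondl; apply: ler_sum => k _.
    by case: ifP.
  apply: (@le_trans _ _ (\sum_(u in nbrs_in (~: K) v) b)).
    rewrite (eq_bigl (mem (nbrs_in (~: K) v))) => [|u]; last by rewrite !inE andbC.
    by apply: ler_sum => u; rewrite !inE => /andP[/xb].
  rewrite sumr_const -[_ *+ _]mulr_natl ler_wpM2r // lerBrDr natr1 ler_nat.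
  exact: deg.
have [b [b0 xb bE]] : exists b : R, [/\ 0 <= b,
    forall u, u \notin K -> x u <= b & rho * b <= S + (a%:R - 1) * b].
  have [v0 nKv0|noK] := pickP [pred v | v \notin K]; last first.
    exists 0; split=> // [u nKu|]; last by rewrite !mulr0 addr0.
    by have := noK u; rewrite /= nKu.
  have [v nKv maxv] : exists2 v, v \notin K & forall u, u \notin K -> x u <= x v.
    by case: (arg_maxP x nKv0) => v nKv maxv; exists v.
  by exists (x v); split=> //; exact: S_out.
have ra : 0 < rho - a%:R + 1 by lra.
have xS k : k \in K -> x k <= S.
  by move=> Kk; rewrite /S (bigD1 k) //= lerDl sumr_ge0.
have S_gt0 : 0 < S.
  rewrite lt_neqAle S0 andbT; apply/negP => /eqP SE.
  have b_le : b * (rho - a%:R + 1) <= 0 by move: bE; rewrite -SE; lra.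
  have bz : b <= 0 by move: b_le; rewrite pmulr_lle0.
  have : x u0 <= 0.
    have [Ku|nKu] := boolP (u0 \in K); first by rewrite SE xS.
    by apply: le_trans (xb _ nKu) bz.
  by rewrite xu0 ler10.
have rowK : rho * S <= #|K|%:R * S - S + #|K|%:R * (#|G|%:R * b).
  have -> : rho * S = \sum_(k in K) rho * x k by rewrite mulr_sumr.
  have -> : #|K|%:R * S - S + #|K|%:R * (#|G|%:R * b) =
      \sum_(k in K) (S - x k + #|G|%:R * b).
    rewrite big_split sumrB /= !sumr_const -(mulr_natl S) -(mulr_natl (_ * b)).
    by rewrite -/S.
  apply: ler_sum => k Kk; rewrite -eigen (bigID (mem K)) /=; apply: lerD.
    have -> : S - x k = \sum_(u in K | u != k) x u.
      have -> : S = x k + \sum_(u in K | u != k) x u by rewrite /S (bigD1 k).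
      by ring.
    rewrite [leLHS]big_mkcond [leRHS]big_mkcond; apply: ler_sum => u _.
    case: (boolP (edge k u)) => /= [e|_]; last by case: ifP.
    have uk : u != k by rewrite eq_sym (edge_neq e).
    by rewrite uk andbT.
  apply: (@le_trans _ _ (\sum_(u : G) b)); last first.
    by rewrite sumr_const -(mulr_natl b).
  rewrite [leLHS]big_mkcond; apply: ler_sum => u _.
  by case: ifP => // /andP[_ /xb].
rewrite -(ler_pM2r S_gt0); set s := #|K|%:R in rowK *; set n := #|G|%:R in rowK *.
have h1 : (rho - s + 1) * S <= s * (n * b) by lra.
have h2 : (rho - s + 1) * S * (rho - a%:R + 1) <= s * (n * b) * (rho - a%:R + 1).
  by rewrite ler_wpM2r // ltW.
have h3 : s * n * (b * (rho - a%:R + 1)) <= s * n * S.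
  by rewrite ler_wpM2l // ?mulr_ge0 //; lra.
have -> : (rho - s + 1) * (rho - a%:R + 1) * S = (rho - s + 1) * S * (rho - a%:R + 1) by ring.
apply: le_trans h2 _; apply: le_trans h3.
by rewrite le_eqVlt; apply/orP; left; apply/eqP; ring.
Qed.

(** * Extremal graphs *)

Section Extremal.
Variables (R : realType) (HH : graph -> Prop).
Hypothesis HH_nonempty : exists H : graph, HH H.
Hypothesis HH_min_degree : forall H : graph, HH H -> (1 <= min_degree H)%N.
Hypothesis HH_not_star : forall H : graph, HH H -> ~ is_star H.

Lemma card_common_minor_free (G : graph) (K : {set G}) :
  minor_free HH G -> #|K| = (gamma HH).+1 ->
  (#|common K| < alpha HH + (gamma HH).+1)%N.
Proof.
move=> mf cK; rewrite ltnNge; apply/negP; rewrite -cK => le.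
apply: (minor_free_no_book HH_nonempty HH_min_degree HH_not_star mf).
rewrite -cK; apply: common_nbrs_book le _ => k x Kk /commonP; exact.
Qed.

(** Of the w + gamma HH vertices of W, as many as K has serve to make K a
    clique by contraction, and w become the isolated vertices whose number can
    then be raised at will. *)
Lemma minor_free_rewire (w : nat) (G : graph) (K W : {set G}) :
  (forall Y : graph, minor_free HH (cone (gamma HH) w Y) ->
     forall m, minor_free HH (cone (gamma HH) m Y)) ->
  minor_free HH G -> #|K| = gamma HH -> W \subset common K ->
  #|W| = (w + gamma HH)%N -> minor_free HH (rewire K (common K :\: W)).
Proof.
move=> isolated mf cK sW cW; set Z := common K :\: W.
have dKZ : [disjoint K & Z].
  by apply: disjointWr (common_disjoint K); exact: subsetDl.
apply: (minor_free_model (rewire_cone dKZ)); rewrite cK; apply: isolated.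
rewrite -cK; apply: minor_free_model mf; apply: (@cone_minor_model G K W).
- by rewrite cW cK.
- by apply/pred0P=> v /=; rewrite inE; case: (v \in W).
- move=> k v Kk; rewrite inE => /orP[/(subsetP sW)/commonP|]; first exact.
  by rewrite inE => /andP[_ /commonP]; exact.
Qed.

(** Comparison with the book gives rho ^+ 2 >= s (n - s), so that
    [improving_rewiring] applies; by extremality there is nothing left to
    improve. *)
Lemma extremal_spanning_book : exists n0 : nat, forall G : graph,
  (n0 <= #|G|)%N -> minor_free HH G ->
  (forall G' : graph, minor_free HH G' -> #|G'| = #|G| ->
     spectral_radius R G' <= spectral_radius R G) ->
  has_spanning (book (gamma HH) (#|G| - gamma HH)%N) G.
Proof.
set s := gamma HH; have s0 : (0 < s)%N by exact: gamma_gt0.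
have [C sparse] := minor_free_sparse HH_nonempty.
have [w isolated] := isolated_vertices_free HH_nonempty HH_min_degree HH_not_star.
have [n1 dom] := @improving_rewiring R s (alpha HH + s.+1) C.+1 (w + s) s0 (ltn0Sn C).
exists (maxn n1 s.+1) => G; rewrite geq_max => /andP[Gn1 Gs] mf maxG.
have ns0 : (0 < #|G| - s)%N by rewrite subn_gt0.
have card_book : #|book s (#|G| - s)%N| = #|G|.
  by rewrite card_sum !card_ord subnKC // ltnW.
have rho_ge : Num.sqrt (s%:R * (#|G| - s)%:R) <= spectral_radius R G.
  have book_free : minor_free HH (book s (#|G| - s)%N) by exact: minor_free_book.
  apply: le_trans (maxG _ book_free card_book).
  apply: le_trans (book_radius_ge R s0 ns0).
  by rewrite lerDr divr_ge0 // subr_ge0 ler1n.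
have sq0 := sqrtr_ge0 (s%:R * (#|G| - s)%:R : R).
have [||||K [W [cK sW cW gain]]] := dom G Gn1.
- move=> A; apply: leq_trans (sparse G mf A) _.
  by rewrite leq_mul2r leqnSn orbT.
- by move=> K; exact: card_common_minor_free.
- have := rho_ge; rewrite -(@ler_pXn2r _ 2) ?nnegrE ?(le_trans sq0) //.
  rewrite sqr_sqrtr ?mulr_ge0 // natrB ?(ltnW Gs) //.
  by apply: le_trans; rewrite mulrBr expr2.
- exact: le_trans rho_ge.
have nogain : ~ (~: (K :|: common K) != set0 \/
    exists k l, [/\ k \in K, l \in K, k != l & ~~ edge k l]).
  move=> /gain; apply/negP; rewrite -leNgt; apply: maxG => //.
  exact: (minor_free_rewire isolated).
rewrite -cK; apply: spanning_book => k v Kk kv.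
have [Kv|nKv] := boolP (v \in K).
  by apply: contraT => nkv; case: nogain; right; exists k, v.
have [/commonP|nCv] := boolP (v \in common K); first exact.
case: nogain; left; apply/set0Pn; exists v.
by rewrite in_setC in_setU negb_or nKv.
Qed.

(** Together with K and alpha HH neighbours outside K, the vertex v would make
    a book that is excluded. *)
Lemma degree_outside (G : graph) (K : {set G}) (v : G) :
  minor_free HH G -> #|K| = gamma HH ->
  (forall k u, k \in K -> k != u -> edge k u) -> v \notin K ->
  (#|nbrs_in (~: K) v| < alpha HH)%N.
Proof.
move=> mf cK eK nKv; rewrite ltnNge; apply/negP => le.
apply: (minor_free_no_book HH_nonempty HH_min_degree HH_not_star mf); rewrite -cK.
apply: (@clique_star_book _ K [set v] (nbrs_in (~: K) v) _ le).
- by apply/set0Pn; exists v; rewrite inE.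
- by move=> x y; rewrite !inE => /eqP-> /eqP->; exact: connect0.
- by rewrite disjoints1 inE edge_irr andbF.
- by move=> k x Kk _; exact: eK.
- apply/pred0P=> x /=; apply/negP; rewrite !inE => /andP[Kx /orP[/eqP xv|]].
    by rewrite xv (negPf nKv) in Kx.
  by rewrite Kx.
- by move=> b; rewrite inE => /andP[_ e]; exists v; rewrite ?inE.
Qed.

(** Let q = sqrt (s n). If the bound failed, the two factors in
    [spanning_radius_le] would exceed q + 1 / 2 + (a - s) / 2 and q + 1 / 2 -
    (a - s) / 2, with product at least q ^+ 2 + q - ((a - s) / 2) ^+ 2; this
    is too large as soon as q >= ((a - s) / 2) ^+ 2. *)
Lemma spanning_book_radius_le : exists n0 : nat, forall G : graph,
  (n0 <= #|G|)%N -> minor_free HH G ->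
  has_spanning (book (gamma HH) (#|G| - gamma HH)%N) G ->
  spectral_radius R G <= Num.sqrt ((gamma HH)%:R * #|G|%:R) +
    ((alpha HH)%:R + (gamma HH)%:R - 1) / 2.
Proof.
set s : R := (gamma HH)%:R; set a : R := (alpha HH)%:R.
have s1 : 1 <= s by rewrite ler1n gamma_gt0.
have a0 : 0 <= a by exact: ler0n.
(* The first term serves the final comparison, and the second one the
   hypothesis a < rho of [spanning_radius_le]. *)
pose D := ((a - s) / 2) ^+ 2 + (a + s) ^+ 2.
have D0 : 0 <= D by rewrite addr_ge0 ?sqr_ge0.
exists (Num.bound (D ^+ 2)) => G Gn mf /spanning_bookP[K cK eK].
set n : R := #|G|%:R; pose q := Num.sqrt (s * n).
have n0 : 0 <= n by exact: ler0n.
have q2 : q ^+ 2 = s * n by rewrite sqr_sqrtr // mulr_ge0 //; lra.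
have q0 : 0 <= q by exact: sqrtr_ge0.
have nD : D ^+ 2 <= n.
  apply: (@le_trans _ _ (Num.bound (D ^+ 2))%:R); last by rewrite /n ler_nat.
  by apply/ltW/archi_boundP; exact: sqr_ge0.
have qD : D <= q.
  rewrite -(@ler_pXn2r _ 2) ?nnegrE // q2; apply: le_trans nD _.
  by rewrite ler_peMl.
rewrite -/q; apply: contraT; rewrite -ltNge => lt.
have rho_a : a < spectral_radius R G.
  apply: le_lt_trans lt.
  have as_le : a + s <= (a + s) ^+ 2 by rewrite expr2 ler_peMr //; lra.
  have asD : (a + s) ^+ 2 <= D by rewrite lerDr sqr_ge0.
  by move: as_le asD qD; set Y := (a + s) ^+ 2; lra.
have K0 : (0 < #|K|)%N by rewrite cK gamma_gt0.
have := spanning_radius_le K0 (fun v => degree_outside mf cK eK (v := v)) rho_a.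
rewrite cK -/s -/a -/n -q2; set rho := spectral_radius R G in lt rho_a *.
have qd : ((a - s) / 2) ^+ 2 <= q.
  by apply: le_trans qD; rewrite lerDl sqr_ge0.
have e1 : q + 1 / 2 + (a - s) / 2 < rho - s + 1 by lra.
have e2 : q + 1 / 2 + (s - a) / 2 < rho - a + 1 by lra.
have dq : (a - s) / 2 <= q + 1 / 2 by nra.
have dq' : (s - a) / 2 <= q + 1 / 2 by nra.
have f1 : 0 <= q + 1 / 2 + (a - s) / 2 by lra.
have f2 : 0 <= q + 1 / 2 + (s - a) / 2 by lra.
have := ltr_pM f1 f2 e1 e2.
have -> : (q + 1 / 2 + (a - s) / 2) * (q + 1 / 2 + (s - a) / 2) =
  q ^+ 2 + q + 1 / 4 - ((a - s) / 2) ^+ 2 by field.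
by set X := (rho - s + 1) * _; lra.
Qed.

End Extremal.
Local Open Scope classical_set_scope.
Local Open Scope ring_scope.

Theorem theorem1p1 (R : realType) (HH : graph -> Prop)
    (HH_nonempty : exists H : graph, HH H)
    (HH_min_degree : forall H : graph, HH H -> (1 <= min_degree H)%N)
    (HH_not_star : forall H : graph, HH H -> ~ is_star H) :
  (\forall n \near \oo, forall G : graph, SPEX R n HH G ->
     has_spanning (book (gamma HH) (n - gamma HH)) G) /\
  (exists e1 e2 : nat -> R,
     [/\ e1 =O_\oo (fun n : nat => (Num.sqrt n%:R)^-1 : R),
         e2 =O_\oo (fun n : nat => (Num.sqrt n%:R)^-1 : R) &
         \forall n \near \oo,
           Num.sqrt ((gamma HH)%:R * n%:R)
             + ((gamma HH)%:R - 1) / 2 + e1 n <= spex R n HH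
           /\ spex R n HH <= Num.sqrt ((gamma HH)%:R * n%:R)
             + ((alpha HH)%:R + (gamma HH)%:R - 1) / 2 + e2 n]).
Proof.
have s0 := gamma_gt0 HH_nonempty HH_min_degree HH_not_star.
have [n1 extremal] := extremal_spanning_book R HH_nonempty HH_min_degree HH_not_star.
have [n2 upper] := spanning_book_radius_le R HH_nonempty HH_min_degree HH_not_star.
have spanning (G : graph) (n : nat) : (n1 <= n)%N -> (0 < n)%N -> SPEX R n HH G ->
    has_spanning (book (gamma HH) (n - gamma HH)) G.
  move=> n1n n0 [[cG mf] rhoG]; subst n; apply: extremal => // G' mf' cG'.
  by rewrite rhoG; apply: spex_ub.
have book_order (n : nat) : (gamma HH <= n)%N ->
    minor_free_order n HH (book (gamma HH) (n - gamma HH)).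
  move=> gn; split; last exact: minor_free_book.
  by rewrite card_sum !card_ord subnKC.
split.
  exists (maxn n1 1) => // n /=; rewrite geq_max => /andP[n1n n0] G.
  exact: spanning.
set s : R := (gamma HH)%:R.
have s1 : 1 <= s by rewrite ler1n.
exists (fun n => - s ^+ 2 * (Num.sqrt n%:R)^-1), (fun=> 0); split.
- apply/eqO_exP; exists (s ^+ 2); first by rewrite exprn_gt0 // (lt_le_trans ltr01).
  by apply: nearW => n; rewrite normrM normrN (ger0_norm (sqr_ge0 s)).
- apply/eqO_exP; exists 1 => //; apply: nearW => n.
  by rewrite normr0 mul1r normr_ge0.
exists (maxn (gamma HH).+1 (maxn n1 n2)) => // n /=; rewrite !geq_max.
move=> /andP[gn /andP[n1n n2n]]; have n0 : (0 < n)%N by exact: leq_ltn_trans gn.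
split; last first.
  have [|G GS] := @spex_attained R HH n n0.
    by exists (book (gamma HH) (n - gamma HH)); exact/book_order/ltnW.
  have sp := spanning G n n1n n0 GS.
  case: GS => -[cG mf] <-; rewrite addr0; subst n; exact: upper.
apply: le_trans (spex_ub R n0 (book_order n (ltnW gn))).
have ns0 : (0 < n - gamma HH)%N by rewrite subn_gt0.
apply: le_trans (book_radius_ge R s0 ns0); rewrite -/s natrB ?(ltnW gn) // -/s.
set N : R := n%:R; set q := Num.sqrt (s * N); set p := Num.sqrt (s * (N - s)).
have sN : s <= N by rewrite ler_nat ltnW.
have r0 : 0 < Num.sqrt N by rewrite sqrtr_gt0 ltr0n.
have p0 : 0 <= p by exact: sqrtr_ge0.
have rq : Num.sqrt N <= q by rewrite ler_wsqrtr // ler_peMl // (le_trans ler01) // (le_trans s1).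
have pq : p <= q by rewrite ler_wsqrtr // ler_wpM2l ?(le_trans ler01) // lerBlDr lerDl (le_trans ler01).
(* (q - p) (q + p) = s ^ 2 and q + p is at least the square root of n. *)
have diff : (q - p) * (q + p) = s ^+ 2.
  rewrite -subr_sqr /q /p !sqr_sqrtr; first by ring.
    by rewrite mulr_ge0 ?subr_ge0 // (le_trans ler01).
  by rewrite mulr_ge0 // (le_trans ler01).
have : q - p <= s ^+ 2 / Num.sqrt N.
  by rewrite ler_pdivlMr // -diff ler_wpM2l ?subr_ge0 //; lra.
by rewrite mulNr; lra.
Qed.
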